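(* Let $Q$ be an affine quiver and let $M$ be an indecomposable finite-dimensional representation of $Q$ over $\mathbb{C}$. Then the transverse quiver Grassmannian $\mathrm{Tr}(M)$ of $M$ satisfies $$\mathrm{Tr}(M)=\{N\in \mathrm{Gr}(M)\ \mid\ \mathrm{Ext}^1(N,M/N)=0\},$$ where $\mathrm{Gr}(M)$ is the quiver Grassmannian of $M$ (the set of all subrepresentations of $M$) and $\mathrm{Ext}^1$ is computed in the category of finite-dimensional representations of $Q$ over $\mathbb{C}$.
   Context: An affine quiver is an acyclic orientation $Q=(Q_0,Q_1)$ of an extended Dynkin diagram of type $\widetilde A$, $\widetilde D$ or $\widetilde E$; $Q_0$ is its set of vertices and $Q_1$ its set of arrows. $\mathrm{rep}(Q)$ is the category of finite-dimensional representations of $Q$ over $\mathbb{C}$, identified with the category of finitely generated left modules over the path algebra $\mathbb{C}Q$. The dimension vector of a representation $M$ is denoted $\mathbf{dim}\, M\in\mathbb{Z}_{\ge 0}^{Q_0}$. Quiver Grassmannians: for a representation $M$ and $\mathbf{e}\in\mathbb{Z}_{\ge0}^{Q_0}$, $\mathrm{Gr}_{\mathbf e}(M)=\{N \text{ subrepresentation of } M \mid \mathbf{dim}\, N=\mathbf e\}$, and $\mathrm{Gr}(M)=\bigsqcup_{\mathbf e\in\mathbb{Z}_{\ge0}^{Q_0}}\mathrm{Gr}_{\mathbf e}(M)$. A representation $M$ is rigid if $\mathrm{Ext}^1(M,M)=0$. Since $Q$ is affine, every indecomposable representation is preprojective, regular or preinjective, and each regular component of the Auslander-Reiten quiver is a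 tube. Each indecomposable regular representation is uniquely of the form $R^{(n)}$ with $R$ quasi-simple (i.e. a simple object of the abelian category of regular representations) and $n\ge1$ its quasi-length; here $R^{(n)}$ is the indecomposable regular representation with quasi-socle $R$ and quasi-length $n$. By convention $R^{(0)}=0$. For $n\le m$, $R^{(m)}$ has a unique subrepresentation isomorphic to $R^{(n)}$ that is regular of quasi-length $n$ (the image of the monomorphism $\iota: R^{(n)}\to R^{(m)}$ given by the ray of the tube), and $R^{(n)}$ is identified with this subrepresentation of $R^{(m)}$; accordingly $\mathrm{Gr}(R^{(n)})$ is regarded as a subset of $\mathrm{Gr}(R^{(m)})$. Transverse quiver Grassmannian: let $M$ be an indecomposable representation of the affine quiver $Q$. (i) If $M$ is rigid, set $\mathrm{Tr}(M)=\mathrm{Gr}(M)$. (ii) If $M$ is not rigid, then $M$ is regular and lies in a tube of some rank $p\ge1$. Let $R_i$, $i\in\mathbb{Z}/p\mathbb{Z}$, be the quasi-simple representations in this tube, ordered so that $\tau R_i\simeq R_{i-1}$ for all $i$, where $\tau$ is the Auslander-Reiten translation. Up to relabeling, $M\simeq R_0^{(lp+k)}$ for unique integers $l\ge1$ and $0\le k\le p-1$. Then $$\mathrm{Tr}(M)=\mathrm{Gr}(M)\setminus\{N\in\mathrm{Gr}(M)\mid R_0^{(k+1)}\subset N\subset R_0^{(lp-1)}\},$$ where $R_0^{(k+1)}$ and $R_0^{(lp-1)}$ are viewed as the unique regular subrepresentations of $M=R_0^{(lp+k)}$ of quasi-lengths $k+1$ and $lp-1$ respectively, i.e. the images of the monomorphisms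 $R_0^{(k+1)}\to M$ and $R_0^{(lp-1)}\to M$ given by the ray of the tube (the removed set is empty if $k+1>lp-1$). *)

(* Defs.v *)
From Stdlib Require Import Relation_Operators.
From HB Require Import structures.
From mathcomp Require Import all_boot all_order all_algebra.
From mathcomp Require Import boolp classical_sets reals complex.

Set Implicit Arguments.
Unset Strict Implicit.
Unset Printing Implicit Defensive.

Import GRing.Theory.
Local Open Scope classical_set_scope.
Local Open Scope ring_scope.

Record quiver := Quiver {
  vertex : finType;
  arrow : finType;
  src : arrow -> vertex;
  tgt : arrow -> vertex }.

Definition adj (Q : quiver) : rel (vertex Q) :=
  fun i j => [exists a : arrow Q, (src a == i) && (tgt a == j)].

Definition acyclic (Q : quiver) : Prop :=
  forall a : arrow Q, ~~ connect (@adj Q) (tgt a) (src a).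

Inductive extended_dynkin := At of nat | Dt of nat | Et6 | Et7 | Et8.

Definition extended_dynkin_wf (D : extended_dynkin) : bool :=
  match D with
  | At n => (1 <= n)%N
  | Dt n => (4 <= n)%N
  | _ => true
  end.

Definition dynkin_rank (D : extended_dynkin) : nat :=
  match D with At n => n | Dt n => n | Et6 => 6 | Et7 => 7 | Et8 => 8 end.

(** The edges of the diagram on the vertices [0, ..., dynkin_rank D], as a list
    with multiplicity; [At 1] has a double edge.  In [Dt n] the vertices
    [2, ..., n - 2] form the spine; in [Et6], [Et7], [Et8] the vertex [0] is the
    branch point, with arms of lengths (2,2,2), (1,3,3) and (1,2,5). *)
Definition dynkin_edges (D : extended_dynkin) : seq (nat * nat) :=
  match D with
  | At n => [seq (i, i.+1 %% n.+1)%N | i <- iota 0 n.+1]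
  | Dt n => [:: (0, 2); (1, 2)]%N ++ [seq (i, i.+1) | i <- iota 2 (n - 4)]
            ++ [:: (n - 2, n - 1); (n - 2, n)]%N
  | Et6 => [:: (0, 1); (1, 2); (0, 3); (3, 4); (0, 5); (5, 6)]%N
  | Et7 => [:: (0, 1); (0, 2); (2, 3); (3, 4); (0, 5); (5, 6); (6, 7)]%N
  | Et8 => [:: (0, 1); (0, 2); (2, 3); (0, 4); (4, 5); (5, 6); (6, 7);
               (7, 8)]%N
  end.

Definition orientation_of (D : extended_dynkin) (Q : quiver) : Prop :=
  exists (f : vertex Q -> 'I_(dynkin_rank D).+1)
         (g : arrow Q -> 'I_(size (dynkin_edges D))),
    [/\ bijective f, bijective g
      & forall a : arrow Q,
          let e := nth (0, 0)%N (dynkin_edges D) (g a) in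
          let s : nat := f (src a) in
          let t : nat := f (tgt a) in
          (s, t) = e \/ (t, s) = e].

Definition affine_quiver (Q : quiver) : Prop :=
  acyclic Q /\
  exists D : extended_dynkin, extended_dynkin_wf D /\ orientation_of D Q.

Section Representations.
Variables (F : fieldType) (Q : quiver).

Record rep := Rep {
  space :> vertex Q -> vectType F;
  rmap : forall a : arrow Q, 'Hom(space (src a), space (tgt a)) }.

Record hom (M N : rep) := RepHom {
  hom_fun :> forall v : vertex Q, 'Hom(M v, N v);
  hom_comm : forall a : arrow Q,
    (hom_fun (tgt a) \o rmap M a = rmap N a \o hom_fun (src a))%VF }.

Definition is_zero (M : rep) : Prop := forall v, \dim {:M v} = 0%N.

Definition iso (M N : rep) : Prop :=
  exists f : hom M N, forall v, lker (f v) = 0%VS /\ limg (f v) = fullv.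

Definition split_mono (M N : rep) (f : hom M N) : Prop :=
  exists r : hom N M, forall v, (r v \o f v = \1)%VF.

Definition split_epi (M N : rep) (f : hom M N) : Prop :=
  exists s : hom N M, forall v, (f v \o s v = \1)%VF.

Definition factors_right (X Y Z : rep) (h : hom X Z) (g : hom Y Z) : Prop :=
  exists k : hom X Y, forall v, (h v = g v \o k v)%VF.

Definition factors_left (X Y Z : rep) (h : hom X Z) (f : hom X Y) : Prop :=
  exists k : hom Y Z, forall v, (h v = k v \o f v)%VF.

Record subrep (M : rep) := SubRep {
  sub_space :> forall v : vertex Q, {vspace M v};
  sub_stable : forall a : arrow Q,
    (rmap M a @: sub_space (src a) <= sub_space (tgt a))%VS }.

Definition sub_le (M : rep) (U W : subrep M) : Prop :=
  forall v, (U v <= W v)%VS.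

Definition rep_of_sub (M : rep) (N : subrep M) : rep :=
  @Rep (fun v => subvs_of (N v))
    (fun a => linfun (vsproj (N (tgt a)))
              \o rmap M a \o linfun (@vsval _ _ (N (src a))))%VF.

(** [vectType] has no quotients: the space of [M / N] at [v] is realized on the
    complement [(N v)^C] of [N v], onto which [M v] is projected along [N v]. *)
Definition quot_pr (M : rep) (N : subrep M) (v : vertex Q) :
    'Hom(M v, subvs_of (N v)^C%VS) :=
  (linfun (vsproj (N v)^C%VS) \o daddv_pi (N v)^C (N v))%VF.

Definition rep_quot (M : rep) (N : subrep M) : rep :=
  @Rep (fun v => subvs_of (N v)^C%VS)
    (fun a => quot_pr N (tgt a)
              \o rmap M a \o linfun (@vsval _ _ (N (src a))^C%VS))%VF.

Definition short_exact (A E B : rep) (f : hom A E) (g : hom E B) : Prop :=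
  forall v, [/\ lker (f v) = 0%VS, limg (f v) = lker (g v)
              & limg (g v) = fullv].

(** Vanishing of [Ext^1(A, B)], whose elements are the classes of short exact
    sequences [0 -> B -> E -> A -> 0] and whose zero is the split class. *)
Definition Ext1_zero (A B : rep) : Prop :=
  forall (E : rep) (f : hom B E) (g : hom E A),
    short_exact f g -> split_epi g.

Definition rigid (M : rep) : Prop := Ext1_zero M M.

Definition indecomposable (M : rep) : Prop :=
  ~ is_zero M /\
  forall U W : subrep M,
    (forall v, (U v + W v)%VS = fullv /\ (U v :&: W v)%VS = 0%VS) ->
    is_zero (rep_of_sub U) \/ is_zero (rep_of_sub W).

Definition projective (P : rep) : Prop :=
  forall (X Y : rep) (g : hom X Y) (h : hom P Y),
    (forall v, limg (g v) = fullv) -> factors_right h g.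

Definition injective_rep (I : rep) : Prop :=
  forall (X Y : rep) (f : hom X Y) (h : hom X I),
    (forall v, lker (f v) = 0%VS) -> factors_left h f.

Definition left_almost_split (X E : rep) (f : hom X E) : Prop :=
  ~ split_mono f /\
  forall (W : rep) (h : hom X W), ~ split_mono h -> factors_left h f.

Definition right_almost_split (E Z : rep) (g : hom E Z) : Prop :=
  ~ split_epi g /\
  forall (W : rep) (h : hom W Z), ~ split_epi h -> factors_right h g.

(** [ar_translate Z X] : [Z] is indecomposable non-projective and [X] is
    isomorphic to its Auslander-Reiten translate, i.e. there is an almost split
    sequence [0 -> X -> E -> Z -> 0]. *)
Definition ar_translate (Z X : rep) : Prop :=
  exists (E : rep) (f : hom X E) (g : hom E Z),
    [/\ short_exact f g, left_almost_split f & right_almost_split g].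

Definition irreducible_hom (X Y : rep) (f : hom X Y) : Prop :=
  [/\ ~ split_mono f, ~ split_epi f
    & forall (W : rep) (g : hom X W) (h : hom W Y),
        (forall v, (f v = h v \o g v)%VF) -> split_mono g \/ split_epi h].

(** The vertices of the Auslander-Reiten quiver are isomorphism classes of
    indecomposables, whence the [iso] alternative. *)
Definition ar_adjacent (X Y : rep) : Prop :=
  [/\ indecomposable X, indecomposable Y
    & iso X Y \/ exists f : hom X Y, irreducible_hom f].

Definition same_ar_component : rep -> rep -> Prop :=
  clos_refl_sym_trans rep ar_adjacent.

(** The indecomposables [tau^-m P] with [P] projective, resp. [tau^m I] with [I]
    injective. *)
Inductive preprojective : rep -> Prop :=
| preprojective_base P : indecomposable P -> projective P -> preprojective P
| preprojective_step Z X :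
    ar_translate Z X -> preprojective X -> preprojective Z.

Inductive preinjective : rep -> Prop :=
| preinjective_base I : indecomposable I -> injective_rep I -> preinjective I
| preinjective_step Z X :
    ar_translate Z X -> preinjective Z -> preinjective X.

Definition summand (D M : rep) : Prop := exists i : hom D M, split_mono i.

Definition regular (M : rep) : Prop :=
  forall D : rep, indecomposable D -> summand D M ->
    ~ preprojective D /\ ~ preinjective D.

Definition quasi_simple (S : rep) : Prop :=
  [/\ regular S, ~ is_zero S
    & forall N : subrep S, regular (rep_of_sub N) ->
        is_zero (rep_of_sub N) \/ forall v, N v = fullv].

(** Length in the abelian category of regular representations. *)
Inductive quasi_length : nat -> rep -> Prop :=
| quasi_length0 X : is_zero X -> quasi_length 0 X
| quasi_lengthS n X (N : subrep X) :
    regular X -> quasi_length n (rep_of_sub N) -> quasi_simple (rep_quot N) ->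
    quasi_length n.+1 X.

(** The sum of all quasi-simple subrepresentations, i.e. their least upper
    bound among subrepresentations. *)
Definition is_quasi_socle (X : rep) (S : subrep X) : Prop :=
  (forall U : subrep X, quasi_simple (rep_of_sub U) -> sub_le U S) /\
  (forall W : subrep X,
     (forall U : subrep X, quasi_simple (rep_of_sub U) -> sub_le U W) ->
     sub_le S W).

(** [ray_rep R n X] : [X] is isomorphic to [R^(n)]. *)
Definition ray_rep (R : rep) (n : nat) (X : rep) : Prop :=
  if n == 0%N then is_zero X else
  [/\ indecomposable X, regular X, quasi_length n X
    & exists S : subrep X, is_quasi_socle S /\ iso (rep_of_sub S) R].

(** [tube_mouth M R] : the component of [M] is a tube of rank [p] whose
    quasi-simples are, up to isomorphism, the [R i] for [i] in Z/pZ, ordered so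
    that [tau (R i)] is isomorphic to [R (i - 1)]. *)
Definition tube_mouth (M : rep) (p : nat) (R : 'I_p -> rep) : Prop :=
  [/\ forall i, quasi_simple (R i) /\ same_ar_component M (R i),
      forall S, quasi_simple S -> same_ar_component M S -> exists i, iso S (R i),
      forall i j, iso (R i) (R j) -> i = j
    & forall i, ar_translate (R i) (R (ord_pred i))].

Definition Gr_dim (M : rep) (e : vertex Q -> nat) : set (subrep M) :=
  [set N | forall v, \dim (N v) = e v].
Arguments Gr_dim : clear implicits.

Definition Gr (M : rep) : set (subrep M) :=
  \bigcup_(e in [set: vertex Q -> nat]) Gr_dim M e.
Arguments Gr : clear implicits.

(** Instead of relabeling so that [M] is [R_0^(lp+k)], any index [i0] is allowed
    for the quasi-socle. *)
Definition Tr_removed (M : rep) : set (subrep M) :=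
  [set N | exists (p : nat) (R : 'I_p -> rep) (i0 : 'I_p) (l k : nat)
                  (U V : subrep M),
     [/\ tube_mouth M R, (1 <= l)%N, (k < p)%N & ray_rep (R i0) (l * p + k) M]
     /\ [/\ ray_rep (R i0) k.+1 (rep_of_sub U),
            ray_rep (R i0) (l * p - 1) (rep_of_sub V),
            sub_le U N & sub_le N V]].
Arguments Tr_removed : clear implicits.

Definition Tr (M : rep) : set (subrep M) :=
  if `[< rigid M >] then Gr M else Gr M `\` Tr_removed M.
Arguments Tr : clear implicits.

Section SubQuot.
Variables (M : rep) (N : subrep M).

Let incl v : 'Hom(rep_of_sub N v, M v) := linfun (@vsval _ _ (N v)).

Lemma sub_incl_comm a :
  (incl (tgt a) \o rmap (rep_of_sub N) a = rmap M a \o incl (src a))%VF.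
Proof.
apply/lfunP => x; rewrite !comp_lfunE !lfunE /= vsprojK //.
by apply: subvP (sub_stable N a) _ _; apply: memv_img; exact: subvsP.
Qed.

Definition sub_incl : hom (rep_of_sub N) M := RepHom sub_incl_comm.

Lemma quot_prE v x : vsval (quot_pr N v x) = daddv_pi (N v)^C (N v) x.
Proof. by rewrite comp_lfunE lfunE /= vsprojK ?memv_pi. Qed.

Let dC v : ((N v)^C :&: N v)%VS = 0%VS.
Proof. by rewrite capvC capv_compl. Qed.

Lemma quot_pr_add v x :
  vsval (quot_pr N v x) + daddv_pi (N v) (N v)^C x = x.
Proof.
rewrite quot_prE daddv_pi_add //.
by rewrite addvC addv_complf memvf.
Qed.

Lemma lker_quot_pr v : lker (quot_pr N v) = N v.
Proof.
apply/vspaceP => x; rewrite memv_ker; apply/eqP/idP => [x0|xN].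
  by rewrite -(quot_pr_add x) x0 linear0 add0r memv_pi.
apply/val_inj => /=; rewrite quot_prE.
have := quot_pr_add x; rewrite quot_prE [X in _ + X = _]daddv_pi_id ?capv_compl //.
by move/(canRL (addrK _)); rewrite subrr.
Qed.

Lemma quot_pr_comm a :
  (quot_pr N (tgt a) \o rmap M a
   = rmap (rep_quot N) a \o quot_pr N (src a))%VF.
Proof.
apply/lfunP => x.
have -> : ((quot_pr N (tgt a) \o rmap M a) x
    = quot_pr N (tgt a) (rmap M a (vsval (quot_pr N (src a) x)))
      + quot_pr N (tgt a) (rmap M a (daddv_pi (N (src a)) (N (src a))^C x)))%VF.
  by rewrite comp_lfunE -2!raddfD quot_pr_add.
rewrite [X in _ + X](_ : _ = 0) ?addr0; first by rewrite !(comp_lfunE, lfunE).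
apply/eqP; rewrite -memv_ker lker_quot_pr.
by apply: subvP (sub_stable N a) _ _; apply/memv_img/memv_pi.
Qed.

Definition quot_proj : hom M (rep_quot N) :=
  @RepHom M (rep_quot N) (quot_pr N) quot_pr_comm.

Lemma short_exact_sub_quot : short_exact sub_incl quot_proj.
Proof.
move=> v; split.
- apply/eqP/lker0P => x y /=; rewrite !lfunE; exact: val_inj.
- rewrite lker_quot_pr; apply/vspaceP => x; apply/memv_imgP/idP.
    by case=> u _ ->; rewrite lfunE /=; exact: subvsP.
  by move=> xN; exists (vsproj (N v) x); rewrite ?memvf // lfunE /= vsprojK.
- apply/vspaceP => x; rewrite memvf; apply/memv_imgP; exists (vsval x).
    exact: memvf.
  apply/val_inj/esym; apply: etrans (quot_prE _) _.
  by rewrite daddv_pi_id //; exact: subvsP.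
Qed.

End SubQuot.

End Representations.

Arguments Gr_dim {F Q} M e _.
Arguments Gr {F Q} M _.
Arguments Tr_removed {F Q} M _.
Arguments Tr {F Q} M _.

(* Main.v *)
(** Let [delta] be the minimal radical vector of the Euler form and [df] the defect
    [euler delta]. Serre duality from almost split sequences gives
    [euler (dim Z) w = - euler w (dim (tau Z))]; with the positivity of the form this shows that
    indecomposables of negative (positive) defect are preprojective (preinjective), hence
    rigid, and that the regular representations are the semistable ones: defect 0, and all
    subrepresentations of defect at most 0. The quasi-simples are the stable ones, [tau]
    permutes them with finite orbits, and a semistable indecomposable is uniserial with
    regular factors running along such an orbit.

    A rigid [M] has [Ext^1(N, M/N) = 0] for all [N], because the global dimension is 1.
    Otherwise [M = R^(n)], [n = lp + k], is uniserial. Let [J] be the largest semistable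
    subobject of [N] and [V] the smallest semistable subobject of [M] containing [N]: [N/J]
    has only subobjects of negative defect and [V/N] only quotients of positive defect, so
    [Ext^1(N, M/N) = 0] iff [Ext^1(J, M/V) = 0]. By Serre duality the latter fails iff
    [J] has quasi-length at least [k + 1] and [V] at most [lp - 1]. For the converse half
    it suffices that [Ext^1(R^(k+1), M/R^(lp-1)) <> 0], which the Euler form decides. *)

From Stdlib Require Import Relation_Operators.
From HB Require Import structures.
From mathcomp Require Import all_boot all_order all_algebra.
From mathcomp Require Import boolp classical_sets reals complex.
From mathcomp Require Import zify ring lra.
Require Import Defs.
Set Implicit Arguments.
Unset Strict Implicit.
Unset Printing Implicit Defensive.
Import Order.TTheory GRing.Theory Num.Theory.
Local Open Scope classical_set_scope.
Local Open Scope ring_scope.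

(** * Linear algebra *)

(** Both Ext^1 and [tau] are built from linear algebra. Ext^1(A, B) is the cokernel of the
    coboundary map from families of linear maps at the vertices to families at the arrows; the
    kernel is Hom(A, B), which gives the Euler form, and since cocycles are unconstrained, vanishing
    passes to subobjects of A and quotients of B. [tau Z] is a summand of an object representing the
    dual of Ext^1(Z, -); acyclicity bounds the dimensions of the candidates for such an object.
    [tau] remains a relation, unique up to isomorphism: only the nonvanishing of morphisms is
    carried along it. The sign of the defect is controlled by pigeonhole: the quadratic form is
    constant on a [tau]-orbit and takes each value on finitely many classes modulo [delta], so an
    orbit that never stops revisits a class. The removed set is defined through the component of M,
    which therefore must be shown to contain the quasi-simples of exactly one [tau]-orbit; this is
    done by following socles along irreducible maps. Algebraic closedness enters through
    eigenvectors: they make endomorphisms of stable representations scalar. *)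

Section DependentProduct.
Import VectorInternalTheory.
Variables (F : fieldType) (I : finType) (V : I -> vectType F).

(** Families of linear maps at the vertices and cocycles at the arrows take values in spaces that
    vary with the index; as elements of one finite-dimensional space they can be counted and
    paired. *)
Definition dprod := {dffun forall i : I, V i}.
HB.instance Definition _ := Choice.on dprod.

Implicit Types f g : dprod.

Definition dprod_zero : dprod := [ffun i => 0].
Definition dprod_add f g : dprod := [ffun i => f i + g i].
Definition dprod_opp f : dprod := [ffun i => - f i].
Definition dprod_scale (k : F) f : dprod := [ffun i => k *: f i].

Fact dprod_addA : associative dprod_add.
Proof. by move=> f g h; apply/ffunP => i; rewrite !ffunE addrA. Qed.
Fact dprod_addC : commutative dprod_add.
Proof. by move=> f g; apply/ffunP => i; rewrite !ffunE addrC. Qed.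
Fact dprod_add0 : left_id dprod_zero dprod_add.
Proof. by move=> f; apply/ffunP => i; rewrite !ffunE add0r. Qed.
Fact dprod_addN : left_inverse dprod_zero dprod_opp dprod_add.
Proof. by move=> f; apply/ffunP => i; rewrite !ffunE addNr. Qed.
HB.instance Definition _ := GRing.isZmodule.Build dprod
  dprod_addA dprod_addC dprod_add0 dprod_addN.

Fact dprod_scaleA a b f : dprod_scale a (dprod_scale b f) = dprod_scale (a * b) f.
Proof. by apply/ffunP => i; rewrite !ffunE scalerA. Qed.
Fact dprod_scale1 : left_id 1 dprod_scale.
Proof. by move=> f; apply/ffunP => i; rewrite !ffunE scale1r. Qed.
Fact dprod_scaleDr : right_distributive dprod_scale +%R.
Proof. by move=> a f g; apply/ffunP => i; rewrite !ffunE scalerDr. Qed.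
Fact dprod_scaleDl f : {morph dprod_scale^~ f : a b / a + b}.
Proof. by move=> a b; apply/ffunP => i; rewrite !ffunE scalerDl. Qed.
HB.instance Definition _ := GRing.Zmodule_isLmodule.Build F dprod
  dprod_scaleA dprod_scale1 dprod_scaleDr dprod_scaleDl.

Lemma dprodDE f g i : (f + g) i = f i + g i. Proof. exact: ffunE. Qed.
Lemma dprodNE f i : (- f) i = - f i. Proof. exact: ffunE. Qed.
Lemma dprodZE a f i : (a *: f) i = a *: f i. Proof. exact: ffunE. Qed.

Let n := (\sum_(j < #|I|) dim (V (enum_val j)))%N.

Let row f : 'rV[F]_n := \mxrow_(j < #|I|) v2r (f (enum_val j)).

Fact dprod_vect_iso : SemiVector.axiom n dprod.
Proof.
exists row.
  split.
    move=> a f; rewrite /row; apply/matrixP => i j.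
    by rewrite !mxE ffunE linearZ !mxE.
  by move=> f g; rewrite /row; apply/matrixP => i j; rewrite !mxE ffunE linearD !mxE.
have inj : injective row.
  move=> f g fg; apply/ffunP => i; rewrite -(enum_rankK i).
  by apply: v2r_inj; move/(congr1 (fun A => submxrow A (enum_rank i))): fg; rewrite !mxrowK.
have sur w : exists f, row f = w.
  (* Block [enum_rank i] has the width of [V (enum_val (enum_rank i))], hence the cast to [V i]. *)
  exists [ffun i => ecast i (V i) (enum_rankK i) (r2v (submxrow w (enum_rank i)))].
  rewrite -[RHS]submxrowK; apply/eq_mxrow => j; rewrite ffunE.
  apply: (canLR r2vK).
  move: (enum_rankK _); rewrite (enum_valK j) => e.
  by rewrite (eq_irrelevance e erefl).
have [h hP] := choice sur.
by exists h => // f; apply: inj; rewrite hP.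
Qed.

HB.instance Definition _ := LSemiModule_hasFinDim.Build F dprod dprod_vect_iso.

Lemma dim_dprod : \dim {: dprod} = (\sum_i \dim {: V i})%N.
Proof.
rewrite dimvf (_ : dim _ = n) // /n [RHS](reindex _ (onW_bij _ (@enum_val_bij I))).
by apply: eq_bigr => j _; rewrite dimvf.
Qed.

End DependentProduct.

Lemma max_nat (P : nat -> Prop) b : (exists n, P n) -> (forall n, P n -> n <= b)%N ->
  exists n, P n /\ forall m, P m -> (m <= n)%N.
Proof.
move=> [n0 Pn0] Pb.
have ex : exists n, `[< P n >] by exists n0; apply/asboolP.
have bd n : `[< P n >] -> (n <= b)%N by move=> /asboolP/Pb.
case: (ex_maxnP ex bd) => n /asboolP Pn nP; exists n; split=> // m Pm.
by apply: nP; apply/asboolP.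
Qed.

Lemma min_nat (P : nat -> Prop) : (exists n, P n) ->
  exists n, P n /\ forall m, P m -> (n <= m)%N.
Proof.
move=> [n0 Pn0].
have ex : exists n, `[< P n >] by exists n0; apply/asboolP.
case: (ex_minnP ex) => n /asboolP Pn nP; exists n; split=> // m Pm.
by apply: nP; apply/asboolP.
Qed.

Section LinearAlgebra.
Variable F : fieldType.
Implicit Types U V W : vectType F.

Lemma linfun_linearE V W (f : V -> W) : linear f -> linfun f =1 f.
Proof.
move=> lf x; pose m := GRing.isLinear.Build F V W _ f lf.
pose f' : {linear V -> W} := HB.pack f m.
by rewrite -[f]/(f' : V -> W) lfunE.
Qed.

(** Among the subspaces contained in [P] one has maximal dimension; adjoining a further vector of
    [P] would enlarge it. *)
Lemma vspace_of_closed V (P : V -> Prop) : P 0 ->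
  (forall a x y, P x -> P y -> P (a *: x + y)) ->
  exists W : {vspace V}, forall x, (x \in W) <-> P x.
Proof.
move=> P0 Pl.
pose sub (W : {vspace V}) := forall x, x \in W -> P x.
have [] := @max_nat (fun n => exists2 W, sub W & \dim W = n) (\dim {:V}).
- by exists 0%N, 0%VS; rewrite ?dimv0 // => x; rewrite memv0 => /eqP ->.
- by move=> n [W _ <-]; apply: dimvS; apply: subvf.
move=> n [[W sW dW] mW]; exists W => x; split=> [/sW //|Px].
have sW' : sub (W + <[x]>)%VS.
  move=> z /memv_addP [u uW [v /vlineP [k ->] ->]].
  by rewrite addrC; apply: Pl => //; apply: sW.
have : (\dim (W + <[x]>) <= \dim W)%N by rewrite dW; apply: mW; exists (W + <[x]>)%VS.
move=> dle; have /eqP -> : W == (W + <[x]>)%VS by rewrite eqEdim addvSl.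
by apply: (subvP (addvSr _ _)); apply: memv_line.
Qed.

(** The projection of [x] to a complement of [W] is nonzero, so some coordinate of it is nonzero and
    can be normalised to 1. *)
Lemma separating_functional V (W : {vspace V}) x : x \notin W ->
  exists phi : 'Hom(V, F^o), phi x = 1 /\ forall w, w \in W -> phi w = 0.
Proof.
move=> xW; pose pi := daddv_pi (W^C)%VS W; pose b := vbasis {:V}.
have dC : ((W^C) :&: W)%VS = 0%VS by rewrite capvC capv_compl.
have piW w : w \in W -> pi w = 0.
  move=> wW; have := @daddv_pi_add _ _ (W^C)%VS W w dC.
  rewrite addvC addv_complf memvf => /(_ isT).
  rewrite [X in _ + X]daddv_pi_id ?capv_compl // => /(canRL (addrK _)).
  by rewrite subrr.
have y0 : pi x != 0.
  apply: contraNneq xW => p0; have := @daddv_pi_add _ _ (W^C)%VS W x dC.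
  rewrite addvC addv_complf memvf => /(_ isT) <-.
  by rewrite -/pi p0 add0r memv_pi.
have [i ci] : exists i, coord b i (pi x) != 0.
  apply: contrapT => /forallNP c0; move/negP: y0; apply; apply/eqP.
  rewrite (coord_vbasis (memvf (pi x))) big1 // => i _.
  by have /negP/negbNE/eqP := c0 i; rewrite -/b => ->; rewrite scale0r.
pose f z : F^o := (coord b i (pi x))^-1 * coord b i (pi z).
have lf : linear f.
  by move=> a u v; rewrite /f (linearP pi) (linearP (coord b i)) mulrDr mulrCA.
exists (linfun f); rewrite linfun_linearE //; split; first by rewrite /f mulVf.
by move=> w wW; rewrite linfun_linearE // /f (piW w) // (linear0 (coord b i)) mulr0.
Qed.

Lemma injective_dim V W (f : 'Hom(V, W)) : injective f -> (\dim {:V} <= \dim {:W})%N.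
Proof.
move=> /lker0P/eqP f0; rewrite -(limg_dim_eq (f := f) (U := fullv)) ?f0 ?capv0 //.
by apply: dimvS; apply: subvf.
Qed.

Lemma dim_subvs V (W : {vspace V}) : \dim {: subvs_of W} = \dim W.
Proof. by rewrite dimvf. Qed.

Lemma dim_dual V : \dim {: 'Hom(V, F^o)} = \dim {: V}.
Proof. by rewrite !dimvf /dim /= muln1. Qed.

Section Pairing.
Variables (U V : vectType F) (beta : U -> V -> F).
Hypotheses (bl : forall v, linear (beta^~ v : U -> F^o))
           (br : forall u, linear (beta u : V -> F^o)).

Let br0 u : beta u 0 = 0.
Proof. by have := br u (-1) 0 0; rewrite scaler0 addr0 scaleN1r addNr. Qed.

Let brZ u a v : beta u (a *: v) = a * beta u v.
Proof. by have := br u a v 0; rewrite addr0 br0 addr0. Qed.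

(** Two embeddings give the two inequalities: [A] pairs trivially with [W], so it embeds in the dual
    of a complement of [W]; and [V] modulo [W] embeds in the dual of [A]. *)
Lemma pairing_dim (A : {vspace U}) (W : {vspace V}) :
  (forall u, u \in A -> (forall v, beta u v = 0) -> u = 0) ->
  (forall v, v \in W <-> (forall u, u \in A -> beta u v = 0)) ->
  (\dim A + \dim W)%N = \dim {:V}.
Proof.
move=> nd WP; apply/eqP; rewrite eqn_leq; apply/andP; split.
  have C : \dim (W^C) = (\dim {:V} - \dim W)%N by rewrite dimv_compl.
  have le : (\dim W <= \dim {:V})%N by apply: dimvS; apply: subvf.
  suff : (\dim A <= \dim (W^C))%N by rewrite C; lia.
  pose g (u : subvs_of A) : 'Hom(subvs_of (W^C)%VS, F^o) :=
    linfun (fun v => beta (vsval u) (vsval v) : F^o).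
  have lg u : linear (fun v : subvs_of (W^C)%VS => beta (vsval u) (vsval v) : F^o).
    by move=> a x y; rewrite linearP br.
  have gl : linear g.
    move=> a x y; apply/lfunP => v.
    by rewrite add_lfunE scale_lfunE !linfun_linearE // (linearP (@vsval _ _ A)) bl.
  rewrite -(dim_subvs A) -(dim_subvs (W^C)%VS) -(dim_dual (subvs_of (W^C)%VS)).
  apply: (@injective_dim _ _ (linfun g)) => x y; rewrite !linfun_linearE //.
  move=> /lfunP xy; apply/val_inj/eqP; rewrite -subr_eq0; apply/eqP => /=.
  apply: nd; first by rewrite rpredB ?subvsP.
  have z : forall v, v \in (W^C)%VS -> beta (vsval x - vsval y) v = 0.
    move=> v vC; have := xy (vsproj (W^C)%VS v); rewrite !linfun_linearE //= vsprojK //.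
    move=> e; have := bl v (-1) (vsval y) (vsval x).
    by rewrite !scaleN1r e addNr [- vsval y + _]addrC.
  move=> v; have : v \in (W + W^C)%VS by rewrite addv_complf memvf.
  case/memv_addP => w /WP wW [c cC ->].
  have xyA : vsval x - vsval y \in A by rewrite rpredB ?subvsP.
  by have := br (vsval x - vsval y) 1 w c; rewrite !scale1r (wW _ xyA) (z c cC) addr0.
pose g (v : V) : 'Hom(subvs_of A, F^o) := linfun (fun u => beta (vsval u) v : F^o).
have lg v : linear (fun u : subvs_of A => beta (vsval u) v : F^o).
  by move=> a x y; rewrite linearP bl.
have gl : linear g.
  move=> a x y; apply/lfunP => v.
  by rewrite add_lfunE scale_lfunE !linfun_linearE //= br.
have kg : lker (linfun g) = W.
  apply/vspaceP => v; rewrite memv_ker linfun_linearE //; apply/eqP/idP.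
    move/lfunP => z; apply/WP => u uA.
    by have := z (vsproj A u); rewrite linfun_linearE // zero_lfunE /= vsprojK.
  by move/WP => z; apply/lfunP => u; rewrite linfun_linearE // zero_lfunE z ?subvsP.
rewrite -(limg_ker_dim (linfun g) fullv) capfv kg addnC leq_add2r -(dim_subvs A) -(dim_dual (subvs_of A)).
by apply: dimvS; apply: subvf.
Qed.

(** If the orthogonal of [A] also killed [u0], then [A] and [A + <[u0]>] would have the same
    orthogonal, hence by [pairing_dim] the same dimension. *)
Lemma pairing_separate (A : {vspace U}) u0 :
  (forall u, (forall v, beta u v = 0) -> u = 0) -> u0 \notin A ->
  exists v, beta u0 v = 1 /\ forall u, u \in A -> beta u v = 0.
Proof.
move=> nd u0A.
have [W WP] : exists W : {vspace V}, forall v, v \in W <-> forall u, u \in A -> beta u v = 0.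
  apply: vspace_of_closed => [u _|a x y hx hy u uA].
    exact: br0.
  by rewrite [LHS]br hx // hy // scaler0 addr0.
have : exists v, v \in W /\ beta u0 v != 0.
  apply: contrapT => /forallNP no.
  have := pairing_dim (fun u _ => @nd u) WP.
  have WP' v : v \in W <-> forall u, u \in (A + <[u0]>)%VS -> beta u v = 0.
    split=> [vW u /memv_addP [x xA [y /vlineP [k ->] ->]]|h].
      rewrite [x + _]addrC (bl v k u0 x).
      have /not_andP [//|/negP/negbNE/eqP ->] := no v.
      by have /WP -> := vW; rewrite // scaler0 addr0.
    apply/WP => u uA; apply: h; exact: subvP (addvSl _ _) _ uA.
  rewrite -(pairing_dim (fun u _ => @nd u) WP') => /eqP; rewrite eqn_add2r => /eqP d.
  move/negP: u0A; apply; have /eqP -> : A == (A + <[u0]>)%VS.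
    by rewrite eqEdim addvSl d /=.
  by apply: (subvP (addvSr _ _)); apply: memv_line.
move=> [v [vW b0]]; exists ((beta u0 v)^-1 *: v); split.
    by rewrite brZ mulVf.
by move=> u uA; rewrite brZ (iffLR (WP v) vW _ uA) mulr0.
Qed.

End Pairing.
End LinearAlgebra.

(** * The category of representations *)

Section LfunMorphism.
Variables (F : fieldType) (V W : vectType F) (f : 'Hom(V, W)).
Lemma lf0 : f 0 = 0. Proof. exact: linear0. Qed.
Lemma lfD x y : f (x + y) = f x + f y. Proof. exact: linearD. Qed.
Lemma lfB x y : f (x - y) = f x - f y. Proof. exact: linearB. Qed.
Lemma lfN x : f (- x) = - f x. Proof. exact: linearN. Qed.
Lemma lfZ k x : f (k *: x) = k *: f x. Proof. exact: linearZ. Qed.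
End LfunMorphism.

Section RepCategory.
Variables (F : fieldType) (Q : quiver).
Local Notation rep := (rep F Q).
Implicit Types (A B C D E M N X Y Z : rep).

Lemma hom_ext M N (f g : hom M N) : (forall v x, f v x = g v x) -> f = g.
Proof.
case: f g => [f fc] [g gc] /= fg.
have e : f = g by apply: functional_extensionality_dep => v; apply/lfunP => x; apply: fg.
by case: _ / e in gc fg *; congr RepHom; apply: Prop_irrelevance.
Qed.

Lemma homE M N (f : hom M N) a x :
  f (tgt a) (rmap M a x) = rmap N a (f (src a) x).
Proof. by have /lfunP/(_ x) := hom_comm f a; rewrite !comp_lfunE. Qed.

Section MkHom.
Variables (M N : rep) (h : forall v, 'Hom(M v, N v)).
Hypothesis hP : forall a x, h (tgt a) (rmap M a x) = rmap N a (h (src a) x).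
Fact mkhom_comm a : (h (tgt a) \o rmap M a = rmap N a \o h (src a))%VF.
Proof. by apply/lfunP => x; rewrite !comp_lfunE. Qed.
Definition mkhom := RepHom mkhom_comm.
End MkHom.

(** Identity, composition, zero and linear combinations are sealed witnesses, accessible only
    through their values in [hidE], [hcompE], [hzeroE] and [hlinE]. *)
Fact hid_subproof M : {f : hom M M | forall v x, f v x = x}.
Proof.
have c a x : \1%VF (rmap M a x) = rmap M a (\1%VF x) by rewrite !id_lfunE.
by exists (mkhom (h := fun v => \1%VF) c) => v x; apply: id_lfunE.
Qed.
Definition hid M := sval (hid_subproof M).

Fact hcomp_subproof M N X (g : hom N X) (f : hom M N) :
  {h : hom M X | forall v x, h v x = g v (f v x)}.
Proof.
have c a x : (g (tgt a) \o f (tgt a))%VF (rmap M a x)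
    = rmap X a ((g (src a) \o f (src a))%VF x) by rewrite !comp_lfunE !homE.
by exists (mkhom (h := fun v => (g v \o f v)%VF) c) => v x; apply: comp_lfunE.
Qed.
Definition hcomp M N X (g : hom N X) (f : hom M N) := sval (hcomp_subproof g f).

Fact hzero_subproof M N : {f : hom M N | forall v x, f v x = 0}.
Proof.
have c a x : (0 : 'Hom(M (tgt a), N (tgt a))) (rmap M a x) = rmap N a ((0 : 'Hom(_, _)) x).
  by rewrite !zero_lfunE lf0.
by exists (mkhom (h := fun v => 0) c) => v x; apply: zero_lfunE.
Qed.
Definition hzero M N := sval (hzero_subproof M N).

Fact hlin_subproof M N k (f g : hom M N) :
  {h : hom M N | forall v x, h v x = k *: f v x + g v x}.
Proof.
have c a x : (k *: f (tgt a) + g (tgt a)) (rmap M a x)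
    = rmap N a ((k *: f (src a) + g (src a)) x).
  by rewrite !add_lfunE !scale_lfunE !homE lfD lfZ.
exists (mkhom (h := fun v => k *: f v + g v) c) => v x.
by rewrite /= add_lfunE scale_lfunE.
Qed.
Definition hlin M N k (f g : hom M N) := sval (hlin_subproof k f g).

Lemma hidE M v x : hid M v x = x. Proof. exact: svalP (hid_subproof M) v x. Qed.
Lemma hcompE M N X (g : hom N X) (f : hom M N) v x : hcomp g f v x = g v (f v x).
Proof. exact: svalP (hcomp_subproof g f) v x. Qed.
Lemma hzeroE M N v x : hzero M N v x = 0. Proof. exact: svalP (hzero_subproof M N) v x. Qed.
Lemma hlinE M N k (f g : hom M N) v x : hlin k f g v x = k *: f v x + g v x.
Proof. exact: svalP (hlin_subproof k f g) v x. Qed.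

Lemma hcompA M N X Y (h : hom X Y) (g : hom N X) (f : hom M N) :
  hcomp h (hcomp g f) = hcomp (hcomp h g) f.
Proof. by apply: hom_ext => v x; rewrite !hcompE. Qed.

Definition mono M N (f : hom M N) := forall v, injective (f v).
Definition epi M N (f : hom M N) := forall v y, exists x, f v x = y.
Definition is_iso M N (f : hom M N) := mono f /\ epi f.

Lemma monoP M N (f : hom M N) : mono f <-> forall v, lker (f v) = 0%VS.
Proof.
split=> h v; first by apply/eqP/lker0P; apply: h.
by apply/lker0P; rewrite h.
Qed.

Lemma epiP M N (f : hom M N) : epi f <-> forall v, limg (f v) = fullv.
Proof.
split=> h v.
  apply/vspaceP => y; rewrite memvf; have [x <-] := h v y.
  by apply: memv_img; apply: memvf.
move=> y; have : y \in limg (f v) by rewrite h memvf.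
by case/memv_imgP => x _ ->; exists x.
Qed.

Lemma mono0 M N (f : hom M N) : (forall v x, f v x = 0 -> x = 0) -> mono f.
Proof.
move=> h v x y e; apply/eqP; rewrite -subr_eq0; apply/eqP/h.
by rewrite lfB e subrr.
Qed.

Lemma mono_eq0 M N (f : hom M N) : mono f -> forall v x, f v x = 0 -> x = 0.
Proof. by move=> h v x e; apply: (h v); rewrite e lf0. Qed.

Lemma mono_id M : mono (hid M).
Proof. by move=> v x y; rewrite !hidE. Qed.
Lemma epi_id M : epi (hid M).
Proof. by move=> v y; exists y; rewrite hidE. Qed.
Lemma mono_comp M N X (g : hom N X) (f : hom M N) : mono g -> mono f -> mono (hcomp g f).
Proof. by move=> hg hf v x y; rewrite !hcompE => /hg/hf. Qed.
Lemma epi_comp M N X (g : hom N X) (f : hom M N) : epi g -> epi f -> epi (hcomp g f).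
Proof.
move=> hg hf v y; have [z <-] := hg v y; have [x <-] := hf v z.
by exists x; rewrite hcompE.
Qed.
Lemma mono_compr M N X (g : hom N X) (f : hom M N) : mono (hcomp g f) -> mono f.
Proof. by move=> h v x y e; apply: (h v); rewrite !hcompE e. Qed.
Lemma epi_compl M N X (g : hom N X) (f : hom M N) : epi (hcomp g f) -> epi g.
Proof. by move=> h v y; have [x] := h v y; rewrite hcompE => <-; exists (f v x). Qed.

(** Linear at each vertex but not a morphism of representations: a retraction when [f] is mono, a
    section when [f] is epi. Its failure to commute with the arrows is what cocycles measure. *)
Definition lret M N (f : hom M N) v : 'Hom(N v, M v) := (f v)^-1%VF.
Lemma lretK M N (f : hom M N) v x : mono f -> lret f v (f v x) = x.
Proof. by move=> h; apply: lker0_lfunK; apply/lker0P/h. Qed.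
Lemma lsecK M N (f : hom M N) v y : epi f -> f v (lret f v y) = y.
Proof. by move/epiP=> h; apply: limg_lfunVK; rewrite h memvf. Qed.

Lemma factor_mono I N X (m : hom I N) (g : hom X N) : mono m ->
  (forall v x, exists y, m v y = g v x) -> exists g' : hom X I, hcomp m g' = g.
Proof.
move=> mm hg.
have K v x : m v (lret m v (g v x)) = g v x.
  by have [y <-] := hg v x; rewrite lretK.
have c a x : (lret m (tgt a) \o g (tgt a))%VF (rmap X a x)
    = rmap I a ((lret m (src a) \o g (src a))%VF x).
  by rewrite !comp_lfunE; apply: mm; rewrite K !homE K.
by exists (mkhom (h := fun v => (lret m v \o g v)%VF) c); apply: hom_ext => v x; rewrite hcompE comp_lfunE K.
Qed.

Lemma factor_epi M I X (e : hom M I) (g : hom M X) : epi e ->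
  (forall v x, e v x = 0 -> g v x = 0) -> exists g' : hom I X, hcomp g' e = g.
Proof.
move=> ee hg.
have K v x : g v (lret e v (e v x)) = g v x.
  by apply/eqP; rewrite -subr_eq0 -lfB; apply/eqP/hg; rewrite lfB lsecK ?subrr.
have c a y : (g (tgt a) \o lret e (tgt a))%VF (rmap I a y)
    = rmap X a ((g (src a) \o lret e (src a))%VF y).
  by have [x <-] := ee (src a) y; rewrite !comp_lfunE -homE !K homE.
by exists (mkhom (h := fun v => (g v \o lret e v)%VF) c); apply: hom_ext => v x; rewrite hcompE comp_lfunE K.
Qed.

Lemma iso_inverse M N (f : hom M N) : is_iso f ->
  exists g : hom N M, hcomp g f = hid M /\ hcomp f g = hid N.
Proof.
case=> mf ef; have [|g fg] := factor_mono (g := hid N) mf.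
  by move=> v x; have [y <-] := ef v x; exists y; rewrite hidE.
exists g; split=> //; apply: hom_ext => v x; apply: mf.
by rewrite -hcompE hcompA fg hcompE !hidE.
Qed.

Lemma inverse_iso M N (f : hom M N) (g : hom N M) :
  hcomp g f = hid M -> hcomp f g = hid N -> is_iso f.
Proof.
move=> gf fg; split.
  by apply: (@mono_compr _ _ _ g); rewrite gf; apply: mono_id.
by apply: (@epi_compl _ _ _ _ g); rewrite fg; apply: epi_id.
Qed.

Lemma isoP M N : iso M N <-> exists f : hom M N, is_iso f.
Proof.
split=> -[f h]; exists f; first by split; [apply/monoP|apply/epiP] => v; case: (h v).
by case: h => /monoP h1 /epiP h2 v; split.
Qed.

Lemma iso_refl M : iso M M.
Proof. by apply/isoP; exists (hid M); split; [apply: mono_id|apply: epi_id]. Qed.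

Lemma iso_sym M N : iso M N -> iso N M.
Proof.
move/isoP => [f /iso_inverse [g [gf fg]]]; apply/isoP; exists g.
exact: inverse_iso fg gf.
Qed.

Lemma iso_trans M N X : iso M N -> iso N X -> iso M X.
Proof.
move=> /isoP [f [mf ef]] /isoP [g [mg eg]]; apply/isoP; exists (hcomp g f).
by split; [apply: mono_comp|apply: epi_comp].
Qed.

Lemma split_monoP M N (f : hom M N) :
  split_mono f <-> exists r, hcomp r f = hid M.
Proof.
split=> -[r h]; exists r.
  by apply: hom_ext => v x; rewrite hcompE hidE -comp_lfunE h id_lfunE.
by move=> v; apply/lfunP => x; rewrite comp_lfunE id_lfunE -hcompE h hidE.
Qed.

Lemma split_epiP M N (f : hom M N) :
  split_epi f <-> exists s, hcomp f s = hid N.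
Proof.
split=> -[r h]; exists r.
  by apply: hom_ext => v x; rewrite hcompE hidE -comp_lfunE h id_lfunE.
by move=> v; apply/lfunP => x; rewrite comp_lfunE id_lfunE -hcompE h hidE.
Qed.

Lemma split_mono_mono M N (f : hom M N) : split_mono f -> mono f.
Proof. by move/split_monoP => [r h]; apply: (@mono_compr _ _ _ r); rewrite h; apply: mono_id. Qed.
Lemma split_epi_epi M N (f : hom M N) : split_epi f -> epi f.
Proof. by move/split_epiP => [r h]; apply: (@epi_compl _ _ _ _ r); rewrite h; apply: epi_id. Qed.

Lemma factors_rightP X Y Z (h : hom X Z) (g : hom Y Z) :
  factors_right h g <-> exists k, hcomp g k = h.
Proof.
split=> -[k e]; exists k.
  by apply: hom_ext => v x; rewrite hcompE e comp_lfunE.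
by move=> v; apply/lfunP => x; rewrite -e hcompE comp_lfunE.
Qed.

Lemma factors_leftP X Y Z (h : hom X Z) (f : hom X Y) :
  factors_left h f <-> exists k, hcomp k f = h.
Proof.
split=> -[k e]; exists k.
  by apply: hom_ext => v x; rewrite hcompE e comp_lfunE.
by move=> v; apply/lfunP => x; rewrite -e hcompE comp_lfunE.
Qed.

Lemma homeqP X Y Z (f : hom X Z) (h : hom Y Z) (g : hom X Y) :
  (forall v, f v = h v \o g v)%VF <-> f = hcomp h g.
Proof.
split=> e; first by apply: hom_ext => v x; rewrite hcompE e comp_lfunE.
by move=> v; rewrite e; apply/lfunP => x; rewrite hcompE comp_lfunE.
Qed.

Lemma is_zeroP M : is_zero M <-> forall v (x : M v), x = 0.
Proof.
split=> h v; last first.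
  by apply/eqP; rewrite dimv_eq0; apply/eqP/vspaceP => x; rewrite memvf memv0 (h v x) eqxx.
move=> x; have /eqP := h v; rewrite dimv_eq0 => /eqP e.
by apply/eqP; rewrite -memv0 -e memvf.
Qed.

Lemma hneq0P M N (f : hom M N) : f <> hzero M N <-> exists v x, f v x <> 0.
Proof.
split=> [h|[v [x h]] e]; last by apply: h; rewrite e hzeroE.
apply: contrapT => no; apply: h; apply: hom_ext => v x; rewrite hzeroE.
by apply: contrapT => fx; apply: no; exists v, x.
Qed.

Lemma nonzeroP M : ~ is_zero M <-> exists v (x : M v), x <> 0.
Proof.
split=> [h|[v [x x0]] /is_zeroP h]; last exact: x0 (h v x).
apply: contrapT => no; apply: h; apply/is_zeroP => v x.
by apply: contrapT => fx; apply: no; exists v, x.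
Qed.

Definition exact M N X (f : hom M N) (g : hom N X) :=
  forall v y, g v y = 0 <-> exists x, f v x = y.
Definition ses M N X (f : hom M N) (g : hom N X) := [/\ mono f, epi g & exact f g].

Lemma short_exactP M N X (f : hom M N) (g : hom N X) : short_exact f g <-> ses f g.
Proof.
split=> [h|[/monoP h1 /epiP h2 h3] v].
  split; first by apply/monoP => v; case: (h v).
    by apply/epiP => v; case: (h v).
  move=> v y; case: (h v) => _ e _; split.
    move=> /eqP; rewrite -memv_ker -e => /memv_imgP [x _ ->]; by exists x.
  by move=> [x <-]; apply/eqP; rewrite -memv_ker -e memv_img ?memvf.
split=> //; apply/vspaceP => y; rewrite memv_ker; apply/idP/eqP.
  by move/memv_imgP => [x _ ->]; apply/h3; exists x.
by move/h3 => [x <-]; rewrite memv_img ?memvf.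
Qed.

Lemma ses_comp0 M N X (f : hom M N) (g : hom N X) v x : ses f g -> g v (f v x) = 0.
Proof. by case=> _ _ h; apply/h; exists x. Qed.

Lemma sub_incl_mono M (U : subrep M) : mono (sub_incl U).
Proof. by move=> v x y; rewrite /= !lfunE; apply: val_inj. Qed.

Lemma sub_inclE M (U : subrep M) v x : sub_incl U v x = vsval x.
Proof. exact: lfunE. Qed.

Lemma sub_inclP M (U : subrep M) v y : (y \in U v) <-> exists x, sub_incl U v x = y.
Proof.
split=> [yU|[x <-]]; last by rewrite sub_inclE subvsP.
by exists (vsproj (U v) y); rewrite sub_inclE vsprojK.
Qed.

Lemma quot_ses M (U : subrep M) : ses (sub_incl U) (quot_proj U).
Proof. by apply/short_exactP; apply: short_exact_sub_quot. Qed.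

Fact img_stable M N (f : hom M N) a :
  (rmap N a @: limg (f (src a)) <= limg (f (tgt a)))%VS.
Proof.
apply/subvP => z /memv_imgP [y /memv_imgP [x _ ->] ->].
by rewrite -homE memv_img ?memvf.
Qed.
Definition img M N (f : hom M N) : subrep N :=
  @SubRep _ _ N (fun v => limg (f v)) (img_stable f).

Lemma imgP M N (f : hom M N) v y : (y \in img f v) <-> exists x, f v x = y.
Proof.
split=> [/memv_imgP [x _ ->]|[x <-]]; first by exists x.
by rewrite memv_img ?memvf.
Qed.

Fact ker_stable M N (f : hom M N) a :
  (rmap M a @: lker (f (src a)) <= lker (f (tgt a)))%VS.
Proof.
apply/subvP => z /memv_imgP [y]; rewrite memv_ker => /eqP fy ->.
by rewrite memv_ker homE fy lf0.
Qed.
Definition ker M N (f : hom M N) : subrep M :=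
  @SubRep _ _ M (fun v => lker (f v)) (ker_stable f).

Lemma kerP M N (f : hom M N) v x : (x \in ker f v) <-> f v x = 0.
Proof. by rewrite memv_ker; split=> /eqP. Qed.

Lemma sub_leP M (U W : subrep M) :
  sub_le U W <-> exists f, hcomp (sub_incl W) f = sub_incl U.
Proof.
split=> [UW|[f e] v].
  apply: factor_mono; first exact: sub_incl_mono.
  by move=> v x; apply/sub_inclP/(subvP (UW v))/sub_inclP; exists x.
apply/subvP => y /sub_inclP [x <-]; apply/sub_inclP; exists (f v x).
by rewrite -e hcompE.
Qed.

Lemma img_iso M N (f : hom M N) : mono f -> iso (rep_of_sub (img f)) M.
Proof.
move=> mf; apply: iso_sym; apply/isoP.
have [|g e] := factor_mono (g := f) (@sub_incl_mono _ (img f)).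
  by move=> v x; apply/sub_inclP/imgP; exists x.
exists g; split; first by apply: (@mono_compr _ _ _ (sub_incl _)); rewrite e.
move=> v y; have /imgP [x fx] : vsval y \in img f v by apply: subvsP.
by exists x; apply: sub_incl_mono; rewrite -hcompE e fx sub_inclE.
Qed.

Lemma mono_img M N (f : hom M N) : mono f ->
  exists f' : hom M (rep_of_sub (img f)), is_iso f' /\ hcomp (sub_incl (img f)) f' = f.
Proof.
move=> mf.
have [|g e] := factor_mono (g := f) (@sub_incl_mono _ (img f)).
  by move=> v x; apply/sub_inclP/imgP; exists x.
exists g; split=> //; split; first by apply: (@mono_compr _ _ _ (sub_incl _)); rewrite e.
move=> v y; have /imgP [x fx] : vsval y \in img f v by apply: subvsP.
by exists x; apply: sub_incl_mono; rewrite -hcompE e fx sub_inclE.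
Qed.

Lemma kernel M N (f : hom M N) :
  exists K (k : hom K M), mono k /\ exact k f.
Proof.
exists (rep_of_sub (ker f)), (sub_incl (ker f)); split; first exact: sub_incl_mono.
by move=> v y; rewrite -kerP; apply: sub_inclP.
Qed.

Lemma cokernel M N (f : hom M N) :
  exists C (c : hom N C), epi c /\ exact f c.
Proof.
exists (rep_quot (img f)), (quot_proj (img f)); have [_ e x] := quot_ses (img f).
by split=> // v y; apply: iff_trans (x v y) _; rewrite -sub_inclP imgP.
Qed.

Lemma image M N (f : hom M N) :
  exists I (e : hom M I) (m : hom I N), [/\ epi e, mono m & hcomp m e = f].
Proof.
exists (rep_of_sub (img f)).
have [|g e] := factor_mono (g := f) (@sub_incl_mono _ (img f)).
  by move=> v x; apply/sub_inclP/imgP; exists x.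
exists g, (sub_incl _); split=> //; last exact: sub_incl_mono.
move=> v y; have /imgP [x fx] : vsval y \in img f v by apply: subvsP.
by exists x; apply: sub_incl_mono; rewrite -hcompE e fx sub_inclE.
Qed.

Definition dv M v := \dim {: M v}.
Definition tdim M := (\sum_v dv M v)%N.

Lemma ses_dv M N X (f : hom M N) (g : hom N X) v : ses f g -> dv N v = (dv M v + dv X v)%N.
Proof.
move/short_exactP/(_ v) => [f0 fg g1].
by rewrite /dv -(limg_ker_dim (g v) fullv) capfv g1 -fg limg_dim_eq // f0 capv0.
Qed.

Lemma ses_tdim M N X (f : hom M N) (g : hom N X) : ses f g -> tdim N = (tdim M + tdim X)%N.
Proof. by move=> h; rewrite /tdim -big_split; apply: eq_bigr => v _; apply: ses_dv h. Qed.

Lemma is_iso_dv M N (f : hom M N) v : is_iso f -> dv M v = dv N v.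
Proof.
case=> /monoP f0 /epiP f1.
by rewrite /dv -(limg_ker_dim (f v) fullv) f0 capv0 dimv0 f1.
Qed.

Lemma iso_dv M N v : iso M N -> dv M v = dv N v.
Proof. by move/isoP => [f /is_iso_dv]. Qed.

Lemma iso_tdim M N : iso M N -> tdim M = tdim N.
Proof. by move=> h; apply: eq_bigr => v _; apply: iso_dv. Qed.

Lemma is_zero_tdim M : is_zero M <-> tdim M = 0%N.
Proof.
split=> [h|/eqP]; first by rewrite /tdim big1 // => v _; apply: h.
by rewrite sum_nat_eq0 => /forallP h v; apply/eqP/h.
Qed.

Lemma mono_coker M N (f : hom M N) : mono f -> exists C (c : hom N C), ses f c.
Proof. by move=> mf; have [C [c [ec x]]] := cokernel f; exists C, c; split. Qed.
Lemma epi_ker M N (f : hom M N) : epi f -> exists K (k : hom K M), ses k f.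
Proof. by move=> mf; have [C [c [ec x]]] := kernel f; exists C, c; split. Qed.

Lemma mono_tdim M N (f : hom M N) : mono f -> (tdim M <= tdim N)%N.
Proof. by move/mono_coker => [C [c /ses_tdim ->]]; apply: leq_addr. Qed.
Lemma epi_tdim M N (f : hom M N) : epi f -> (tdim N <= tdim M)%N.
Proof. by move/epi_ker => [C [c /ses_tdim ->]]; apply: leq_addl. Qed.

Lemma mono_tdim_iso M N (f : hom M N) : mono f -> (tdim N <= tdim M)%N -> is_iso f.
Proof.
move=> mf le; split=> // v y; have [C [c h]] := mono_coker mf.
have : tdim C = 0%N by have := ses_tdim h; lia.
by case: h => _ _ x /is_zero_tdim/is_zeroP z; apply/x/z.
Qed.

Lemma epi_tdim_iso M N (f : hom M N) : epi f -> (tdim M <= tdim N)%N -> is_iso f.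
Proof.
move=> mf le; split=> //; have [C [c h]] := epi_ker mf.
have : tdim C = 0%N by have := ses_tdim h; lia.
case: h => _ _ x /is_zero_tdim/is_zeroP z; apply: mono0 => v y /x [u <-].
by rewrite (z v u) lf0.
Qed.

(* [c a] is the off-diagonal block of the arrow [a] in an extension of [A] by [B]. *)
Definition coc A B := dprod (fun a : arrow Q => 'Hom(A (src a), B (tgt a))).
Definition fam A B := forall v, 'Hom(A v, B v).

Lemma coc_ext A B (c c' : coc A B) : (forall a x, c a x = c' a x) -> c = c'.
Proof. by move=> e; apply/ffunP => a; apply/lfunP => x; apply: e. Qed.

Definition cob A B (h : fam A B) : coc A B :=
  [ffun a => (h (tgt a) \o rmap A a)%VF - (rmap B a \o h (src a))%VF].
Definition push A B B' (g : fam B B') (c : coc A B) : coc A B' :=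
  [ffun a => (g (tgt a) \o c a)%VF].
Definition pull A A' B (c : coc A B) (f : fam A' A) : coc A' B :=
  [ffun a => (c a \o f (src a))%VF].

Lemma cobE A B (h : fam A B) a x :
  cob h a x = h (tgt a) (rmap A a x) - rmap B a (h (src a) x).
Proof. by rewrite ffunE add_lfunE opp_lfunE !comp_lfunE. Qed.
Lemma pushE A B B' (g : fam B B') (c : coc A B) a x : push g c a x = g (tgt a) (c a x).
Proof. by rewrite ffunE comp_lfunE. Qed.
Lemma pullE A A' B (c : coc A B) (f : fam A' A) a x : pull c f a x = c a (f (src a) x).
Proof. by rewrite ffunE comp_lfunE. Qed.
Lemma cocDE A B (c c' : coc A B) a x : (c + c') a x = c a x + c' a x.
Proof. by rewrite dprodDE add_lfunE. Qed.
Lemma cocNE A B (c : coc A B) a x : (- c) a x = - c a x.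
Proof. by rewrite dprodNE opp_lfunE. Qed.
Lemma cocZE A B k (c : coc A B) a x : (k *: c) a x = k *: c a x.
Proof. by rewrite dprodZE scale_lfunE. Qed.
Lemma coc0E A B a x : (0 : coc A B) a x = 0.
Proof. by rewrite ffunE zero_lfunE. Qed.
Definition cocE := (cocDE, cocNE, cocZE, coc0E, pushE, pullE, cobE).

Definition cobound A B (c : coc A B) := exists h : fam A B, c = cob h.

Section Extension.
Variables (A B : rep).
Implicit Types c : coc A B.

Definition ext_map c a (p : (B (src a) * A (src a))%type) :
  (B (tgt a) * A (tgt a))%type := (rmap B a p.1 + c a p.2, rmap A a p.2).
Fact ext_map_linear c a : linear (@ext_map c a).
Proof.
move=> k [b1 a1] [b2 a2].
change (ext_map c (k *: b1 + b2, k *: a1 + a2) =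
  (k *: (rmap B a b1 + c a a1) + (rmap B a b2 + c a a2),
   k *: rmap A a a1 + rmap A a a2)).
by rewrite /ext_map /= !lfD !lfZ scalerDr addrACA.
Qed.
Definition ext_rep c : rep :=
  @Rep F Q (fun v => (B v * A v)%type) (fun a => linfun (@ext_map c a)).
Lemma ext_rmapE c a p : rmap (ext_rep c) a p = (rmap B a p.1 + c a p.2, rmap A a p.2).
Proof. by rewrite linfun_linearE //; apply: ext_map_linear. Qed.

Let inj_ v (b : B v) : (B v * A v)%type := (b, 0).
Let inj_lin v : linear (@inj_ v).
Proof. by move=> k x y; rewrite /inj_; congr pair; rewrite /= scaler0 addr0. Qed.
Fact ext_in_subproof c a x :
  (linfun (@inj_ (tgt a)) : 'Hom(B _, ext_rep c _)) (rmap B a x) =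
  rmap (ext_rep c) a (linfun (@inj_ (src a)) x).
Proof. by rewrite ext_rmapE !linfun_linearE //= !lf0 addr0. Qed.
Definition ext_in c : hom B (ext_rep c) :=
  @mkhom B (ext_rep c) (fun v => linfun (@inj_ v)) (ext_in_subproof c).
Lemma ext_inE c v b : ext_in c v b = (b, 0).
Proof. by rewrite linfun_linearE. Qed.

Let prj_ v (p : (B v * A v)%type) : A v := p.2.
Let prj_lin v : linear (@prj_ v). Proof. by []. Qed.
Fact ext_out_subproof c a x :
  (linfun (@prj_ (tgt a)) : 'Hom(ext_rep c _, A _)) (rmap (ext_rep c) a x) =
  rmap A a (linfun (@prj_ (src a)) x).
Proof. by rewrite ext_rmapE !linfun_linearE. Qed.
Definition ext_out c : hom (ext_rep c) A :=
  @mkhom (ext_rep c) A (fun v => linfun (@prj_ v)) (@ext_out_subproof c).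
Lemma ext_outE c v p : ext_out c v p = p.2.
Proof. by rewrite linfun_linearE. Qed.

Lemma ext_ses c : ses (ext_in c) (ext_out c).
Proof.
split.
- by move=> v x y; rewrite !ext_inE => -[].
- by move=> v y; exists (0, y); rewrite ext_outE.
move=> v y; rewrite ext_outE; split=> [y2|[x <-]]; last by rewrite ext_inE.
by exists y.1; rewrite ext_inE -y2 -surjective_pairing.
Qed.

End Extension.
End RepCategory.

(** * Extensions as cocycles modulo coboundaries *)

Section ExtCalculus.
Variables (F : fieldType) (Q : quiver).
Local Notation rep := (rep F Q).
Implicit Types (A B C D E M N X Y Z : rep).

Lemma cobound0 A B : cobound (0 : coc A B).
Proof.
exists (fun v => 0); apply: coc_ext => a x.
by rewrite !cocE !zero_lfunE lf0 subrr.
Qed.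

Lemma coboundP A B k (c c' : coc A B) : cobound c -> cobound c' -> cobound (k *: c + c').
Proof.
move=> [h ->] [h' ->]; exists (fun v => k *: h v + h' v); apply: coc_ext => a x.
by rewrite !cocE !add_lfunE !scale_lfunE lfD lfZ scalerBr opprD addrACA.
Qed.

Lemma coboundD A B (c c' : coc A B) : cobound c -> cobound c' -> cobound (c + c').
Proof. by move=> h h'; rewrite -[c]scale1r; apply: coboundP. Qed.
Lemma cobound_addl A B (c c' : coc A B) : cobound (c - c') -> cobound c' -> cobound c.
Proof. by move=> h h'; rewrite -(subrK c' c); apply: coboundD. Qed.

Lemma pushD A B B' (g : fam B B') (c c' : coc A B) : push g (c + c') = push g c + push g c'.
Proof. by apply: coc_ext => a x; rewrite !cocE lfD. Qed.
Lemma pushN A B B' (g : fam B B') (c : coc A B) : push g (- c) = - push g c.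
Proof. by apply: coc_ext => a x; rewrite !cocE lfN. Qed.
Lemma pushB A B B' (g : fam B B') (c c' : coc A B) : push g (c - c') = push g c - push g c'.
Proof. by rewrite pushD pushN. Qed.
Lemma pushZ A B B' (g : fam B B') k (c : coc A B) : push g (k *: c) = k *: push g c.
Proof. by apply: coc_ext => a x; rewrite !cocE lfZ. Qed.
Lemma pullD A A' B (c c' : coc A B) (f : fam A' A) : pull (c + c') f = pull c f + pull c' f.
Proof. by apply: coc_ext => a x; rewrite !cocE. Qed.
Lemma pullN A A' B (c : coc A B) (f : fam A' A) : pull (- c) f = - pull c f.
Proof. by apply: coc_ext => a x; rewrite !cocE. Qed.
Lemma pullB A A' B (c c' : coc A B) (f : fam A' A) : pull (c - c') f = pull c f - pull c' f.
Proof. by rewrite pullD pullN. Qed.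
Lemma pullZ A A' B k (c : coc A B) (f : fam A' A) : pull (k *: c) f = k *: pull c f.
Proof. by apply: coc_ext => a x; rewrite !cocE. Qed.
Lemma push_comp A B B' B'' (g' : hom B' B'') (g : hom B B') (c : coc A B) :
  push (hcomp g' g) c = push g' (push g c).
Proof. by apply: coc_ext => a x; rewrite !cocE hcompE. Qed.
Lemma pull_comp A A' A'' B (c : coc A B) (f : hom A' A) (f' : hom A'' A') :
  pull c (hcomp f f') = pull (pull c f) f'.
Proof. by apply: coc_ext => a x; rewrite !cocE hcompE. Qed.
Lemma push_pull A A' B B' (g : fam B B') (c : coc A B) (f : fam A' A) :
  push g (pull c f) = pull (push g c) f.
Proof. by apply: coc_ext => a x; rewrite !cocE. Qed.
Lemma push_id A B (c : coc A B) : push (hid B) c = c.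
Proof. by apply: coc_ext => a x; rewrite !cocE hidE. Qed.
Lemma pull_id A B (c : coc A B) : pull c (hid A) = c.
Proof. by apply: coc_ext => a x; rewrite !cocE hidE. Qed.

Lemma push_cob A B B' (g : hom B B') (h : fam A B) :
  push g (cob h) = cob (fun v => g v \o h v)%VF.
Proof. by apply: coc_ext => a x; rewrite !cocE !comp_lfunE lfB homE. Qed.
Lemma pull_cob A A' B (f : hom A' A) (h : fam A B) :
  pull (cob h) f = cob (fun v => h v \o f v)%VF.
Proof. by apply: coc_ext => a x; rewrite !cocE !comp_lfunE homE. Qed.

Lemma cobound_push A B B' (g : hom B B') (c : coc A B) : cobound c -> cobound (push g c).
Proof. by move=> [h ->]; rewrite push_cob; exists (fun v => g v \o h v)%VF. Qed.
Lemma cobound_pull A A' B (f : hom A' A) (c : coc A B) : cobound c -> cobound (pull c f).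
Proof. by move=> [h ->]; rewrite pull_cob; exists (fun v => h v \o f v)%VF. Qed.

Lemma lretKK M N (f : hom M N) v x : f v (lret f v (f v x)) = f v x.
Proof. by apply: limg_lfunVK; rewrite memv_img ?memvf. Qed.

(** Middle exactness of Ext^1(A, -): a trivialisation of [push p c] lifts vertexwise through [p],
    and after subtracting its coboundary the cocycle takes values in the image of [i]. *)
Lemma push_exact A B' B B'' (i : hom B' B) (p : hom B B'') (c : coc A B) :
  epi p -> exact i p -> cobound (push p c) -> exists c' : coc A B', cobound (c - push i c').
Proof.
move=> ep x [h e]; pose h' v := (lret p v \o h v)%VF.
exists (push (lret i) (c - cob h')), h'.
apply: coc_ext => a y; rewrite cocDE cocNE !pushE.
have [z zE] : exists z, i (tgt a) z = (c - cob h') a y.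
  apply/x; rewrite !cocE !comp_lfunE !lfB homE !lsecK //.
  by move/ffunP/(_ a)/lfunP/(_ y): e; rewrite pushE cobE => ->; rewrite subrr.
by rewrite -zE lretKK zE cocDE cocNE subKr.
Qed.

(** Middle exactness of Ext^1(-, B): a trivialisation on [A'] extends vertexwise to [A], and after
    subtracting its coboundary the cocycle vanishes on the image of [i]. *)
Lemma pull_exact A' A A'' B (i : hom A' A) (p : hom A A'') (c : coc A B) :
  mono i -> exact i p -> cobound (pull c i) -> exists c' : coc A'' B, cobound (c - pull c' p).
Proof.
move=> mi x [h e]; pose h' v := (h v \o lret i v)%VF.
exists (pull (c - cob h') (lret p)), h'.
apply: coc_ext => a y; rewrite cocDE cocNE !pullE.
have [z zE] : exists z, i (src a) z = y - lret p (src a) (p (src a) y).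
  by apply/x; rewrite lfB lretKK subrr.
have : (c - cob h') a (y - lret p (src a) (p (src a) y)) = 0.
  rewrite -zE !cocE !comp_lfunE -homE !lretK //.
  by move/ffunP/(_ a)/lfunP/(_ z): e; rewrite pullE cobE => ->; rewrite subrr.
by rewrite lfB => /eqP; rewrite subr_eq0 => /eqP <-; rewrite cocDE cocNE subKr.
Qed.

Lemma ext_inD A B (c : coc A B) v (b : B v) (a : A v) :
  (b, a) = ext_in c v b + (0, a) :> ext_rep c v.
Proof. by rewrite ext_inE; congr pair; rewrite ?addr0 ?add0r. Qed.

(** Exactness of Hom(E, W) -> Hom(B, W) -> Ext^1(A, W), with E the extension: the connecting map
    sends [g] to the class of [push g c]. *)
Lemma ext_in_factor A B W (c : coc A B) (g : hom B W) :
  (exists k, hcomp k (ext_in c) = g) <-> cobound (push g c).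
Proof.
split=> [[r rE]|[h e]].
  (* The vertexwise section [a |-> (0, a)] fails to commute with the arrows by [c], so [r]
     restricted to it trivialises [push g c]; the sign matches the convention of [cob]. *)
  pose j v (a : A v) : W v := - r v (0, a).
  have jl v : linear (@j v).
    move=> k x y; rewrite /j.
    have -> : (0, k *: x + y) = k *: (0, x) + (0, y) :> ext_rep c v.
      by congr pair; rewrite /= scaler0 addr0.
    by rewrite lfD lfZ opprD scalerN.
  exists (fun v => linfun (@j v)); apply: coc_ext => a x.
  rewrite cobE !(linfun_linearE (@jl _)) /j pushE.
  have := homE r ((0, x) : ext_rep c (src a)); rewrite ext_rmapE lf0 add0r /= (ext_inD c) lfD.
  by rewrite -(hcompE r) rE => e; rewrite lfN opprK -e addrC addrK.
pose r v (p : (B v * A v)%type) : W v := g v p.1 - h v p.2.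
have rl v : linear (@r v).
  move=> k x y; rewrite /r.
  rewrite -[(k *: x + y).1]/(k *: x.1 + y.1) -[(k *: x + y).2]/(k *: x.2 + y.2).
  by rewrite !lfD !lfZ scalerBr opprD addrACA.
have rP a (x : ext_rep c (src a)) :
    (linfun (@r (tgt a)) : 'Hom(ext_rep c _, W _)) (rmap (ext_rep c) a x)
    = rmap W a ((linfun (@r (src a)) : 'Hom(ext_rep c _, W _)) x).
  rewrite ext_rmapE !(linfun_linearE (@rl _)) /r /= lfD lfB homE -pushE e cobE -addrA.
  by congr (_ + _); rewrite addrAC subrr add0r.
exists (@mkhom _ _ (ext_rep c) W (fun v => linfun (@r v)) rP).
by apply: hom_ext => v x; rewrite hcompE ext_inE /= (linfun_linearE (@rl _)) /r /= lf0 subr0.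
Qed.

Lemma ext_out_factor A B W (c : coc A B) (f : hom W A) :
  (exists k, hcomp (ext_out c) k = f) <-> cobound (pull c f).
Proof.
split=> [[s sE]|[h e]].
  have s2 v x : (s v x).2 = f v x by rewrite -ext_outE -hcompE sE.
  pose j v (a : W v) : B v := (s v a).1.
  have jl v : linear (@j v) by move=> k x y; rewrite /j lfD lfZ.
  exists (fun v => linfun (@j v)); apply: coc_ext => a x.
  rewrite cobE !(linfun_linearE (@jl _)) /j pullE.
  by rewrite homE ext_rmapE /= s2 addrC addKr.
pose s v (a : W v) : (B v * A v)%type := (h v a, f v a).
have sl v : linear (@s v) by move=> k x y; rewrite /s !lfD !lfZ.
have sP a x :
    (linfun (@s (tgt a)) : 'Hom(_, ext_rep c _)) (rmap W a x)
    = rmap (ext_rep c) a (linfun (@s (src a)) x).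
  by rewrite ext_rmapE !(linfun_linearE (@sl _)) /s /= -pullE e cobE addrC subrK homE.
exists (@mkhom _ _ W (ext_rep c) (fun v => linfun (@s v)) sP).
by apply: hom_ext => v x; rewrite hcompE ext_outE /= (linfun_linearE (@sl _)).
Qed.

Lemma ext_in_split A B (c : coc A B) : split_mono (ext_in c) <-> cobound c.
Proof.
rewrite -[c in cobound c]push_id -ext_in_factor; apply: iff_trans (split_monoP _) _.
by [].
Qed.

Lemma ext_out_split A B (c : coc A B) : split_epi (ext_out c) <-> cobound c.
Proof.
rewrite -[c in cobound c]pull_id -ext_out_factor; apply: iff_trans (split_epiP _) _.
by [].
Qed.

(** A linear section of [g] splits the sequence at each vertex; the off-diagonal blocks of the
    arrows in this splitting form the cocycle. *)
Lemma ses_ext B E A (f : hom B E) (g : hom E A) : ses f g ->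
  exists (c : coc A B) (phi : hom E (ext_rep c)),
    [/\ is_iso phi, hcomp phi f = ext_in c & hcomp (ext_out c) phi = g].
Proof.
move=> sfg; have [mf eg x] := sfg.
(* The retraction complementary to the section [lret g]: [f] after [rho] is the identity minus
   [lret g] after [g]. *)
pose rho v : 'Hom(E v, B v) := (lret f v \o (\1%VF - (lret g v \o g v)%VF))%VF.
have rhoE v y : f v (rho v y) = y - lret g v (g v y).
  rewrite comp_lfunE add_lfunE opp_lfunE id_lfunE comp_lfunE.
  have [z <-] : exists z, f v z = y - lret g v (g v y).
    by apply/x; rewrite lfB lretKK subrr.
  by rewrite lretK.
pose c : coc A B := [ffun a => (rho (tgt a) \o rmap E a \o lret g (src a))%VF].
have cE a y : c a y = rho (tgt a) (rmap E a (lret g (src a) y)).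
  by rewrite ffunE !comp_lfunE.
pose p v (y : E v) : (B v * A v)%type := (rho v y, g v y).
have pl v : linear (@p v) by move=> k y z; rewrite /p !lfD !lfZ.
have pP a y : (linfun (@p (tgt a)) : 'Hom(_, ext_rep c _)) (rmap E a y)
    = rmap (ext_rep c) a (linfun (@p (src a)) y).
  rewrite ext_rmapE !(linfun_linearE (@pl _)) /p homE; congr pair.
  apply: mf; rewrite lfD cE homE !rhoE lfB homE /= homE lsecK //.
  by rewrite addrA subrK.
exists c, (@mkhom _ _ E (ext_rep c) (fun v => linfun (@p v)) pP); split.
- split.
    apply: mono0 => v y /=; rewrite linfun_linearE // => -[r0 g0].
    by have := rhoE v y; rewrite r0 g0 !lf0 subr0.
  move=> v [b a]; exists (f v b + lret g v a); rewrite /= (linfun_linearE (@pl _)) /p.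
  have e : g v (f v b + lret g v a) = a by rewrite lfD (ses_comp0 _ sfg) add0r lsecK.
  by congr pair => //; apply: mf; rewrite rhoE e addrK.
- apply: hom_ext => v y; rewrite hcompE ext_inE /= (linfun_linearE (@pl _)) /p.
  rewrite (ses_comp0 _ sfg); congr pair.
  by apply: mf; rewrite rhoE (ses_comp0 _ sfg) lf0 subr0.
by apply: hom_ext => v y; rewrite hcompE ext_outE /= (linfun_linearE (@pl _)).
Qed.

Lemma split_epi_isor M N X (g : hom N X) (f : hom M N) :
  is_iso f -> split_epi (hcomp g f) <-> split_epi g.
Proof.
move=> /iso_inverse [f' [_ ff']]; split=> /split_epiP [s e]; apply/split_epiP.
  by exists (hcomp f s); rewrite hcompA.
exists (hcomp f' s); rewrite hcompA -(hcompA g) ff'.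
by rewrite -e; apply: hom_ext => v x; rewrite !hcompE hidE.
Qed.

Lemma split_mono_isol M N X (g : hom N X) (f : hom M N) :
  is_iso g -> split_mono (hcomp g f) <-> split_mono f.
Proof.
move=> /iso_inverse [g' [g'g _]]; split=> /split_monoP [s e]; apply/split_monoP.
  by exists (hcomp s g); rewrite -hcompA.
exists (hcomp s g'); rewrite -hcompA (hcompA g') g'g.
by rewrite -e; apply: hom_ext => v x; rewrite !hcompE hidE.
Qed.

Lemma Ext1_zeroP A B : Ext1_zero A B <-> forall c : coc A B, cobound c.
Proof.
split=> [h c|h E f g /short_exactP/ses_ext [c [phi [iphi _ <-]]]].
  by apply/ext_out_split; apply: h (ext_in c) _ _; apply/short_exactP/ext_ses.
by apply/(split_epi_isor _ iphi)/ext_out_split.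
Qed.

Lemma Ext1_nonzero A B : ~ Ext1_zero A B -> exists c : coc A B, ~ cobound c.
Proof. by move=> h; apply: contrapT => /forallNP no; apply/h/Ext1_zeroP => c; apply: contrapT. Qed.

(** The hereditary property: a cocycle is an arbitrary family of linear maps, so one on [A'] extends
    to [A] along vertexwise retractions, and Ext^1(A, B) -> Ext^1(A', B) is onto. *)
Lemma Ext1_mono A' A B (i : hom A' A) : mono i -> Ext1_zero A B -> Ext1_zero A' B.
Proof.
move=> mi /Ext1_zeroP h; apply/Ext1_zeroP => c.
have -> : c = pull (pull c (lret i)) i by apply: coc_ext => a x; rewrite !pullE lretK.
exact: cobound_pull.
Qed.

Lemma Ext1_epi A B B'' (p : hom B B'') : epi p -> Ext1_zero A B -> Ext1_zero A B''.
Proof.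
move=> ep /Ext1_zeroP h; apply/Ext1_zeroP => c.
have -> : c = push p (push (lret p) c) by apply: coc_ext => a x; rewrite !pushE lsecK.
exact: cobound_push.
Qed.

Lemma Ext1_extl A' A A'' B (i : hom A' A) (p : hom A A'') : ses i p ->
  Ext1_zero A' B -> Ext1_zero A'' B -> Ext1_zero A B.
Proof.
move=> [mi ep x] /Ext1_zeroP h /Ext1_zeroP h'; apply/Ext1_zeroP => c.
have [c' e] := pull_exact mi x (h (pull c i)).
by apply: cobound_addl e _; apply: cobound_pull.
Qed.

Lemma Ext1_extr A B' B B'' (i : hom B' B) (p : hom B B'') : ses i p ->
  Ext1_zero A B' -> Ext1_zero A B'' -> Ext1_zero A B.
Proof.
move=> [mi ep x] /Ext1_zeroP h /Ext1_zeroP h'; apply/Ext1_zeroP => c.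
have [c' e] := push_exact ep x (h' (push p c)).
by apply: cobound_addl e _; apply: cobound_push.
Qed.

End ExtCalculus.

(** * Indecomposables and almost split sequences *)

Section Indecomposable.
Variables (F : fieldType) (Q : quiver).
Local Notation rep := (rep F Q).
Implicit Types (A B C D E M N X Y Z W : rep).

Definition biprod X A B (iA : hom A X) (pA : hom X A) (iB : hom B X) (pB : hom X B) :=
  [/\ hcomp pA iA = hid A, hcomp pB iB = hid B
    & forall v x, x = iA v (pA v x) + iB v (pB v x)].

Lemma biprod_ses X A B (iA : hom A X) pA (iB : hom B X) pB :
  biprod iA pA iB pB -> ses iA pB.
Proof.
move=> [eA eB e]; have mA : mono iA by apply: (@mono_compr _ _ _ _ _ pA); rewrite eA; apply: mono_id.
have mB : mono iB by apply: (@mono_compr _ _ _ _ _ pB); rewrite eB; apply: mono_id.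
split=> //; first by apply: (@epi_compl _ _ _ _ _ _ iB); rewrite eB; apply: epi_id.
move=> v y; split=> [y0|[x <-]]; first by exists (pA v y); rewrite [RHS](e v) y0 lf0 addr0.
apply: mB; rewrite lf0; have := e v (iA v x); rewrite -(hcompE pA) eA hidE.
by rewrite -[X in X = _]addr0 => /addrI.
Qed.

Lemma biprod_sym X A B (iA : hom A X) pA (iB : hom B X) pB :
  biprod iA pA iB pB -> biprod iB pB iA pA.
Proof. by move=> [a b e]; split=> // v x; rewrite addrC. Qed.

Lemma complement_proj X (U W : subrep X) :
  (forall v, (U v + W v)%VS = fullv /\ (U v :&: W v)%VS = 0%VS) ->
  exists p : hom X (rep_of_sub U), hcomp p (sub_incl U) = hid _ /\
    hcomp p (sub_incl W) = hzero _ _.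
Proof.
move=> c; have [mW eW xW] := quot_ses W.
have isoq : is_iso (hcomp (quot_proj W) (sub_incl U)).
  split.
    apply: mono0 => v x; rewrite hcompE => /xW/sub_inclP xxW.
    have : sub_incl U v x \in (U v :&: W v)%VS.
      by rewrite memv_cap xxW andbT; apply/sub_inclP; exists x.
    have [_ ->] := c v; rewrite memv0 => /eqP; apply: mono_eq0; exact: sub_incl_mono.
  move=> v y; have [x <-] := eW v y.
  have : x \in (U v + W v)%VS by have [-> _] := c v; apply: memvf.
  case/memv_addP => u /sub_inclP [u' <-] [w /sub_inclP/xW w0 ->].
  by exists u'; rewrite lfD w0 addr0 hcompE.
have [q [q1 q2]] := iso_inverse isoq; exists (hcomp q (quot_proj W)); split.
  by rewrite -hcompA.
apply: hom_ext => v x; rewrite hzeroE !hcompE (_ : quot_proj W v _ = 0) ?lf0 //.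
by apply/xW; exists x.
Qed.

Lemma decomposable X : ~ is_zero X -> ~ indecomposable X ->
  exists A B (iA : hom A X) pA (iB : hom B X) pB,
    [/\ biprod iA pA iB pB, ~ is_zero A & ~ is_zero B].
Proof.
move=> nz nind.
have : exists U W : subrep X,
  (forall v, (U v + W v)%VS = fullv /\ (U v :&: W v)%VS = 0%VS) /\
  ~ is_zero (rep_of_sub U) /\ ~ is_zero (rep_of_sub W).
  apply: contrapT => no; apply: nind; split=> // U W c.
  by apply: contrapT => /not_orP [a b]; apply: no; exists U, W.
move=> [U [W [c [nU nW]]]].
have [p [p1 p0]] := complement_proj c.
have [q [q1 q0]] : exists p : hom X (rep_of_sub W), hcomp p (sub_incl W) = hid _ /\
    hcomp p (sub_incl U) = hzero _ _.
  by apply: complement_proj => v; rewrite addvC capvC.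
exists _, _, (sub_incl U), p, (sub_incl W), q; split=> //; split=> // v x.
have : x \in (U v + W v)%VS by have [-> _] := c v; apply: memvf.
case/memv_addP => u /sub_inclP [u' <-] [w /sub_inclP [w' <-] ->].
by rewrite !lfD -![p v _]hcompE -![q v _]hcompE p1 p0 q1 q0 !hidE !hzeroE !lf0 addr0 add0r.
Qed.

Lemma tdim_gt0 X : ~ is_zero X -> (0 < tdim X)%N.
Proof. by move=> h; rewrite lt0n; apply/eqP => /is_zero_tdim. Qed.

Lemma iso_zero M N : iso M N -> is_zero M -> is_zero N.
Proof. by move=> h; rewrite !is_zero_tdim (iso_tdim h). Qed.

Lemma mono_zero M N (f : hom M N) : mono f -> is_zero N -> is_zero M.
Proof. by move=> /mono_tdim h; rewrite !is_zero_tdim; lia. Qed.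
Lemma epi_zero M N (f : hom M N) : epi f -> is_zero M -> is_zero N.
Proof. by move=> /epi_tdim h; rewrite !is_zero_tdim; lia. Qed.

(** The image of [s] and the kernel of [r] are complementary, and the image is nonzero. *)
Lemma indec_retract A X (s : hom A X) (r : hom X A) :
  indecomposable X -> ~ is_zero A -> hcomp r s = hid A -> is_iso s.
Proof.
move=> [nz ind] nA e.
have ms : mono s by apply: (@mono_compr _ _ _ _ _ r); rewrite e; apply: mono_id.
have [|z|z] := ind (img s) (ker r).
- move=> v; split.
    apply/vspaceP => x; rewrite memvf; apply/memv_addP.
    exists (s v (r v x)); first by apply/imgP; exists (r v x).
    exists (x - s v (r v x)); last by rewrite addrC subrK.
    by apply/kerP; rewrite lfB -(hcompE r) e hidE subrr.
  apply/vspaceP => x; rewrite memv_cap memv0; apply/andP/eqP => [[]|->]; last by rewrite !mem0v.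
  by move=> /imgP [y <-] /kerP; rewrite -hcompE e hidE => ->; rewrite lf0.
- by case: nA; apply: iso_zero z; apply: img_iso.
have mr : mono r.
  apply: mono0 => v x /kerP/sub_inclP [y <-].
  by move/is_zeroP: z => /(_ v y) ->; rewrite lf0.
split=> // v x; exists (r v x); apply: mr.
by rewrite -(hcompE r) e hidE.
Qed.

Lemma split_mono_indec A X (s : hom A X) :
  indecomposable X -> ~ is_zero A -> split_mono s -> is_iso s.
Proof. by move=> iX nA /split_monoP [r e]; apply: indec_retract e. Qed.

Lemma split_epi_indec X A (r : hom X A) :
  indecomposable X -> ~ is_zero A -> split_epi r -> is_iso r.
Proof.
move=> iX nA /split_epiP [s e]; have h := indec_retract iX nA e.
have [t [ts st]] := iso_inverse h.
have -> : r = t by apply: hom_ext => v x; rewrite -{1}(hidE x) -st -(hcompE r) hcompA e hcompE hidE.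
by apply: inverse_iso st ts.
Qed.

Fixpoint hpow X (f : hom X X) n : hom X X := if n is m.+1 then hcomp f (hpow f m) else hid X.

Lemma hpowS X (f : hom X X) n v x : hpow f n.+1 v x = hpow f n v (f v x).
Proof. by elim: n => [|n IH]; rewrite /= !hcompE ?hidE // -IH /= hcompE. Qed.

Lemma hpowD X (f : hom X X) n m v x : hpow f (n + m) v x = hpow f n v (hpow f m v x).
Proof. by elim: n => [|n IH]; rewrite ?hidE //= !hcompE IH. Qed.

(* Fitting's lemma: once the kernels of the powers of [f] stop growing, [X] is the
   direct sum of the kernel and the image of a power of [f]. *)
Lemma fitting X (f : hom X X) : indecomposable X ->
  is_iso f \/ exists n, hpow f n = hzero X X.
Proof.
move=> [nz ind].
pose kd n := (\sum_v \dim (ker (hpow f n) v))%N.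
have kle n v : (\dim (ker (hpow f n) v) <= dv X v)%N by apply: dimvS; apply: subvf.
have [||m [[n nE] mx]] := @max_nat (fun m => exists n, kd n = m) (tdim X).
- by exists (kd 0%N), 0%N.
- by move=> m [n <-]; apply: leq_sum => v _; apply: kle.
have sub v : (ker (hpow f n) v <= ker (hpow f (n + n)) v)%VS.
  by apply/subvP => x /kerP x0; apply/kerP; rewrite hpowD x0 lf0.
have eqk v : ker (hpow f n) v = ker (hpow f (n + n)) v.
  apply/eqP; rewrite eqEdim sub /=.
  have : (kd (n + n) <= kd n)%N by rewrite nE; apply: mx; exists (n + n)%N.
  rewrite /kd (bigD1 v) //= [X in (_ <= X)%N](bigD1 v) //=.
  have : (\sum_(i | i != v) \dim (ker (hpow f n) i)
         <= \sum_(i | i != v) \dim (ker (hpow f (n + n)) i))%N.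
    by apply: leq_sum => i _; apply: dimvS; apply: sub.
  by rewrite /=; lia.
have cap v : (img (hpow f n) v :&: ker (hpow f n) v = 0)%VS.
  apply/vspaceP => x; rewrite memv_cap memv0; apply/andP/eqP => [[]|->]; last by rewrite !mem0v.
  by move=> /imgP [y <-] /kerP; rewrite -hpowD => /kerP; rewrite -eqk => /kerP.
have sum v : (img (hpow f n) v + ker (hpow f n) v = fullv)%VS.
  apply/eqP; rewrite eqEdim subvf /= -(limg_ker_dim (hpow f n v) fullv) capfv.
  by rewrite dimv_disjoint_sum ?cap // addnC.
have [|z|z] := ind (img (hpow f n)) (ker (hpow f n)).
- by move=> v; split.
- right; exists n; apply: hom_ext => v x; rewrite hzeroE.
  have /imgP/sub_inclP [y <-] : exists y, hpow f n v y = hpow f n v x by exists x.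
  by move/is_zeroP: z => /(_ v y) ->; rewrite lf0.
left; have k1 v : \dim (ker (hpow f 1) v) = 0%N.
  suff : kd 1%N == 0%N by rewrite /kd sum_nat_eq0 => /forallP/(_ v)/eqP.
  rewrite -leqn0; apply: leq_trans (mx _ (ex_intro _ 1%N erefl)) _.
  rewrite -nE leqn0 /kd sum_nat_eq0.
  by apply/forallP => u /=; rewrite -(dim_subvs (ker (hpow f n) u)); apply/eqP/z.
apply: mono_tdim_iso => //; apply: mono0 => v x fx.
have : x \in ker (hpow f 1) v by apply/kerP; rewrite hpowS fx lf0.
by have /eqP := k1 v; rewrite dimv_eq0 => /eqP ->; rewrite memv0 => /eqP.
Qed.

(** If [f] is not invertible it is nilpotent, and then [g] is injective, because [g x = 0] forces
    [f x = x]. *)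
Lemma local_end X (f g : hom X X) : indecomposable X ->
  (forall v x, f v x + g v x = x) -> is_iso f \/ is_iso g.
Proof.
move=> iX e; have [|[n fn]] := fitting f iX; [by left|right].
apply: mono_tdim_iso => //; apply: mono0 => v x gx.
have fx : f v x = x by rewrite -[RHS](e v) gx addr0.
have : hpow f n v x = x by elim: n {fn} => [|n IH]; rewrite ?hidE // hpowS fx.
by rewrite fn hzeroE.
Qed.

(** The identity of [W] is a sum of projections to summands, so one of the resulting composites is
    nonzero. This allows tests on an arbitrary middle object to be made on an indecomposable one. *)
Lemma indec_summand_factor A W B (f : hom A W) (g : hom W B) : hcomp g f <> hzero A B ->
  exists W' (i : hom W' W) (p : hom W W'),
    [/\ indecomposable W', hcomp p i = hid W' & hcomp (hcomp g i) (hcomp p f) <> hzero A B].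
Proof.
have [n] := ubnP (tdim W); elim: n W f g => // n IH W f g; rewrite ltnS => le nz.
have nW : ~ is_zero W.
  by move=> /is_zeroP z; apply: nz; apply: hom_ext => v x; rewrite hcompE (z v (f v x)) lf0 hzeroE.
have [iW|dW] := pselect (indecomposable W).
  by exists W, (hid W), (hid W); split=> //; [apply: hom_ext => v x; rewrite hcompE !hidE|
    move=> e; apply: nz; rewrite -e; apply: hom_ext => v x; rewrite !hcompE !hidE].
have [C [D [iC [pC [iD [pD [bp nC nD]]]]]]] := decomposable nW dW.
have tW := ses_tdim (biprod_ses bp); have := tdim_gt0 nC; have := tdim_gt0 nD => d1 d2.
have [[eC eD e] _] := (bp, I).
suff : hcomp (hcomp g iC) (hcomp pC f) <> hzero A B \/
       hcomp (hcomp g iD) (hcomp pD f) <> hzero A B.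
  case=> h; [have [|W' [i [p [iW' ep h']]]] := IH _ _ _ _ h|
             have [|W' [i [p [iW' ep h']]]] := IH _ _ _ _ h]; try lia.
    exists W', (hcomp iC i), (hcomp p pC); split=> //; last by move: h'; rewrite !hcompA.
    by rewrite -hcompA (hcompA pC) eC -ep; apply: hom_ext => v x; rewrite !hcompE hidE.
  exists W', (hcomp iD i), (hcomp p pD); split=> //; last by move: h'; rewrite !hcompA.
  by rewrite -hcompA (hcompA pD) eD -ep; apply: hom_ext => v x; rewrite !hcompE hidE.
apply: contrapT => /not_orP [/contrapT hC /contrapT hD]; apply: nz; apply: hom_ext => v x.
have := congr1 (fun h : hom A B => h v x) hC; have := congr1 (fun h : hom A B => h v x) hD.
rewrite !hcompE hzeroE => z1 z2; by rewrite [f v x](e v) lfD z1 z2 addr0.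
Qed.

Lemma indec_summand X : ~ is_zero X -> exists D, indecomposable D /\ summand D X.
Proof.
move=> nX; have [|W' [i [p [iW' ep _]]]] := @indec_summand_factor X X X (hid X) (hid X).
  apply/hneq0P; have [v [x x0]] := iffLR (nonzeroP X) nX.
  by exists v, x; rewrite hcompE !hidE.
by exists W'; split=> //; exists i; apply/split_monoP; exists p.
Qed.

End Indecomposable.

(** * Almost split sequences as extension classes *)

Section AlmostSplit.
Variables (F : fieldType) (Q : quiver).
Local Notation rep := (rep F Q).
Implicit Types (A B C D E M N X Y Z W : rep).

(** The almost split conditions, expressed on the class of the sequence instead of its middle term
    through [ext_in_factor] and [ext_out_factor]. *)
Definition ar_coc Z X (c : coc Z X) :=
  [/\ ~ cobound c,
      forall W (g : hom X W), ~ split_mono g -> cobound (push g c)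
    & forall W (h : hom W Z), ~ split_epi h -> cobound (pull c h)].

Lemma hcomp_idl M N (f : hom M N) : hcomp (hid N) f = f.
Proof. by apply: hom_ext => v x; rewrite hcompE hidE. Qed.
Lemma hcomp_idr M N (f : hom M N) : hcomp f (hid M) = f.
Proof. by apply: hom_ext => v x; rewrite hcompE hidE. Qed.

Lemma ar_translateP Z X : ar_translate Z X <-> exists c : coc Z X, ar_coc c.
Proof.
split=> [[E [f [g [/short_exactP/ses_ext [c [phi [iphi ef eg]]] [nf lf] [ng rg]]]]]|[c [nc lc rc]]].
  have [psi [e1 e2]] := iso_inverse iphi; exists c; split.
  - by move/ext_in_split; rewrite -ef => /(split_mono_isol _ iphi).
  - move=> W h /lf/factors_leftP [k ek]; apply/ext_in_factor; exists (hcomp k psi).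
    by rewrite -ef -hcompA (hcompA psi) e1 hcomp_idl.
  move=> W h /rg/factors_rightP [k ek]; apply/ext_out_factor; exists (hcomp phi k).
  by rewrite hcompA eg.
exists (ext_rep c), (ext_in c), (ext_out c); split; first exact/short_exactP/ext_ses.
  split; first by move/ext_in_split.
  by move=> W h /lc/ext_in_factor/factors_leftP.
split; first by move/ext_out_split.
by move=> W h /rc/ext_out_factor/factors_rightP.
Qed.

(** In a decomposition of [X] neither projection is split mono, so both pushes of [c] vanish; but
    [c] is recovered as the sum of these pushes. *)
Lemma ar_coc_indecr Z X (c : coc Z X) : ar_coc c -> indecomposable X.
Proof.
move=> [nc lc _].
have nX : ~ is_zero X.
  move/is_zeroP => z; apply: nc; exists (fun v => 0); apply: coc_ext => a x.
  by rewrite [LHS]z [RHS]z.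
apply: contrapT => /(decomposable nX) [A [B [iA [pA [iB [pB [bp nA nB]]]]]]].
have [eA eB e] := bp; have [mA _ _] := biprod_ses bp.
have [mB _ _] := biprod_ses (biprod_sym bp).
have ns C D (p : hom X C) (i : hom D X) : ~ is_zero D -> mono i ->
    (forall v y, p v (i v y) = 0) -> ~ split_mono p.
  move=> /nonzeroP [v [y y0]] mi z /split_mono_mono/mono_eq0 mp; apply: y0.
  by apply: (mono_eq0 mi); apply: mp.
have xA v y : pA v (iB v y) = 0.
  have [_ _ x] := biprod_ses (biprod_sym bp); by apply/x; exists y.
have xB v y : pB v (iA v y) = 0.
  have [_ _ x] := biprod_ses bp; by apply/x; exists y.
have /(cobound_push iA) hA := lc _ pA (ns _ _ _ _ nB mB xA).
have /(cobound_push iB) hB := lc _ pB (ns _ _ _ _ nA mA xB).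
apply: nc; have -> : c = push iA (push pA c) + push iB (push pB c).
  by apply: coc_ext => a x; rewrite !cocE -e.
exact: coboundD.
Qed.

Lemma ar_coc_indecl Z X (c : coc Z X) : ar_coc c -> indecomposable Z.
Proof.
move=> [nc _ rc].
have nX : ~ is_zero Z.
  move/is_zeroP => z; apply: nc; exists (fun v => 0); apply: coc_ext => a x.
  by rewrite (z _ x) !lf0.
apply: contrapT => /(decomposable nX) [A [B [iA [pA [iB [pB [bp nA nB]]]]]]].
have [eA eB e] := bp; have [mA eB' x] := biprod_ses bp.
have [mB eA' xA] := biprod_ses (biprod_sym bp).
have ns C D (i : hom C Z) (p : hom Z D) : ~ is_zero D -> epi p ->
    (forall v y, p v (i v y) = 0) -> ~ split_epi i.
  move=> /nonzeroP [v [y y0]] ep z /split_epi_epi ei; apply: y0.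
  by have [w <-] := ep v y; have [u <-] := ei v w; apply: z.
have hA : cobound (pull c iA) by apply/rc/(ns _ _ _ pB nB) => // v y; apply/x; exists y.
have hB : cobound (pull c iB) by apply/rc/(ns _ _ _ pA nA) => // v y; apply/xA; exists y.
apply: nc; have -> : c = pull (pull c iA) pA + pull (pull c iB) pB.
  by apply: coc_ext => a y; rewrite !cocE -lfD -e.
by apply: coboundD; apply: cobound_pull.
Qed.

(** The map from [X] to the cokernel of a nonzero [f] is not split mono, so it kills [c], and
    [push_exact] moves [c] back to [Y]. This is nondegeneracy of the Serre pairing in the Hom
    variable. *)
Lemma ar_coc_pushl Z X (c : coc Z X) Y (f : hom Y X) : ar_coc c -> f <> hzero Y X ->
  exists c' : coc Z Y, cobound (c - push f c').
Proof.
move=> [_ lc _] /hneq0P [v [y fy]]; have [C [q [epq x]]] := cokernel f.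
apply: (push_exact epq x); apply: lc => /split_mono_mono/mono_eq0 mq; apply: fy.
by apply: mq; apply/x; exists y.
Qed.

Lemma ar_coc_pullr Z X (c : coc Z X) Y (g : hom Z Y) : ar_coc c -> g <> hzero Z Y ->
  exists c' : coc Y X, cobound (c - pull c' g).
Proof.
move=> [_ _ rc] /hneq0P [v [y gy]]; have [K [k [mk x]]] := kernel g.
apply: (pull_exact mk x); apply: rc => /split_epi_epi ek; apply: gy.
by apply/x; apply: ek.
Qed.

(** The class [c] dies on the middle term of [c']. Its trivialisation there restricts to a morphism
    [Y -> X], because the pulled back cocycle vanishes on [Y], and this morphism pushes [c'] to [c].
    It is nondegeneracy of the Serre pairing in the Ext variable. *)
Lemma right_as_push Z X (c : coc Z X) Y (c' : coc Z Y) :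
  (forall W (h : hom W Z), ~ split_epi h -> cobound (pull c h)) -> ~ cobound c' ->
  exists f : hom Y X, cobound (c - push f c').
Proof.
move=> rc nc'.
have [h e] : cobound (pull c (ext_out c')) by apply: rc => /ext_out_split.
have fP a b : (h (tgt a) \o ext_in c' (tgt a))%VF (rmap Y a b)
    = rmap X a ((h (src a) \o ext_in c' (src a))%VF b).
  rewrite !comp_lfunE homE; apply/eqP; rewrite -subr_eq0 -cobE -e pullE.
  by rewrite (ses_comp0 _ (ext_ses c')) lf0.
exists (@mkhom _ _ Y X (fun v => h v \o ext_in c' v)%VF fP).
pose j v (z : Z v) : (Y v * Z v)%type := (0, z).
have jl v : linear (@j v).
  by move=> k x y; rewrite /j; congr pair; rewrite /= scaler0 addr0.
exists (fun v => h v \o linfun (@j v))%VF; apply: coc_ext => a z.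
have := congr1 (fun d : coc _ _ => d a ((0, z) : ext_rep c' (src a))) e.
rewrite pullE !cobE ext_outE ext_rmapE lf0 add0r !comp_lfunE !(linfun_linearE (@jl _)) /=.
rewrite cocDE cocNE pushE /= comp_lfunE => ->.
by rewrite (ext_inD c') lfD /j addrAC [_ + h _ (0, _)]addrC addrK.
Qed.

Lemma ar_coc_push Z X (c : coc Z X) Y (c' : coc Z Y) : ar_coc c -> ~ cobound c' ->
  exists f : hom Y X, cobound (c - push f c').
Proof. by move=> [_ _ rc]; apply: right_as_push. Qed.

Lemma left_as_pull Z X (c : coc Z X) Y (c' : coc Y X) :
  (forall W (g : hom X W), ~ split_mono g -> cobound (push g c)) -> ~ cobound c' ->
  exists g : hom Z Y, cobound (c - pull c' g).
Proof.
move=> lc nc'.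
have [h e] : cobound (push (ext_in c') c) by apply: lc => /ext_in_split.
pose h1 v : 'Hom(Z v, X v) := linfun (fun z => (h v z).1).
(* The second component of the trivialisation commutes with the arrows; the sign turns the relation
   into [c = cob h1 + pull c' h2]. *)
pose h2 v : 'Hom(Z v, Y v) := linfun (fun z => - (h v z).2).
have l1 v : linear (fun z : Z v => (h v z).1) by move=> k x y; rewrite lfD lfZ.
have l2 v : linear (fun z : Z v => - (h v z).2).
  by move=> k x y; rewrite lfD lfZ scalerN -opprD.
have E a z : (c a z, 0) = h (tgt a) (rmap Z a z)
    - (rmap X a (h (src a) z).1 + c' a (h (src a) z).2, rmap Y a (h (src a) z).2)
    :> (X (tgt a) * Y (tgt a))%type.
  by have := congr1 (fun d : coc _ _ => d a z) e; rewrite pushE cobE ext_inE ext_rmapE.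
have hP a z : h2 (tgt a) (rmap Z a z) = rmap Y a (h2 (src a) z).
  rewrite /h2 !(linfun_linearE (l2 _)) lfN; congr (- _).
  by have := congr1 snd (E a z) => /= /eqP; rewrite eq_sym subr_eq0 => /eqP.
exists (mkhom hP), h1; apply: coc_ext => a z.
rewrite cocDE cocNE cobE pullE /= /h1 /h2 !(linfun_linearE (l1 _)) !(linfun_linearE (l2 _)).
have -> : c a z = (h (tgt a) (rmap Z a z)).1
    - (rmap X a (h (src a) z).1 + c' a (h (src a) z).2) := congr1 fst (E a z).
by rewrite lfN opprK opprD addrA subrK.
Qed.

Lemma ar_coc_pull Z X (c : coc Z X) Y (c' : coc Y X) : ar_coc c -> ~ cobound c' ->
  exists g : hom Z Y, cobound (c - pull c' g).
Proof. by move=> [_ lc _]; apply: left_as_pull. Qed.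

Lemma cobound_neq Z X (c : coc Z X) Y (c' : coc Z Y) (f : hom Y X) :
  ~ cobound c -> cobound (c - push f c') -> ~ cobound c'.
Proof. by move=> nc e h; apply/nc/(cobound_addl e)/cobound_push. Qed.

Lemma serre_l Z X Y : ar_translate Z X -> Ext1_zero Z Y <-> forall f : hom Y X, f = hzero Y X.
Proof.
move=> /ar_translateP [c arc]; split=> [/Ext1_zeroP z f|h].
  apply: contrapT => /(ar_coc_pushl arc) [c' e]; have [nc _ _] := arc.
  exact: cobound_neq nc e (z c').
apply/Ext1_zeroP => c'; apply: contrapT => /(ar_coc_push arc) [f].
rewrite (h f) => e; have [nc _ _] := arc; apply/nc/(cobound_addl e).
rewrite (_ : push _ _ = 0); first exact: cobound0.
by apply: coc_ext => a x; rewrite !cocE hzeroE.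
Qed.

Lemma serre_r Z X Y : ar_translate Z X -> Ext1_zero Y X <-> forall f : hom Z Y, f = hzero Z Y.
Proof.
move=> /ar_translateP [c arc]; have [nc _ _] := arc; split=> [/Ext1_zeroP z f|h].
  apply: contrapT => /(ar_coc_pullr arc) [c' e].
  by apply/nc/(cobound_addl e)/cobound_pull/z.
apply/Ext1_zeroP => c'; apply: contrapT => /(ar_coc_pull arc) [f].
rewrite (h f) => e; apply/nc/(cobound_addl e).
rewrite (_ : pull _ _ = 0); first exact: cobound0.
by apply: coc_ext => a x; rewrite !cocE hzeroE lf0.
Qed.

Lemma coc_sub_trans A B (c c' c'' : coc A B) :
  cobound (c - c') -> cobound (c' - c'') -> cobound (c - c'').
Proof. by move=> h h'; rewrite -(subrK c' c) -addrA; apply: coboundD. Qed.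

(** A class fixed by [f] is fixed by all powers of [f], so [f] is not nilpotent and Fitting's lemma
    applies. *)
Lemma push_end Z X (c : coc Z X) (f : hom X X) : indecomposable X -> ~ cobound c ->
  cobound (c - push f c) -> is_iso f.
Proof.
move=> iX nc e; have [//|[n fn]] := fitting f iX; exfalso; apply: nc.
have : cobound (c - push (hpow f n) c).
  elim: n {fn} => [|n IH]; first by rewrite push_id subrr; apply: cobound0.
  rewrite [hpow _ _]/= push_comp; apply: coc_sub_trans e _.
  by rewrite -pushB; apply: cobound_push.
rewrite fn (_ : push _ _ = 0) ?subr0 //.
by apply: coc_ext => a x; rewrite !cocE hzeroE.
Qed.

Lemma pull_end Z X (c : coc Z X) (f : hom Z Z) : indecomposable Z -> ~ cobound c ->
  cobound (c - pull c f) -> is_iso f.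
Proof.
move=> iZ nc e; have [//|[n fn]] := fitting f iZ; exfalso; apply: nc.
have : cobound (c - pull c (hpow f n)).
  elim: n {fn} => [|n IH]; first by rewrite pull_id subrr; apply: cobound0.
  rewrite [hpow _ _]/= pull_comp; apply: coc_sub_trans IH _.
  by rewrite -pullB; apply: cobound_pull.
rewrite fn (_ : pull _ _ = 0) ?subr0 //.
by apply: coc_ext => a x; rewrite !cocE hzeroE lf0.
Qed.

Lemma iso_of_comp M N (f : hom M N) (g : hom N M) :
  is_iso (hcomp g f) -> is_iso (hcomp f g) -> is_iso f.
Proof. by move=> [/mono_compr a _] [_ /epi_compl b]. Qed.

(** Each of the two almost split classes is a push of the other; both composites fix a class and are
    invertible by [push_end]. *)
Lemma ar_unique_l Z X X' : ar_translate Z X -> ar_translate Z X' -> iso X X'.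
Proof.
move=> /ar_translateP [c arc] /ar_translateP [c' arc'].
have [nc _ _] := arc; have [nc' _ _] := arc'.
have [f fE] := ar_coc_push arc nc'; have [g gE] := ar_coc_push arc' nc.
apply/isoP; exists g; apply: (iso_of_comp (g := f)).
  apply: push_end (ar_coc_indecr arc) nc _; rewrite push_comp; apply: coc_sub_trans fE _.
  by rewrite -pushB; apply: cobound_push.
apply: push_end (ar_coc_indecr arc') nc' _; rewrite push_comp; apply: coc_sub_trans gE _.
by rewrite -pushB; apply: cobound_push.
Qed.

Lemma ar_unique_r Z Z' X : ar_translate Z X -> ar_translate Z' X -> iso Z Z'.
Proof.
move=> /ar_translateP [c arc] /ar_translateP [c' arc'].
have [nc _ _] := arc; have [nc' _ _] := arc'.
have [f fE] := ar_coc_pull arc nc'; have [g gE] := ar_coc_pull arc' nc.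
apply/isoP; exists f; apply: (iso_of_comp (g := g)).
  apply: pull_end (ar_coc_indecl arc) nc _; rewrite pull_comp; apply: coc_sub_trans fE _.
  by rewrite -pullB; apply: cobound_pull.
apply: pull_end (ar_coc_indecl arc') nc' _; rewrite pull_comp; apply: coc_sub_trans gE _.
by rewrite -pullB; apply: cobound_pull.
Qed.

Lemma ar_translate_iso Z Z' X X' : iso Z Z' -> iso X X' -> ar_translate Z X -> ar_translate Z' X'.
Proof.
move=> /isoP [f if_] /isoP [g ig] /ar_translateP [c [nc lc rc]]; apply/ar_translateP.
have [f' [ff1 ff2]] := iso_inverse if_; have [g' [gg1 gg2]] := iso_inverse ig.
have if' : is_iso f' by apply: inverse_iso ff2 ff1.
exists (push g (pull c f')); split.
- move=> /(cobound_push g')/(cobound_pull f); rewrite -push_comp gg1 push_id -pull_comp ff1.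
  by rewrite pull_id.
- move=> W h nh; rewrite -push_comp push_pull; apply/cobound_pull/lc.
  move/split_monoP => [r e]; apply: nh; apply/split_monoP; exists (hcomp g r).
  by rewrite -hcompA -[hcomp r h]hcomp_idr -gg2 (hcompA (hcomp r h)) -(hcompA r) e hcomp_idl.
move=> W h nh; rewrite -push_pull -pull_comp; apply/cobound_push/rc.
move/split_epiP => [r e]; apply: nh; apply/split_epiP; exists (hcomp r f').
by rewrite hcompA -[hcomp h r]hcomp_idl -ff2 -(hcompA f) (hcompA f') e hcomp_idr.
Qed.

(** If some [pull c h] is nonzero, [c] is in turn a pull of it; the resulting endomorphism of [Z]
    fixes [c], hence is invertible, and [h] splits. Existence proofs thus need to build only one
    half of the almost split property. *)
Lemma left_almost_split_coc Z X (c : coc Z X) : indecomposable Z -> ~ cobound c ->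
  (forall W (g : hom X W), ~ split_mono g -> cobound (push g c)) -> ar_coc c.
Proof.
move=> iZ nc lc; split=> // W h nh; apply: contrapT => nd.
have [g e] := left_as_pull lc nd; rewrite -pull_comp in e.
have /iso_inverse [k [_ hk]] := pull_end iZ nc e.
by apply: nh; apply/split_epiP; exists (hcomp g k); rewrite hcompA.
Qed.

Lemma right_almost_split_coc Z X (c : coc Z X) : indecomposable X -> ~ cobound c ->
  (forall W (h : hom W Z), ~ split_epi h -> cobound (pull c h)) -> ar_coc c.
Proof.
move=> iX nc rc; split=> // W g ng; apply: contrapT => nd.
have [f e] := right_as_push rc nd; rewrite -push_comp in e.
have /iso_inverse [k [kh _]] := push_end iX nc e.
by apply: ng; apply/split_monoP; exists (hcomp k f); rewrite -hcompA.
Qed.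

End AlmostSplit.

(** * Euler form and Serre duality *)

Section EulerForm.
Variables (F : fieldType) (Q : quiver).
Local Notation rep := (rep F Q).
Implicit Types (A B C D E M N X Y Z W : rep).

Definition famv A B := dprod (fun v : vertex Q => 'Hom(A v, B v)).

Lemma cob_linear A B : linear (fun u : famv A B => cob u).
Proof.
move=> k u w; apply: coc_ext => a x; rewrite !cocE !dprodDE !dprodZE.
by rewrite !add_lfunE !scale_lfunE lfD lfZ scalerBr opprD addrACA.
Qed.

Definition cobv A B : 'Hom(famv A B, coc A B) := linfun (fun u : famv A B => cob u).
Lemma cobvE A B (u : famv A B) : cobv A B u = cob u.
Proof. exact: (linfun_linearE (@cob_linear A B)). Qed.

Definition homsp A B : {vspace famv A B} := lker (cobv A B).
Definition cobsp A B : {vspace coc A B} := limg (cobv A B).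
(** [hd] and [ed] are the dimensions of Hom and Ext^1, taken as kernel and cokernel of the
    coboundary map. *)
Definition hd A B := \dim (homsp A B).
Definition ed A B := (\dim {: coc A B} - \dim (cobsp A B))%N.

Definition fam_of A B (f : fam A B) : famv A B := [ffun v => f v].
Lemma fam_ofE A B (f : fam A B) v : fam_of f v = f v. Proof. exact: ffunE. Qed.

Lemma cob_ext A B (f g : fam A B) : (forall v, f v = g v) -> cob f = cob g.
Proof. by move=> e; apply: coc_ext => a x; rewrite !cobE !e. Qed.

Lemma cobspP A B (c : coc A B) : c \in cobsp A B <-> cobound c.
Proof.
split=> [/memv_imgP [u _ ->]|[h ->]]; first by rewrite cobvE; exists u.
have -> : cob h = cobv A B (fam_of h).
  by rewrite cobvE; apply: cob_ext => v; rewrite fam_ofE.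
by rewrite memv_img ?memvf.
Qed.

Lemma homspP A B (u : famv A B) : u \in homsp A B <-> exists f : hom A B, u = fam_of f.
Proof.
rewrite memv_ker cobvE; split=> [/eqP e|[f ->]].
  have uP a x : u (tgt a) (rmap A a x) = rmap B a (u (src a) x).
    apply/eqP; rewrite -subr_eq0 -(cobE u) e; apply/eqP; exact: coc0E.
  by exists (mkhom uP); apply/ffunP => v; rewrite fam_ofE.
apply/eqP/coc_ext => a x; rewrite (cob_ext (fam_ofE f)) cobE homE subrr.
by symmetry; apply: coc0E.
Qed.

Lemma dim_famv A B : \dim {: famv A B} = (\sum_v dv A v * dv B v)%N.
Proof. by rewrite dim_dprod; apply: eq_bigr => v _; rewrite /dv !dimvf. Qed.

Lemma dim_coc A B : \dim {: coc A B} = (\sum_a dv A (src a) * dv B (tgt a))%N.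
Proof. by rewrite dim_dprod; apply: eq_bigr => a _; rewrite /dv !dimvf. Qed.

Definition euler (x y : {ffun vertex Q -> int}) : int :=
  \sum_v x v * y v - \sum_a x (src a) * y (tgt a).
Definition dvz M : {ffun vertex Q -> int} := [ffun v => (dv M v)%:Z].

Lemma sumz (I : finType) (f : I -> nat) : (\sum_i f i)%N%:Z = \sum_i (f i)%:Z.
Proof. exact: (big_morph Posz PoszD (erefl _)). Qed.

Lemma cobsp_le A B : (\dim (cobsp A B) <= \dim {: coc A B})%N.
Proof. by apply: dimvS; apply: subvf. Qed.

(** Rank-nullity for the coboundary map, whose source is counted by vertices and whose target by
    arrows. *)
Lemma eulerE A B : euler (dvz A) (dvz B) = (hd A B)%:Z - (ed A B)%:Z.
Proof.
have dC := cobsp_le A B.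
have := limg_ker_dim (cobv A B) fullv; rewrite capfv -/(homsp A B) -/(cobsp A B).
rewrite dim_famv /euler => e.
have -> : \sum_v dvz A v * dvz B v = (\sum_v dv A v * dv B v)%N%:Z.
  by rewrite sumz; apply: eq_bigr => v _; rewrite !ffunE.
have -> : \sum_a dvz A (src a) * dvz B (tgt a) = (\dim {: coc A B})%:Z.
  by rewrite dim_coc sumz; apply: eq_bigr => a _; rewrite !ffunE.
rewrite /hd /ed -e; move: dC; set x := \dim (homsp _ _); set y := \dim (cobsp _ _).
set z := \dim {: coc A B}; move: x y z => x y z; lia.
Qed.

Lemma hd_eq0 A B : hd A B = 0%N <-> forall f : hom A B, f = hzero A B.
Proof.
split=> [/eqP|h]; last first.
  apply/eqP; rewrite dimv_eq0; apply/eqP/vspaceP => u; rewrite memv0.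
  apply/idP/eqP => [/homspP [f ->]|->]; last exact: mem0v.
  by apply/ffunP => v; rewrite fam_ofE (h f) ffunE; apply/lfunP => x; rewrite hzeroE zero_lfunE.
rewrite dimv_eq0 => /eqP e f.
have : fam_of f \in homsp A B by apply/homspP; exists f.
rewrite e memv0 => /eqP f0; apply: hom_ext => v x.
by rewrite hzeroE -fam_ofE f0 ffunE zero_lfunE.
Qed.

Lemma ed_eq0 A B : ed A B = 0%N <-> Ext1_zero A B.
Proof.
have dC := cobsp_le A B; split=> [e|/Ext1_zeroP h].
  apply/Ext1_zeroP => c; apply/cobspP.
  have /eqP -> : cobsp A B == fullv by rewrite eqEdim subvf /=; move: e; rewrite /ed; lia.
  exact: memvf.
apply/eqP; rewrite subn_eq0; apply: dimvS; apply/subvP => c _; exact/cobspP.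
Qed.

Lemma hd_gt0 A B (f : hom A B) : f <> hzero A B -> (0 < hd A B)%N.
Proof. by move=> h; rewrite lt0n; apply/eqP => /hd_eq0 e; apply/h/e. Qed.

Lemma hd_gt0P A B : (0 < hd A B)%N -> exists f : hom A B, f <> hzero A B.
Proof.
move=> h; apply: contrapT => /forallNP no; have : hd A B = 0%N; last by lia.
by apply/hd_eq0 => f; apply: contrapT.
Qed.

Lemma push_famv A B B' k (u w : famv B B') (c : coc A B) :
  push (k *: u + w) c = k *: push u c + push w c.
Proof. by apply: coc_ext => a x; rewrite !cocE dprodDE dprodZE add_lfunE scale_lfunE. Qed.
Lemma pull_famv A A' B k (u w : famv A' A) (c : coc A B) :
  pull c (k *: u + w) = k *: pull c u + pull c w.
Proof.
by apply: coc_ext => a x; rewrite !cocE dprodDE dprodZE add_lfunE scale_lfunE lfD lfZ.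
Qed.
Lemma push_fam_of A B B' (f : hom B B') (c : coc A B) : push (fam_of f) c = push f c.
Proof. by apply: coc_ext => a x; rewrite !cocE fam_ofE. Qed.
Lemma pull_fam_of A A' B (f : hom A' A) (c : coc A B) : pull c (fam_of f) = pull c f.
Proof. by apply: coc_ext => a x; rewrite !cocE fam_ofE. Qed.
Lemma fam_of_eq0 A B (f : hom A B) : fam_of f = 0 <-> f = hzero A B.
Proof.
split=> [e|->]; last by apply/ffunP => v; rewrite !ffunE; apply/lfunP => x; rewrite hzeroE zero_lfunE.
by apply: hom_ext => v x; rewrite hzeroE -fam_ofE e ffunE zero_lfunE.
Qed.

Lemma cobound_functional A B (c : coc A B) : ~ cobound c ->
  exists phi : 'Hom(coc A B, F^o), phi c = 1 /\ forall c', cobound c' -> phi c' = 0.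
Proof.
move=> nc; have [|phi [p1 p0]] := @separating_functional _ _ (cobsp A B) c.
  by apply/negP => /cobspP.
by exists phi; split=> // c' /cobspP; apply: p0.
Qed.

Section SerreDuality.
Variables (Z X : rep) (tZX : ar_translate Z X).

(** A functional [phi] on Ext^1(Z, X) with value 1 on the almost split class pairs Hom(Y, X) with
    Ext^1(Z, Y) by [phi (push u c')]; [ar_coc_pushl] and [ar_coc_push] are its two
    nondegeneracies. *)
Lemma serre_dim_l Y : hd Y X = ed Z Y.
Proof.
have /ar_translateP [c arc] := tZX; have [nc _ _] := arc.
have [phi [p1 p0]] := cobound_functional nc.
pose beta (u : famv Y X) (c' : coc Z Y) : F := phi (push u c').
have bl c' : linear (beta^~ c' : famv Y X -> F^o).
  by move=> k u w; rewrite /beta push_famv lfD lfZ.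
have br u : linear (beta u : coc Z Y -> F^o).
  by move=> k c1 c2; rewrite /beta pushD pushZ lfD lfZ.
have nd u : u \in homsp Y X -> (forall c', beta u c' = 0) -> u = 0.
  move=> /homspP [f ->] h; apply/fam_of_eq0; apply: contrapT => /(ar_coc_pushl arc) [c' e].
  have := p0 _ e; rewrite lfB p1 -push_fam_of => /eqP.
  by rewrite [phi _](h c') subr0 oner_eq0.
have WP c' : c' \in cobsp Z Y <-> forall u, u \in homsp Y X -> beta u c' = 0.
  split=> [/cobspP cc u /homspP [f ->]|h].
    by rewrite /beta push_fam_of p0 //; apply: cobound_push.
  apply/cobspP; apply: contrapT => /(ar_coc_push arc) [f e].
  have := p0 _ e; rewrite lfB p1 -push_fam_of => /eqP.
  rewrite [phi (push _ _)]h ?subr0 ?oner_eq0 //; by apply/homspP; exists f.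
by rewrite -[hd _ _]/(\dim (homsp Y X)) /ed -(pairing_dim bl br nd WP) addnK.
Qed.

Lemma serre_dim_r Y : hd Z Y = ed Y X.
Proof.
have /ar_translateP [c arc] := tZX; have [nc _ _] := arc.
have [phi [p1 p0]] := cobound_functional nc.
pose beta (u : famv Z Y) (c' : coc Y X) : F := phi (pull c' u).
have bl c' : linear (beta^~ c' : famv Z Y -> F^o).
  by move=> k u w; rewrite /beta pull_famv lfD lfZ.
have br u : linear (beta u : coc Y X -> F^o).
  by move=> k c1 c2; rewrite /beta pullD pullZ lfD lfZ.
have nd u : u \in homsp Z Y -> (forall c', beta u c' = 0) -> u = 0.
  move=> /homspP [f ->] h; apply/fam_of_eq0; apply: contrapT => /(ar_coc_pullr arc) [c' e].
  have := p0 _ e; rewrite lfB p1 -pull_fam_of => /eqP.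
  by rewrite [phi _](h c') subr0 oner_eq0.
have WP c' : c' \in cobsp Y X <-> forall u, u \in homsp Z Y -> beta u c' = 0.
  split=> [/cobspP cc u /homspP [f ->]|h].
    by rewrite /beta pull_fam_of p0 //; apply: cobound_pull.
  apply/cobspP; apply: contrapT => /(ar_coc_pull arc) [f e].
  have := p0 _ e; rewrite lfB p1 -pull_fam_of => /eqP.
  rewrite [phi (pull _ _)]h ?subr0 ?oner_eq0 //; by apply/homspP; exists f.
by rewrite -[hd _ _]/(\dim (homsp Z Y)) /ed -(pairing_dim bl br nd WP) addnK.
Qed.

Lemma serre_euler Y : euler (dvz Z) (dvz Y) = - euler (dvz Y) (dvz X).
Proof. by rewrite !eulerE serre_dim_l serre_dim_r opprB. Qed.

End SerreDuality.
End EulerForm.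

(** * Existence of almost split sequences *)

Section SourceInduction.
Variables (Q : quiver) (acQ : acyclic Q).

(** By acyclicity the set of vertices reachable from a vertex shrinks strictly along each arrow. *)
Lemma tgt_induction (P : vertex Q -> Prop) :
  (forall v, (forall a, src a = v -> P (tgt a)) -> P v) -> forall v, P v.
Proof.
move=> IH v; pose r v := #|connect (@adj Q) v|.
have [n] := ubnP (r v); elim: n v => // n IHn v; rewrite ltnS => le.
apply: IH => a sa; apply: IHn; apply: leq_trans le; apply: proper_card; apply/properP; split.
  apply/fintype.subsetP => w; apply: connect_trans; apply: connect1.
  by apply/existsP; exists a; rewrite sa !eqxx.
by exists v; [apply: connect0|have := acQ a; rewrite sa].
Qed.

Lemma src_induction (P : vertex Q -> Prop) :
  (forall v, (forall a, tgt a = v -> P (src a)) -> P v) -> forall v, P v.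
Proof.
move=> IH v; pose r v := #|[pred w | connect (@adj Q) w v]|.
have [n] := ubnP (r v); elim: n v => // n IHn v; rewrite ltnS => le.
apply: IH => a sa; apply: IHn; apply: leq_trans le; apply: proper_card; apply/properP; split.
  apply/fintype.subsetP => w; rewrite !inE => h; apply: connect_trans h _; apply: connect1.
  by apply/existsP; exists a; rewrite sa !eqxx.
by exists v; rewrite !inE ?connect0 //; have := acQ a; rewrite sa.
Qed.

End SourceInduction.

Section PlaceAt.
Variables (F : fieldType) (I : eqType) (V : I -> vectType F).

Definition place i (x : V i) j : V j :=
  if i =P j is ReflectT e then ecast j (V j) e x else 0.

Lemma place_eq i (x : V i) : place x i = x.
Proof. by rewrite /place; case: eqP => // e; rewrite (eq_irrelevance e erefl). Qed.
Lemma place_neq i (x : V i) j : i <> j -> place x j = 0.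
Proof. by rewrite /place; case: eqP. Qed.
Lemma place_linear i j : linear (fun x : V i => place x j).
Proof.
move=> k x y; rewrite /place; case: eqP => [e|_]; last by rewrite scaler0 addr0.
by case: _ / e.
Qed.
End PlaceAt.

Lemma joint_inj_dim (F : fieldType) (V : vectType F) (I : finType) (W : I -> vectType F)
  (f : forall i, 'Hom(V, W i)) : (forall x, (forall i, f i x = 0) -> x = 0) ->
  (\dim {:V} <= \sum_i \dim (limg (f i)))%N.
Proof.
move=> inj; pose g (x : V) : dprod (fun i => subvs_of (limg (f i))) :=
  [ffun i => vsproj (limg (f i)) (f i x)].
have gl : linear g.
  by move=> k x y; apply/ffunP => i; rewrite dprodDE dprodZE !ffunE lfD lfZ linearP.
have : injective (linfun g).
  move=> x y /eqP; rewrite -subr_eq0 -lfB (linfun_linearE gl) => /eqP e.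
  apply/eqP; rewrite -subr_eq0; apply/eqP/inj => i.
  have : vsval (g (x - y) i) = 0 by rewrite e ffunE.
  by rewrite ffunE vsprojK // memv_img ?memvf.
move/injective_dim; rewrite dim_dprod => le; apply: (leq_trans le).
by apply: leq_sum => i _; rewrite dim_subvs.
Qed.

Lemma dim_limg_le (F : fieldType) (V W : vectType F) (f : 'Hom(V, W)) :
  (\dim (limg f) <= \dim {: W})%N.
Proof. by apply: dimvS; apply: subvf. Qed.

Section SemisimpleRep.
Variables (F : fieldType) (Q : quiver).
Local Notation rep := (rep F Q).

(** Semisimple representations provide the simples, a zero object, and a representation of each
    dimension vector on which the Euler form can be evaluated. *)
Definition ssrep (d : vertex Q -> nat) : rep :=
  @Rep F Q (fun w => 'rV[F]_(d w)) (fun a => 0).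

Lemma ssrep_dv d w : dv (ssrep d) w = d w.
Proof. by rewrite /dv dimvf; apply: mul1n. Qed.

Definition simple v := ssrep (fun w => nat_of_bool (w == v)).

Lemma simple_nonzero v : ~ is_zero (simple v).
Proof. by move/(_ v); rewrite -[\dim _]/(dv _ _) ssrep_dv eqxx. Qed.

Lemma ssrep0_zero : is_zero (ssrep (fun=> 0%N)).
Proof. by move=> v; rewrite -[\dim _]/(dv _ _) ssrep_dv. Qed.

Lemma const_mx_sum n (x : 'rV[F]_n) k : x = const_mx k -> n = 1%N -> \sum_j x 0 j = k.
Proof. by move=> -> ->; rewrite big_ord1 mxE. Qed.

Lemma hom_from_simple (Y : rep) v (y : Y v) :
  (forall a, rmap Y a (place y (src a)) = 0) ->
  exists k : hom (simple v) Y, forall w r, k w r = (\sum_j r 0 j) *: place y w.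
Proof.
(* The row [r] has one entry at [v] and none elsewhere; summing its entries reads it without a
   cast. *)
move=> h; pose k w (r : simple v w) : Y w := (\sum_j r 0 j) *: place y w.
have kl w : linear (@k w).
  move=> c r s; rewrite /k scalerA -scalerDl; congr (_ *: _).
  by rewrite mulr_sumr -big_split; apply: eq_bigr => j _; rewrite !mxE.
have kP a r : (linfun (@k (tgt a)) : 'Hom(simple v _, Y _)) (rmap (simple v) a r)
    = rmap Y a (linfun (@k (src a)) r).
  by rewrite !(linfun_linearE (kl _)) zero_lfunE /k lfZ h scaler0 big1 ?scale0r // => j _; rewrite mxE.
exists (@mkhom _ _ (simple v) Y (fun w => linfun (@k w)) kP) => w r.
by rewrite /= (linfun_linearE (kl _)).
Qed.

Lemma hom_to_simple (X : rep) v (l : 'Hom(X v, F^o)) :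
  (forall a x, place (V := fun w => 'Hom(X w, F^o)) l (tgt a) (rmap X a x) = 0) ->
  exists q : hom X (simple v),
    forall w x, q w x = const_mx (place (V := fun w => 'Hom(X w, F^o)) l w x).
Proof.
move=> h; pose q w (x : X w) : simple v w :=
  const_mx (place (V := fun w => 'Hom(X w, F^o)) l w x).
have ql w : linear (@q w).
  by move=> c r s; apply/rowP => j; rewrite /q lfD lfZ !mxE.
have qP a x : (linfun (@q (tgt a)) : 'Hom(X _, simple v _)) (rmap X a x)
    = rmap (simple v) a (linfun (@q (src a)) x).
  rewrite !(linfun_linearE (ql _)) zero_lfunE /q h.
  by apply/rowP => j; rewrite !mxE.
exists (@mkhom _ _ X (simple v) (fun w => linfun (@q w)) qP) => w r.
by rewrite /= (linfun_linearE (ql _)).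
Qed.

End SemisimpleRep.

Section Existence.
Variables (F : fieldType) (Q : quiver) (acQ : acyclic Q).
Local Notation rep := (rep F Q).
Implicit Types (A B C D E G K M N X Y Z W : rep).

Section Faithful.
Variable Z : rep.

(** By Yoneda a functional on Ext^1(Z, Y), that is one with [annih], is a natural map from Hom(-, Y)
    to the dual of Ext^1(Z, -); [faithful] says that this map is injective. *)
Definition faithful Y (eta : 'Hom(coc Z Y, F^o)) := forall K (k : hom K Y),
  mono k -> (forall c, eta (push k c) = 0) -> is_zero K.
Definition annih Y (eta : 'Hom(coc Z Y, F^o)) := forall h : fam Z Y, eta (cob h) = 0.

Definition rank1 Y a (l : 'Hom(Z (src a), F^o)) (y : forall w, Y w) : coc Z Y :=
  [ffun b => linfun (fun z => place (V := fun b => 'Hom(Z (src b), F^o)) l b z *: y (tgt b))].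

Lemma rank1E Y a (l : 'Hom(Z (src a), F^o)) (y : forall w, Y w) b z :
  rank1 l y b z = place (V := fun b => 'Hom(Z (src b), F^o)) l b z *: y (tgt b).
Proof.
rewrite ffunE linfun_linearE // => k x u.
by rewrite lfD lfZ scalerDl scalerA.
Qed.

(** A nonzero vector at [v] killed by all arrows out of [v], and by [eta] on all rank one cocycles
    with values in its span, generates a simple subobject that violates faithfulness. Hence [Y v]
    embeds in the sum of the spaces at the targets of these arrows and of double duals of spaces of
    [Z]. *)
Lemma faithful_dv Y (eta : 'Hom(coc Z Y, F^o)) v : faithful eta ->
  (dv Y v <= \sum_a (if src a == v then dv Y (tgt a) else 0) + \sum_a dv Z (src a))%N.
Proof.
move=> fe.
pose out a : 'Hom(Y v, Y (tgt a)) := linfun (fun y => rmap Y a (place y (src a))).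
have outl a : linear (fun y : Y v => rmap Y a (place y (src a))).
  by move=> k x y; rewrite place_linear lfD lfZ.
pose g a (y : Y v) (l : 'Hom(Z (src a), F^o)) : F^o := eta (rank1 l (place y)).
have gl a y : linear (@g a y).
  move=> k l m; rewrite /g -lfZ -lfD; congr (eta _); apply: coc_ext => b z.
  by rewrite !cocE !rank1E place_linear add_lfunE scale_lfunE scalerDl scalerA.
pose inn a : 'Hom(Y v, 'Hom('Hom(Z (src a), F^o), F^o)) := linfun (fun y => linfun (@g a y)).
have innl a : linear (fun y => linfun (@g a y)).
  move=> k x y; apply/lfunP => l; rewrite add_lfunE scale_lfunE !(linfun_linearE (gl a _)).
  rewrite /g -lfZ -lfD; congr (eta _); apply: coc_ext => b z.
  by rewrite !cocE !rank1E place_linear scalerDr !scalerA mulrC.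
have inj y : (forall a, out a y = 0) -> (forall a, inn a y = 0) -> y = 0.
  move=> o0 i0; apply: contrapT => y0.
  have [|k kE] := @hom_from_simple _ _ Y v y.
    by move=> a; have := o0 a; rewrite (linfun_linearE (outl a)).
  apply: (@simple_nonzero F Q v); apply: (fe _ k).
    apply: mono0 => w r; rewrite kE => /eqP; rewrite scaler_eq0.
    have [e|ne] := pselect (w = v); last first.
      by move=> _; apply/rowP => -[j jP]; exfalso; move: jP; rewrite (introF eqP ne).
    subst w; rewrite place_eq => /orP [/eqP s0|/eqP //].
    apply/rowP => j; rewrite mxE -[RHS]s0; symmetry.
    have e1 : forall i, i = j by case: j => j jP [i iP]; apply: val_inj => /=; move: jP iP; rewrite eqxx; lia.
    by rewrite (bigD1 j) //= big1 ?addr0 // => i; rewrite (e1 i) eqxx.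
  move=> c.
  pose l a : 'Hom(Z (src a), F^o) := linfun (fun z => \sum_j (c a z) 0 j : F^o).
  have ll a : linear (fun z => \sum_j (c a z) 0 j : F^o).
    move=> t x z; rewrite scaler_sumr -big_split; apply: eq_bigr => j _.
    by rewrite lfD lfZ !mxE.
  (* A cocycle with values in the simple has one linear form per arrow, so its push is a sum of rank
     one cocycles, each killed by [eta]. *)
  have -> : push k c = \sum_a rank1 (l a) (place y).
    apply: coc_ext => b z; rewrite pushE kE.
    have -> : (\sum_a rank1 (l a) (place y)) b z = \sum_a rank1 (l a) (place y) b z.
      apply: (big_morph (fun d : coc Z Y => d b z)) => [d d'|]; first exact: cocDE.
      exact: coc0E.
    rewrite (bigD1 b) //= [X in _ = _ + X]big1 => [|a /eqP ab].
      by rewrite addr0 rank1E place_eq (linfun_linearE (ll b)).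
    by rewrite rank1E place_neq // zero_lfunE scale0r.
  rewrite linear_sum big1 // => a _.
  have /lfunP/(_ (l a)) := i0 a.
  by rewrite (linfun_linearE (innl a)) (linfun_linearE (gl a y)) zero_lfunE.
pose W (i : arrow Q + arrow Q) : vectType F :=
  match i with inl a => Y (tgt a) | inr a => 'Hom('Hom(Z (src a), F^o), F^o) end.
pose f (i : arrow Q + arrow Q) : 'Hom(Y v, W i) :=
  match i with inl a => out a | inr a => inn a end.
have := @joint_inj_dim F (Y v) _ W f; rewrite big_sumType /= => h.
apply: leq_trans (h _) _ => [y y0|].
  by apply: inj => a; [apply: (y0 (inl a))|apply: (y0 (inr a))].
apply: leq_add; apply: leq_sum => a _; last first.
  by apply: leq_trans (dim_limg_le _) _; rewrite !dim_dual.
case: eqP => [_|ne]; first exact: dim_limg_le.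
rewrite leqn0 dimv_eq0; apply/eqP/vspaceP => x; rewrite memv0.
apply/memv_imgP/eqP => [[y _ ->]|->]; last by exists 0; rewrite ?memvf ?lf0.
by rewrite (linfun_linearE (outl a)) place_neq ?lf0 // => e; apply: ne.
Qed.

(** Recursion from the sinks: [faithful_dv] bounds the dimension at a vertex by those at the targets
    of its arrows and a constant depending on [Z]. *)
Lemma faithful_bound : exists b, forall Y (eta : 'Hom(coc Z Y, F^o)), faithful eta -> (tdim Y <= b)%N.
Proof.
have : forall v, exists b, forall Y (eta : 'Hom(coc Z Y, F^o)), faithful eta -> (dv Y v <= b)%N.
  apply: (tgt_induction acQ) => v IH.
  have IH' a : exists b, src a = v -> forall Y (eta : 'Hom(coc Z Y, F^o)), faithful eta ->
      (dv Y (tgt a) <= b)%N.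
    have [e|ne] := pselect (src a = v); last by exists 0%N.
    by have [b bP] := IH a e; exists b.
  have [b bP] := choice IH'; exists (\sum_a b a + \sum_a dv Z (src a))%N => Y eta fe.
  apply: leq_trans (faithful_dv v fe) _; rewrite leq_add2r; apply: leq_sum => a _.
  by case: eqP => // e; apply: bP fe.
by move/choice => [b bP]; exists (\sum_v b v)%N => Y eta fe; apply: leq_sum => v _; apply: bP fe.
Qed.

End Faithful.
End Existence.

Section AlmostSplitExistence.
Variables (F : fieldType) (Q : quiver) (acQ : acyclic Q).
Local Notation rep := (rep F Q).
Implicit Types (A B C D E G K M N X Y Z W : rep).

Lemma dsum A B : exists D (iA : hom A D) (pA : hom D A) (iB : hom B D) (pB : hom D B),
  biprod iA pA iB pB.
Proof.
pose D := ext_rep (0 : coc B A).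
pose s v (b : B v) : (A v * B v)%type := (0, b).
have sl v : linear (@s v) by move=> k x y; rewrite /s; congr pair; rewrite /= scaler0 addr0.
have sP a x : (linfun (@s (tgt a)) : 'Hom(_, D _)) (rmap B a x) = rmap D a (linfun (@s (src a)) x).
  by rewrite ext_rmapE !(linfun_linearE (@sl _)) /s /= coc0E lf0 addr0.
pose p v (d : (A v * B v)%type) : A v := d.1.
have pl v : linear (@p v) by [].
have pP a x : (linfun (@p (tgt a)) : 'Hom(D _, _)) (rmap D a x) =
    rmap A a ((linfun (@p (src a)) : 'Hom(D _, _)) x).
  by rewrite ext_rmapE !(linfun_linearE (@pl _)) /p /= coc0E addr0.
exists D, (ext_in 0), (@mkhom _ _ D A (fun v => linfun (@p v)) pP),
  (@mkhom _ _ B D (fun v => linfun (@s v)) sP), (ext_out 0); split.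
- by apply: hom_ext => v x; rewrite hcompE ext_inE hidE /= (linfun_linearE (@pl _)).
- by apply: hom_ext => v x; rewrite hcompE ext_outE hidE /= (linfun_linearE (@sl _)).
move=> v [a b]; rewrite ext_inE ext_outE /= (linfun_linearE (@pl _)) (linfun_linearE (@sl _)).
by congr pair; rewrite ?addr0 ?add0r.
Qed.

Lemma biprod_comp0 D A B (iA : hom A D) pA (iB : hom B D) pB : biprod iA pA iB pB ->
  (forall v b, pA v (iB v b) = 0) /\ (forall v a, pB v (iA v a) = 0).
Proof.
move=> bp; split=> v x.
  exact: ses_comp0 (biprod_ses (biprod_sym bp)).
exact: ses_comp0 (biprod_ses bp).
Qed.

Section Universal.
Variable Z : rep.

(* A faithful functional of maximal total dimension represents the contravariant
   functor [Y |-> Ext^1(Z, Y)^*]. *)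
Lemma universal_functional : exists T (eta : 'Hom(coc Z T, F^o)),
  [/\ annih eta, faithful eta
    & forall Y (eta' : 'Hom(coc Z Y, F^o)), annih eta' ->
        exists f : hom Y T, forall c, eta' c = eta (push f c)].
Proof.
have [b bP] := @faithful_bound F Q acQ Z.
have [||n [[T [eta [aT fT] nT]] mT]] := @max_nat (fun n => exists T,
  exists2 eta : 'Hom(coc Z T, F^o), annih eta /\ faithful eta & tdim T = n) b.
- exists 0%N, (ssrep F (fun=> 0%N)), 0; last by apply/is_zero_tdim/ssrep0_zero.
  split; first by move=> h; rewrite zero_lfunE.
  move=> K k mk _; exact: mono_zero mk (@ssrep0_zero F Q).
- by move=> n [T [eta [_ fe] <-]]; apply: bP fe.
exists T, eta; split=> // Y eta' aY.
have [D [iT [pT [iY [pY bp]]]]] := dsum T Y; have [eT eY eD] := bp.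
have [pTiY pYiT] := biprod_comp0 bp.
pose etaD0 c : F^o := eta (push pT c) + eta' (push pY c).
have lD : linear etaD0.
  by move=> k c d; rewrite /etaD0 !pushD !pushZ !lfD !lfZ scalerDr addrACA.
pose etaD : 'Hom(coc Z D, F^o) := linfun etaD0.
have etaDE c : etaD c = eta (push pT c) + eta' (push pY c) by rewrite (linfun_linearE lD).
have aD : annih etaD by move=> h; rewrite etaDE !push_cob aT aY addr0.
(* Dividing the direct sum [D] by a maximal subobject killed by [etaD] makes the functional faithful
   on the quotient [G]. [T] still embeds in [G], so by maximality of [T] this is an isomorphism, and
   [Y -> D -> G] followed by its inverse is the morphism sought. *)
have [||m [[K [k [mk k0 nK]]] mK]] := @max_nat (fun n => exists K, exists k : hom K D,
  [/\ mono k, forall c, etaD (push k c) = 0 & tdim K = n]) (tdim D).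
- exists 0%N, (ssrep F (fun=> 0%N)), (hzero _ _); split.
  + apply: mono0 => v x _; exact: (iffLR (is_zeroP _) (@ssrep0_zero F Q)).
  + move=> c; rewrite (_ : push _ c = 0) ?lf0 //.
    by apply: coc_ext => a x; rewrite !cocE hzeroE.
  by apply/is_zero_tdim/ssrep0_zero.
- by move=> i [K [k [mk _ <-]]]; apply: mono_tdim mk.
have [G [q skq]] := mono_coker mk; have [_ eq xq] := skq.
pose etaG0 c : F^o := etaD (push (lret q) c).
have lG : linear etaG0 by move=> t c d; rewrite /etaG0 pushD pushZ lfD lfZ.
pose etaG : 'Hom(coc Z G, F^o) := linfun etaG0.
have etaGE c : etaG (push q c) = etaD c.
  rewrite (linfun_linearE lG) /etaG0; apply/eqP; rewrite -subr_eq0 -lfB.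
  have -> : push (lret q) (push q c) - c = push k (push (lret k) (push (lret q) (push q c) - c)).
    apply: coc_ext => a x; rewrite [RHS]pushE pushE.
    have [y <-] : exists y, k (tgt a) y = (push (lret q) (push q c) - c) a x.
      by apply/xq; rewrite !cocE lfB lretKK subrr.
    by rewrite lretK.
  by rewrite k0.
have aG : annih etaG.
  move=> h; have -> : cob h = push q (cob (fun v => lret q v \o h v)%VF).
    rewrite push_cob; apply: cob_ext => v; apply/lfunP => x.
    by rewrite !comp_lfunE lsecK.
  by rewrite etaGE aD.
(* The preimage in [D] of a killed subobject of [G] is killed by [etaD], hence no larger than
   [K]. *)
have fG : faithful etaG.
  move=> J j mj j0; have [C [r sjr]] := mono_coker mj; have [_ er xr] := sjr.
  have erq : epi (hcomp r q) by apply: epi_comp.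
  have [K' [k' sk']] := epi_ker erq; have [mk' _ xk'] := sk'.
  apply/is_zero_tdim.
  have : (tdim K' <= m)%N.
    apply: mK; exists K', k'; split=> // c; rewrite -etaGE -push_comp.
    have [|g ge] := factor_mono (g := hcomp q k') mj.
      by move=> v x; apply/xr; rewrite hcompE -(hcompE r); apply/xk'; exists x.
    by rewrite -ge push_comp j0.
  have := ses_tdim skq; have := ses_tdim sjr; have := ses_tdim sk'; lia.
have mTG : mono (hcomp q iT).
  have [K2 [k2 [mk2 x2]]] := kernel (hcomp q iT).
  have z : is_zero K2.
    apply: (fT _ k2 mk2) => c.
    have -> : eta (push k2 c) = etaD (push iT (push k2 c)).
      rewrite etaDE -!push_comp ?hcompA eT hcomp_idl.
      rewrite (_ : push (hcomp (hcomp pY iT) k2) c = 0) ?lf0 ?addr0 //.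
      by apply: coc_ext => a x; rewrite !cocE !hcompE pYiT.
    rewrite -etaGE -!push_comp (_ : push _ c = 0) ?lf0 //.
    apply: coc_ext => a x; rewrite !cocE !hcompE -[LHS](hcompE q iT).
    by apply/x2; exists (c a x).
  by apply: mono0 => v x /x2 [y <-]; rewrite (iffLR (is_zeroP _) z v y) lf0.
have iTG : is_iso (hcomp q iT).
  by apply: mono_tdim_iso => //; rewrite nT; apply: mT; exists G, etaG.
have [g [g1 g2]] := iso_inverse iTG.
exists (hcomp g (hcomp q iY)) => c.
have e1 d : eta d = etaG (push (hcomp q iT) d).
  rewrite push_comp etaGE etaDE -!push_comp eT push_id (_ : push (hcomp pY iT) d = 0) ?lf0 ?addr0 //.
  by apply: coc_ext => a x; rewrite !cocE hcompE pYiT.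
rewrite e1 -push_comp (hcompA (hcomp q iT)) g2 hcomp_idl push_comp etaGE etaDE -!push_comp eY.
rewrite push_id (_ : push (hcomp pT iY) c = 0) ?lf0 ?add0r //.
by apply: coc_ext => a x; rewrite !cocE hcompE pTiY.
Qed.

End Universal.

(** Any indecomposable summand [A] of the representing object [T] serves as [tau Z]: a class on [A]
    that pairs to 1 with the inclusion and to 0 with every morphism [A -> T] that is not split mono
    is almost split. *)
Lemma ar_translate_exists Z : indecomposable Z -> (exists Y, ~ Ext1_zero Z Y) ->
  exists X, ar_translate Z X.
Proof.
move=> iZ [Y /Ext1_nonzero [c0 nc0]].
have [T [eta [aT fT uT]]] := universal_functional Z.
have kills W (c : coc Z W) (f : hom W T) : cobound c -> eta (push f c) = 0.
  by move=> /(cobound_push f) [h ->]; apply: aT.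
have detect W (c : coc Z W) : ~ cobound c -> exists f : hom W T, eta (push f c) = 1.
  move=> /cobound_functional [phi [p1 p0]].
  have [|f fE] := uT W phi; last by exists f; rewrite -fE.
  by move=> h; apply: p0; exists h.
have [f0 f0E] := detect _ _ nc0.
have nT : ~ is_zero T.
  move=> /is_zeroP z; have : push f0 c0 = 0 by apply: coc_ext => a x; rewrite [LHS]z [RHS]z.
  by move=> e; move/eqP: f0E; rewrite e lf0 eq_sym oner_eq0.
have [A [iA [i /split_monoP [r ri]]]] := indec_summand nT.
pose U := subvs_of (homsp A T).
pose beta (u : U) (c : coc Z A) : F := eta (push (vsval u) c).
have bl c : linear (beta^~ c : U -> F^o).
  by move=> k u w; rewrite /beta linearP push_famv lfD lfZ.
have br u : linear (beta u : coc Z A -> F^o).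
  by move=> k c1 c2; rewrite /beta pushD pushZ lfD lfZ.
have hom_of (f : hom A T) : exists u : U, vsval u = fam_of f.
  by exists (vsproj _ (fam_of f)); rewrite vsprojK //; apply/homspP; exists f.
have nd u : (forall c, beta u c = 0) -> u = 0.
  move=> h; apply/val_inj => /=; have /homspP [f fE] := subvsP u.
  rewrite fE; apply/fam_of_eq0; have [I [e [m [ee mm fI]]]] := image f.
  have : is_zero I.
    apply: (fT _ m mm) => c.
    have -> : c = push e (push (lret e) c) by apply: coc_ext => a x; rewrite !pushE lsecK.
    by rewrite -push_comp fI -push_fam_of -fE; apply: h.
  by move/is_zeroP => z; apply: hom_ext => v x; rewrite -fI hcompE (z v (e v x)) lf0 hzeroE.
(* The morphisms [A -> T] that are not split mono form a subspace because the endomorphism ring of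
   [A] is local. *)
have [R RP] : exists R : {vspace U}, forall u, u \in R <->
    (forall f : hom A T, vsval u = fam_of f -> ~ split_mono f).
  apply: vspace_of_closed.
    move=> f /= /esym/fam_of_eq0 -> /split_mono_mono/mono_eq0 m0.
    have [nA _] := iA; have /nonzeroP [v [x x0]] := nA; apply: x0.
    by apply: m0; rewrite hzeroE.
  move=> k x y hx hy f fE /split_monoP [s se].
  have /homspP [fx fxE] := subvsP x; have /homspP [fy fyE] := subvsP y.
  have e v z : f v z = k *: fx v z + fy v z.
    by rewrite -fam_ofE -fE -[vsval _]/(k *: vsval x + vsval y) dprodDE dprodZE fxE fyE add_lfunE scale_lfunE !fam_ofE.
  have [] := @local_end _ _ A (hlin k (hcomp s fx) (hzero _ _)) (hcomp s fy) iA.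
  - move=> v z; rewrite hlinE hzeroE addr0 !hcompE -lfZ -lfD -e.
    by rewrite -(hcompE s) se hidE.
  - have -> : hlin k (hcomp s fx) (hzero A A) = hcomp (hlin k s (hzero _ _)) fx.
      by apply: hom_ext => v z; rewrite hlinE !hcompE hlinE !hzeroE.
    move=> /iso_inverse [t [te _]]; apply: hx fxE _.
    by apply/split_monoP; exists (hcomp t (hlin k s (hzero _ _))); rewrite -hcompA.
  move=> /iso_inverse [t [te _]]; apply: hy fyE _.
  by apply/split_monoP; exists (hcomp t s); rewrite -hcompA.
have [u0 u0E] := hom_of i.
have u0R : u0 \notin R.
  by apply/negP => /RP/(_ i u0E); apply; apply/split_monoP; exists r.
have [c [c1 cR]] := pairing_separate bl br nd u0R.
have cE f : ~ split_mono f -> eta (push f c) = 0.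
  move=> nf; have [u uE] := hom_of f; rewrite -push_fam_of -uE; apply: cR.
  apply/RP => g; rewrite uE => e; have -> // : g = f.
  by apply: hom_ext => v x; rewrite -(fam_ofE g) -(fam_ofE f) e.
have nc : ~ cobound c.
  move=> /(kills _ _ i) e; move/eqP: c1.
  by rewrite /beta u0E push_fam_of e eq_sym oner_eq0.
(* If [push g c] were nonzero, some [f : W -> T] would detect it; but [f] after [g] is not split
   mono, so it pairs to 0 with [c]. *)
exists A; apply/ar_translateP; exists c; apply: left_almost_split_coc => // W g ng.
apply: contrapT => /detect [f]; rewrite -push_comp cE => [/eqP|]; first by rewrite eq_sym oner_eq0.
by move/split_monoP => [s se]; apply: ng; apply/split_monoP; exists (hcomp s f); rewrite -hcompA.
Qed.

End AlmostSplitExistence.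

(** * Existence of inverse translates *)

Section AlmostSplitExistenceDual.
Variables (F : fieldType) (Q : quiver) (acQ : acyclic Q).
Local Notation rep := (rep F Q).
Implicit Types (A B C D E G K M N X Y Z W : rep).

Section Cofaithful.
Variable A : rep.

Definition cofaithful X (eta : 'Hom(coc X A, F^o)) := forall C (q : hom X C),
  epi q -> (forall c, eta (pull c q) = 0) -> is_zero C.

Let form X w := 'Hom(X w, F^o).

Definition corank1 X (l : forall w, form X w) a (y : A (tgt a)) : coc X A :=
  [ffun b => linfun (fun x => l (src b) x *: place (V := fun b => A (tgt b)) y b)].

Lemma corank1E X (l : forall w, form X w) a (y : A (tgt a)) b x :
  corank1 l y b x = l (src b) x *: place (V := fun b => A (tgt b)) y b.
Proof.
rewrite ffunE linfun_linearE // => k z u.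
by rewrite lfD lfZ scalerDl scalerA.
Qed.

(** Dual to [faithful_dv]: a form on [X v] that vanishes on the images of the arrows into [v] is a
    morphism to the simple at [v], so the bound is obtained for the dual of [X v], in terms of the
    sources. *)
Lemma cofaithful_dv X (eta : 'Hom(coc X A, F^o)) v : cofaithful eta ->
  (dv X v <= \sum_a (if tgt a == v then dv X (src a) else 0) + \sum_a dv A (tgt a))%N.
Proof.
move=> fe; pose at_ (l : form X v) w : form X w := place (V := form X) l w.
pose out0 a (l : form X v) : form X (src a) := (at_ l (tgt a) \o rmap X a)%VF.
have out0l a : linear (out0 a).
  move=> k l m; rewrite /out0 /at_ place_linear; apply/lfunP => x.
  by rewrite !(comp_lfunE, add_lfunE, scale_lfunE).
pose out a : 'Hom(form X v, form X (src a)) := linfun (out0 a).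
pose g a (l : form X v) (y : A (tgt a)) : F^o := eta (corank1 (at_ l) y).
have gl a l : linear (@g a l).
  move=> k y z; rewrite /g -lfZ -lfD; congr (eta _); apply: coc_ext => b x.
  by rewrite !cocE !corank1E place_linear scalerDr !scalerA mulrC.
pose inn a : 'Hom(form X v, 'Hom(A (tgt a), F^o)) := linfun (fun l => linfun (@g a l)).
have innl a : linear (fun l => linfun (@g a l)).
  move=> k l m; apply/lfunP => y; rewrite add_lfunE scale_lfunE !(linfun_linearE (gl a _)).
  rewrite /g -lfZ -lfD; congr (eta _); apply: coc_ext => b x.
  by rewrite !cocE !corank1E /at_ place_linear add_lfunE scale_lfunE scalerDl scalerA.
have inj l : (forall a, out a l = 0) -> (forall a, inn a l = 0) -> l = 0.
  move=> o0 i0; apply/lfunP => x; rewrite zero_lfunE; apply: contrapT => lx.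
  have [|q qE] := @hom_to_simple _ _ X v l.
    move=> a y; have /lfunP/(_ y) := o0 a.
    by rewrite (linfun_linearE (out0l a)) comp_lfunE zero_lfunE.
  apply: (@simple_nonzero F Q v); apply: (fe _ q).
    move=> w r; have [e|ne] := pselect (w = v); last first.
      by exists 0; apply/rowP => -[j jP]; exfalso; move: jP; rewrite (introF eqP ne).
    subst w; have vv : (0 < (v == v))%N by rewrite eqxx.
    exists ((r 0 (Ordinal vv) / l x) *: x); rewrite qE place_eq.
    apply/rowP => j; rewrite mxE lfZ /GRing.scale /= divfK; last exact/eqP.
    congr (r _ _); apply: val_inj => /=; case: j => j /=; by rewrite eqxx; lia.
  move=> c; pose y a : A (tgt a) := c a (const_mx 1).
  have -> : pull c q = \sum_a corank1 (at_ l) (y a).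
    apply: coc_ext => b z; rewrite pullE qE.
    have -> : (\sum_a corank1 (at_ l) (y a)) b z = \sum_a corank1 (at_ l) (y a) b z.
      apply: (big_morph (fun d : coc X A => d b z)) => [d d'|]; first exact: cocDE.
      exact: coc0E.
    rewrite (bigD1 b) //= [X in _ = _ + X]big1 => [|a /eqP ab].
      rewrite addr0 corank1E place_eq -lfZ; congr (c b _).
      by apply/rowP => j; rewrite !mxE mulr1.
    by rewrite corank1E place_neq // scaler0.
  rewrite linear_sum big1 // => a _.
  have /lfunP/(_ (y a)) := i0 a.
  by rewrite (linfun_linearE (innl a)) (linfun_linearE (gl a l)) zero_lfunE.
pose W (i : arrow Q + arrow Q) : vectType F :=
  match i with inl a => form X (src a) | inr a => 'Hom(A (tgt a), F^o) end.
pose f (i : arrow Q + arrow Q) : 'Hom(form X v, W i) :=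
  match i with inl a => out a | inr a => inn a end.
have := @joint_inj_dim F (form X v) _ W f; rewrite big_sumType dim_dual /= => h.
apply: leq_trans (h _) _ => [y y0|].
  by apply: inj => a; [apply: (y0 (inl a))|apply: (y0 (inr a))].
apply: leq_add; apply: leq_sum => a _; last first.
  by apply: leq_trans (dim_limg_le _) _; rewrite !dim_dual.
case: eqP => [_|ne]; first by apply: leq_trans (dim_limg_le _) _; rewrite dim_dual.
rewrite leqn0 dimv_eq0; apply/eqP/vspaceP => x; rewrite memv0.
apply/memv_imgP/eqP => [[y _ ->]|->]; last by exists 0; rewrite ?memvf ?lf0.
rewrite (linfun_linearE (out0l a)) /out0 /at_ place_neq ?comp_lfun0l // => e; exact: ne.
Qed.

Lemma cofaithful_bound : exists b, forall X (eta : 'Hom(coc X A, F^o)),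
  cofaithful eta -> (tdim X <= b)%N.
Proof.
have : forall v, exists b, forall X (eta : 'Hom(coc X A, F^o)), cofaithful eta -> (dv X v <= b)%N.
  apply: (src_induction acQ) => v IH.
  have IH' a : exists b, tgt a = v -> forall X (eta : 'Hom(coc X A, F^o)), cofaithful eta ->
      (dv X (src a) <= b)%N.
    have [e|ne] := pselect (tgt a = v); last by exists 0%N.
    by have [b bP] := IH a e; exists b.
  have [b bP] := choice IH'; exists (\sum_a b a + \sum_a dv A (tgt a))%N => X eta fe.
  apply: leq_trans (cofaithful_dv v fe) _; rewrite leq_add2r; apply: leq_sum => a _.
  by case: eqP => // e; apply: bP fe.
by move/choice => [b bP]; exists (\sum_v b v)%N => Y eta fe; apply: leq_sum => v _; apply: bP fe.
Qed.

Lemma universal_cofunctional : exists T (eta : 'Hom(coc T A, F^o)),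
  [/\ annih eta, cofaithful eta
    & forall Y (eta' : 'Hom(coc Y A, F^o)), annih eta' ->
        exists f : hom T Y, forall c, eta' c = eta (pull c f)].
Proof.
have [b bP] := cofaithful_bound.
have [||n [[T [eta [aT fT] nT]] mT]] := @max_nat (fun n => exists T,
  exists2 eta : 'Hom(coc T A, F^o), annih eta /\ cofaithful eta & tdim T = n) b.
- exists 0%N, (ssrep F (fun=> 0%N)), 0; last by apply/is_zero_tdim/ssrep0_zero.
  split; first by move=> h; rewrite zero_lfunE.
  move=> K k mk _; exact: epi_zero mk (@ssrep0_zero F Q).
- by move=> n [T [eta [_ fe] <-]]; apply: bP fe.
exists T, eta; split=> // Y eta' aY.
have [D [iT [pT [iY [pY bp]]]]] := dsum T Y; have [eT eY eD] := bp.
have [pTiY pYiT] := biprod_comp0 bp.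
pose etaD0 c : F^o := eta (pull c iT) + eta' (pull c iY).
have lD : linear etaD0.
  by move=> k c d; rewrite /etaD0 !pullD !pullZ !lfD !lfZ scalerDr addrACA.
pose etaD : 'Hom(coc D A, F^o) := linfun etaD0.
have etaDE c : etaD c = eta (pull c iT) + eta' (pull c iY) by rewrite (linfun_linearE lD).
have aD : annih etaD by move=> h; rewrite etaDE !pull_cob aT aY addr0.
have [||m [[K [k [mk k0 nK]]] mK]] := @max_nat (fun n => exists K, exists k : hom D K,
  [/\ epi k, forall c, etaD (pull c k) = 0 & tdim K = n]) (tdim D).
- exists 0%N, (ssrep F (fun=> 0%N)), (hzero _ _); split.
  + move=> v y; exists 0; rewrite lf0; symmetry.
    exact: (iffLR (is_zeroP _) (@ssrep0_zero F Q)).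
  + move=> c; rewrite (_ : pull c _ = 0) ?lf0 //.
    by apply: coc_ext => a x; rewrite !cocE hzeroE lf0.
  by apply/is_zero_tdim/ssrep0_zero.
- by move=> i [K [k [mk _ <-]]]; apply: epi_tdim mk.
have [G [q skq]] := epi_ker mk; have [mq _ xq] := skq.
pose etaG0 c : F^o := etaD (pull c (lret q)).
have lG : linear etaG0 by move=> t c d; rewrite /etaG0 pullD pullZ lfD lfZ.
pose etaG : 'Hom(coc G A, F^o) := linfun etaG0.
have etaGE c : etaG (pull c q) = etaD c.
  rewrite (linfun_linearE lG) /etaG0; apply/eqP; rewrite -subr_eq0 -lfB.
  set d := (_ - c); have -> : d = pull (pull d (lret k)) k.
    apply: coc_ext => a x; rewrite !pullE; apply/eqP; rewrite -subr_eq0 -lfB; apply/eqP.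
    have [y <-] : exists y, q (src a) y = x - lret k (src a) (k (src a) x).
      by apply/xq; rewrite lfB lretKK subrr.
    by rewrite /d !cocE lretK // subrr.
  by rewrite k0.
have aG : annih etaG.
  move=> h; have -> : cob h = pull (cob (fun v => h v \o lret q v)%VF) q.
    rewrite pull_cob; apply: cob_ext => v; apply/lfunP => x.
    by rewrite !comp_lfunE lretK.
  by rewrite etaGE aD.
have fG : cofaithful etaG.
  move=> J j ej j0; have [C [r srj]] := epi_ker ej; have [mr _ xr] := srj.
  have mqr : mono (hcomp q r) by apply: mono_comp.
  have [K' [k' sk']] := mono_coker mqr; have [_ ek' xk'] := sk'.
  apply/is_zero_tdim.
  have : (tdim K' <= m)%N.
    apply: mK; exists K', k'; split=> // c; rewrite -etaGE -pull_comp.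
    have [|g ge] := factor_epi (g := hcomp k' q) ej.
      by move=> v x /xr [y <-]; rewrite hcompE -(hcompE q); apply/xk'; exists y.
    by rewrite -ge pull_comp j0.
  have := ses_tdim skq; have := ses_tdim srj; have := ses_tdim sk'; lia.
have eGT : epi (hcomp pT q).
  have [K2 [k2 [ek2 x2]]] := cokernel (hcomp pT q).
  have z : is_zero K2.
    apply: (fT _ k2 ek2) => c.
    have -> : eta (pull c k2) = etaD (pull (pull c k2) pT).
      rewrite etaDE -!pull_comp -?hcompA eT hcomp_idr.
      rewrite (_ : pull c (hcomp k2 (hcomp pT iY)) = 0) ?lf0 ?addr0 //.
      by apply: coc_ext => a x; rewrite !cocE !hcompE pTiY !lf0.
    rewrite -etaGE -!pull_comp (_ : pull c _ = 0) ?lf0 //.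
    apply: coc_ext => a x; rewrite !cocE -?hcompA hcompE.
    by rewrite (_ : k2 _ _ = 0) ?lf0 //; apply/x2; exists x.
  by move=> v y; apply/x2; apply: (iffLR (is_zeroP _) z).
have iGT : is_iso (hcomp pT q).
  by apply: epi_tdim_iso => //; rewrite nT; apply: mT; exists G, etaG.
have [g [g1 g2]] := iso_inverse iGT.
exists (hcomp (hcomp pY q) g) => c.
have e1 d : eta d = etaG (pull d (hcomp pT q)).
  rewrite pull_comp etaGE etaDE -!pull_comp eT pull_id (_ : pull d (hcomp pT iY) = 0) ?lf0 ?addr0 //.
  by apply: coc_ext => a x; rewrite !cocE hcompE pTiY lf0.
rewrite e1 -pull_comp -(hcompA (hcomp pY q)) g1 hcomp_idr pull_comp etaGE etaDE -!pull_comp eY.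
rewrite pull_id (_ : pull c (hcomp pY iT) = 0) ?lf0 ?add0r //.
by apply: coc_ext => a x; rewrite !cocE hcompE pYiT lf0.
Qed.

End Cofaithful.

Lemma ar_translate_inv_exists A : indecomposable A -> (exists Y, ~ Ext1_zero Y A) ->
  exists Z, ar_translate Z A.
Proof.
move=> iA [Y /Ext1_nonzero [c0 nc0]].
have [T [eta [aT fT uT]]] := universal_cofunctional A.
have kills W (c : coc W A) (f : hom T W) : cobound c -> eta (pull c f) = 0.
  by move=> /(cobound_pull f) [h ->]; apply: aT.
have detect W (c : coc W A) : ~ cobound c -> exists f : hom T W, eta (pull c f) = 1.
  move=> /cobound_functional [phi [p1 p0]].
  have [|f fE] := uT W phi; last by exists f; rewrite -fE.
  by move=> h; apply: p0; exists h.
have [f0 f0E] := detect _ _ nc0.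
have nT : ~ is_zero T.
  move=> /is_zeroP z; have : pull c0 f0 = 0.
    by apply: coc_ext => a x; rewrite pullE (z _ x) !lf0.
  by move=> e; move/eqP: f0E; rewrite e lf0 eq_sym oner_eq0.
have [Z [iZ [i /split_monoP [r ri]]]] := indec_summand nT.
pose U := subvs_of (homsp T Z).
pose beta (u : U) (c : coc Z A) : F := eta (pull c (vsval u)).
have bl c : linear (beta^~ c : U -> F^o).
  by move=> k u w; rewrite /beta linearP pull_famv lfD lfZ.
have br u : linear (beta u : coc Z A -> F^o).
  by move=> k c1 c2; rewrite /beta pullD pullZ lfD lfZ.
have hom_of (f : hom T Z) : exists u : U, vsval u = fam_of f.
  by exists (vsproj _ (fam_of f)); rewrite vsprojK //; apply/homspP; exists f.
have nd u : (forall c, beta u c = 0) -> u = 0.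
  move=> h; apply/val_inj => /=; have /homspP [f fE] := subvsP u.
  rewrite fE; apply/fam_of_eq0; have [I [e [m [ee mm fI]]]] := image f.
  have : is_zero I.
    apply: (fT _ e ee) => c.
    have -> : c = pull (pull c (lret m)) m by apply: coc_ext => a x; rewrite !pullE lretK.
    by rewrite -pull_comp fI -pull_fam_of -fE; apply: h.
  by move/is_zeroP => z; apply: hom_ext => v x; rewrite -fI hcompE (z v (e v x)) lf0 hzeroE.
have [R RP] : exists R : {vspace U}, forall u, u \in R <->
    (forall f : hom T Z, vsval u = fam_of f -> ~ split_epi f).
  apply: vspace_of_closed.
    move=> f /= /esym/fam_of_eq0 -> /split_epi_epi e0.
    have [nZ _] := iZ; have /nonzeroP [v [x x0]] := nZ; apply: x0.
    by have [y <-] := e0 v x; rewrite hzeroE.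
  move=> k x y hx hy f fE /split_epiP [s se].
  have /homspP [fx fxE] := subvsP x; have /homspP [fy fyE] := subvsP y.
  have e v z : f v z = k *: fx v z + fy v z.
    by rewrite -fam_ofE -fE -[vsval _]/(k *: vsval x + vsval y) dprodDE dprodZE fxE fyE
      add_lfunE scale_lfunE !fam_ofE.
  have [] := @local_end _ _ Z (hlin k (hcomp fx s) (hzero _ _)) (hcomp fy s) iZ.
  - by move=> v z; rewrite hlinE hzeroE addr0 !hcompE -e -(hcompE f) se hidE.
  - have -> : hlin k (hcomp fx s) (hzero Z Z) = hcomp fx (hlin k s (hzero _ _)).
      by apply: hom_ext => v z; rewrite hlinE !hcompE hlinE !hzeroE !addr0 lfZ.
    move=> /iso_inverse [t [_ te]]; apply: hx fxE _.
    by apply/split_epiP; exists (hcomp (hlin k s (hzero _ _)) t); rewrite hcompA.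
  move=> /iso_inverse [t [_ te]]; apply: hy fyE _.
  by apply/split_epiP; exists (hcomp s t); rewrite hcompA.
have [u0 u0E] := hom_of r.
have u0R : u0 \notin R.
  by apply/negP => /RP/(_ r u0E); apply; apply/split_epiP; exists i.
have [c [c1 cR]] := pairing_separate bl br nd u0R.
have cE f : ~ split_epi f -> eta (pull c f) = 0.
  move=> nf; have [u uE] := hom_of f; rewrite -pull_fam_of -uE; apply: cR.
  apply/RP => g; rewrite uE => e; have -> // : g = f.
  by apply: hom_ext => v x; rewrite -(fam_ofE g) -(fam_ofE f) e.
have nc : ~ cobound c.
  move=> /(kills _ _ r) e; move/eqP: c1.
  by rewrite /beta u0E pull_fam_of e eq_sym oner_eq0.
exists Z; apply/ar_translateP; exists c; apply: right_almost_split_coc => // W g ng.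
apply: contrapT => /detect [f]; rewrite -pull_comp cE => [/eqP|]; first by rewrite eq_sym oner_eq0.
by move/split_epiP => [s se]; apply: ng; apply/split_epiP; exists (hcomp f s); rewrite hcompA.
Qed.

End AlmostSplitExistenceDual.

(** * Quadratic forms of affine quivers *)

Section TitsForm.
Variable Q : quiver.
Local Notation vec := {ffun vertex Q -> int}.
Implicit Types x y z w : vec.

Lemma eulerDl x y w : euler (x + y) w = euler x w + euler y w.
Proof.
rewrite /euler addrACA -opprD -!big_split; congr (_ - _); apply: eq_bigr => i _;
  by rewrite ffunE mulrDl.
Qed.
Lemma eulerDr x y w : euler w (x + y) = euler w x + euler w y.
Proof.
rewrite /euler addrACA -opprD -!big_split; congr (_ - _); apply: eq_bigr => i _;
  by rewrite ffunE mulrDr.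
Qed.

(* [B] is the Euler form or its transpose. *)
Section RadicalVector.
Variables (delta : vec) (v0 : vertex Q) (B : vec -> vec -> int).
Hypotheses (BDl : forall x y w, B (x + y) w = B x w + B y w)
           (BDr : forall x y w, B w (x + y) = B w x + B w y)
           (Bq : forall x, B x x = euler x x)
           (Bdelta : forall x, B x delta = - B delta x)
           (q_ge0 : forall x, 0 <= euler x x)
           (q_eq0 : forall x, euler x x = 0 -> x = delta *~ (x v0))
           (q_bound : forall c v, exists b : nat, forall x, euler x x = c ->
              `|x v - (delta *~ x v0) v| <= b%:Z).

Let B0l w : B 0 w = 0. Proof. by have /eqP := BDl 0 0 w; rewrite addr0 -subr_eq subrr => /eqP. Qed.
Let B0r w : B w 0 = 0. Proof. by have /eqP := BDr 0 0 w; rewrite addr0 -subr_eq subrr => /eqP. Qed.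
Let BNl x w : B (- x) w = - B x w.
Proof. by apply/eqP; rewrite -addr_eq0 -BDl addNr B0l. Qed.
Let BNr x w : B w (- x) = - B w x.
Proof. by apply/eqP; rewrite -addr_eq0 -BDr addNr B0r. Qed.
Let BMl x n w : B (x *+ n) w = B x w *+ n.
Proof. by elim: n => [|n IH]; rewrite ?mulr0n ?B0l // !mulrS BDl IH. Qed.
Let BMr x n w : B w (x *+ n) = B w x *+ n.
Proof. by elim: n => [|n IH]; rewrite ?mulr0n ?B0r // !mulrS BDr IH. Qed.
Let BZl x (t : int) w : B (x *~ t) w = t * B x w.
Proof. by case: t => n; rewrite ?NegzE ?mulNrz -?pmulrn ?BNl BMl; rewrite -mulr_natl ?mulNr natz. Qed.
Let BZr x (t : int) w : B w (x *~ t) = t * B w x.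
Proof. by case: t => n; rewrite ?NegzE ?mulNrz -?pmulrn ?BNr BMr; rewrite -mulr_natl ?mulNr natz. Qed.

Variable z : nat -> vec.
Hypotheses (z_ge0 : forall m v, 0 <= z m v)
           (zS : forall m w, B (z m) w = - B w (z m.+1)).

Let d0 : B delta delta = 0.
Proof. by have := Bdelta delta; lia. Qed.

Let zd m : B delta (z m) = B delta (z 0).
Proof. by elim: m => // m <-; have := zS m delta; rewrite Bdelta; lia. Qed.

Let zq m : euler (z m) (z m) = euler (z 0) (z 0).
Proof. by elim: m => // m <-; rewrite -!Bq; have := zS m (z m); have := zS m (z m.+1); lia. Qed.

Let sum_shift m n w :
  B (\sum_(m <= i < m + n) z i) w = - B w (\sum_(m <= i < m + n) z i + (z (m + n) - z m)).
Proof.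
elim: n => [|n IH]; first by rewrite addn0 big_geq // subrr addr0 B0l B0r oppr0.
rewrite addnS big_nat_recr ?leq_addr //= BDl IH zS -opprD -BDr; congr (- B w _).
by rewrite -!addrA; do 2!congr (_ + _); rewrite addrC.
Qed.

(** The quadratic form is constant on the orbit, so [q_bound] leaves finitely many classes modulo
    [delta], and one of them recurs infinitely often. *)
Lemma pigeonhole_delta : exists m1 m2 (t : int),
  [/\ (m1 < m2)%N, 0 <= t & z m2 = z m1 + delta *~ t].
Proof.
have [b bP] := choice (q_bound (euler (z 0) (z 0))).
pose N := (\sum_v b v)%N.
have bN m v : `|z m v - (delta *~ z m v0) v| <= N%:Z.
  apply: le_trans (bP v _ (zq m)) _; rewrite lez_nat /N (bigD1 v) //=; exact: leq_addr.
(* The class modulo [delta] is represented by the vector with value 0 at [v0]; its entries lie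
   between [-N] and [N] and are shifted by [N]. *)
pose cls m : {ffun vertex Q -> 'I_(N + N).+1} :=
  [ffun v => inord (absz (z m v - (delta *~ z m v0) v + N%:Z))].
have [k kP] : exists k, forall m, exists2 m', (m <= m')%N & cls m' = k.
  apply: contrapT => /forallNP no.
  have /choice [g gP] : forall k, exists m, forall m', (m <= m')%N -> cls m' <> k.
    move=> k; have /existsNP [m mP] := no k; exists m => m' mm e; apply: mP; by exists m'.
  by apply: (gP (cls (\max_k g k)) (\max_k g k)) => //; apply: leq_bigmax.
(* Taking [m1] with the least value at [v0] in the recurring class makes the multiple [t] of [delta]
   nonnegative. *)
have [|n [[m1 [m1k m1n]] nP]] := @min_nat (fun n => exists m, cls m = k /\ absz (z m v0) = n).
  by have [m _ mk] := kP 0%N; exists (absz (z m v0)), m.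
have [m2 lt m2k] := kP m1.+1; exists m1, m2, (z m2 v0 - z m1 v0); split=> //.
  have : (n <= absz (z m2 v0))%N by apply: nP; exists m2.
  by rewrite -m1n; have := z_ge0 m1 v0; have := z_ge0 m2 v0; lia.
apply/ffunP => v; rewrite !ffunE ffunMzE mulrzz.
have lt_ m : (absz (z m v - (delta *~ z m v0) v + N%:Z)%R < (N + N).+1)%N.
  by have := bN m v; lia.
have : cls m1 v = cls m2 v by rewrite m1k m2k.
rewrite !ffunE => /(congr1 val) /=; rewrite !inordK //.
have := bN m1 v; have := bN m2 v; rewrite !ffunMzE !mulrzz mulrBr.
by move: (delta v * z m2 v0) (delta v * z m1 v0) => p q; lia.
Qed.

(** [y] is the sum of the orbit from [m1] to just before [m2]: shifting it by one step changes it by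
    [t] times [delta] only, so it is almost skew for [B]. *)
Let pigeonhole_sum : exists m1 m2 (t : int) y,
  [/\ (m1 < m2)%N, 0 <= t, z m2 = z m1 + delta *~ t,
      forall w, B y w = - B w y + t * B delta w
    & B delta y = (m2 - m1)%:Z * B delta (z 0)].
Proof.
have [m1 [m2 [t [lt t0 e]]]] := pigeonhole_delta.
exists m1, m2, t, (\sum_(m1 <= i < m1 + (m2 - m1)) z i); split=> //.
  move=> w; rewrite sum_shift (_ : m1 + (m2 - m1) = m2)%N ?subnKC 1?ltnW //.
  rewrite e addrAC subrr add0r BDr BZr Bdelta; lia.
elim: (m2 - m1)%N => [|n IH]; first by rewrite addn0 big_geq // B0r mul0r.
by rewrite addnS big_nat_recr ?leq_addr //= BDr IH zd; lia.
Qed.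

(** With [w = y] the sum satisfies [2 q(y) = t B(delta, y)]. A negative defect makes the right side
    nonpositive, so [t = 0] and [q(y) = 0]; then [y] is a multiple of [delta] and has defect 0, a
    contradiction. *)
Lemma no_negative_defect : 0 <= B delta (z 0).
Proof.
rewrite leNgt; apply/negP => neg.
have [m1 [m2 [t [y [lt t0 e yB yd]]]]] := pigeonhole_sum.
have := yB y; have := q_ge0 y; rewrite -Bq yd => q0 qe.
have t_eq0 : t = 0 by nia.
have /q_eq0 yE : euler y y = 0 by rewrite -Bq; move: qe; rewrite t_eq0; lia.
by move: yd; rewrite yE BZr d0; nia.
Qed.

(** Now [q(y) = 0], so [y] is a multiple of [delta] and exactly skew for [B]; testing on a vector
    [w] of nonzero defect forces [t = 0]. *)
Lemma zero_defect_periodic w : B delta w != 0 -> B delta (z 0) = 0 ->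
  exists m1 m2, (m1 < m2)%N /\ z m1 = z m2.
Proof.
move=> /eqP nz z0; have [m1 [m2 [t [y [lt t0 e yB yd]]]]] := pigeonhole_sum.
have /q_eq0 yE : euler y y = 0 by rewrite -Bq; have := yB y; rewrite yd z0; lia.
have : t = 0 by have := yB w; rewrite yE BZl BZr Bdelta; nia.
by move=> t_eq0; exists m1, m2; rewrite e t_eq0 mulr0z addr0.
Qed.

End RadicalVector.
End TitsForm.

(** * Radical vectors of the extended Dynkin diagrams *)

Section DynkinRadical.

(** The sum of [d] over the neighbours of [i], with multiplicity; [d] is radical when it equals
    [2 * d i] everywhere. *)
Definition nodal (E : seq (nat * nat)) (d : nat -> nat) i :=
  (\sum_(e <- E) ((e.1 == i) * d e.2 + (e.2 == i) * d e.1))%N.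

Lemma nodal_cat E E' d i : nodal (E ++ E') d i = (nodal E d i + nodal E' d i)%N.
Proof. exact: big_cat. Qed.

Lemma nodal_path m l d i : nodal [seq (k, k.+1) | k <- iota m l] d i =
  ((if (m <= i < m + l)%N then d i.+1 else 0) +
   (if (m < i <= m + l)%N then d i.-1 else 0))%N.
Proof.
elim: l m => [|l IH] m; rewrite /nodal /=.
  by rewrite big_nil; do ![case: ifP => ?]; lia.
rewrite big_cons -/(nodal _ _ _) IH /=.
have [->|ne] := eqVneq m i.
  rewrite eqn_leq ltnn !leqnn /= mul0n mul1n addn0.
  by do ![case: ifP => ?]; lia.
rewrite mul0n add0n; have [<-|ne'] := eqVneq m.+1 i.
  by rewrite /= mul1n; do ![case: ifP => ?]; lia.
by do ![case: ifP => ?]; lia.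
Qed.

(** [d] lists the marks of the affine diagram and [i0] is an extending vertex. The last clause is
    connectedness, stated for functions that are constant along edges. *)
Lemma dynkin_radical (D : extended_dynkin) : extended_dynkin_wf D ->
  exists (d : nat -> nat) (i0 : 'I_(dynkin_rank D).+1),
  [/\ forall i, (i <= dynkin_rank D)%N -> (0 < d i)%N, d i0 = 1%N,
      forall i, (i <= dynkin_rank D)%N -> nodal (dynkin_edges D) d i = (2 * d i)%N
    & forall (T : Type) (phi : nat -> T),
        (forall e, e \in dynkin_edges D -> phi e.1 = phi e.2) ->
        forall i, (i <= dynkin_rank D)%N -> phi i = phi i0].
Proof.
case: D => [n|n|||]; rewrite [dynkin_rank _]/= [extended_dynkin_wf _]/= => wf.
- exists (fun=> 1%N), ord0; split=> // [i le|T phi h].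
    have -> : dynkin_edges (At n) = [seq (k, k.+1) | k <- iota 0 n] ++ [:: (n, 0)]%N.
      rewrite /dynkin_edges -[X in iota 0 X]addn1 iotaD map_cat /= add0n modnn; congr (_ ++ _).
      apply/eq_in_map => k; rewrite mem_iota => kn; rewrite modn_small //; lia.
    rewrite nodal_cat nodal_path /nodal big_seq1 /=.
    by do ![case: eqP|case: ifP] => * /=; lia.
  elim=> // i IH lt; rewrite -(IH (ltnW lt)); symmetry.
  have := h (i, i.+1 %% n.+1)%N; rewrite modn_small //; apply.
  apply/mapP; exists i; rewrite ?mem_iota ?modn_small //=; lia.
(* Mark 1 at the four leaves [0], [1], [n - 1], [n] and mark 2 on the spine. *)
- exists (fun i => if (i < 2)%N || (n - 1 <= i)%N then 1%N else 2%N), ord0; split=> //.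
  + by move=> i _; case: ifP.
  + move=> i le; rewrite !nodal_cat nodal_path /nodal !big_cons !big_nil /=.
    by (repeat (case: eqP => ? /=; try by exfalso; lia));
      (repeat (case: ifP => ? /=; try by exfalso; lia)); lia.
  move=> T phi h.
  have h02 : phi 0%N = phi 2%N by apply: (h (0, 2)%N).
  have h12 : phi 1%N = phi 2%N by apply: (h (1, 2)%N); rewrite !inE.
  have path i : (2 <= i <= n - 2)%N -> phi i = phi 0%N.
    elim: i => // i IH /andP [lo hi].
    have [->//|ne] := eqVneq i 1%N.
    rewrite -(IH); last by lia.
    symmetry; apply: (h (i, i.+1)); rewrite !mem_cat; apply/orP; right; apply/orP; left.
    apply/mapP; exists i => //; rewrite mem_iota; lia.
  have e1 : phi (n - 2)%N = phi (n - 1)%N.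
    by apply: (h (n - 2, n - 1)%N); rewrite !mem_cat !inE eqxx !orbT.
  have e2 : phi (n - 2)%N = phi n.
    by apply: (h (n - 2, n)%N); rewrite !mem_cat !inE eqxx !orbT.
  move=> i le; case: (ltnP i 2) => [|lo].
    by case: i le => [|[|i]] // _ _; rewrite h12.
  case: (leqP i (n - 2)) => hi; first by apply: path; lia.
  have := path (n - 2)%N; case: (eqVneq i (n - 1)%N) => [->|ne]; first by rewrite -e1; apply; lia.
  have -> : i = n by lia.
  by rewrite -e2; apply; lia.
(* The branch point [0] carries the largest mark; the extending vertex is the tip of an arm with
   mark 1, here and in the two remaining cases. *)
- exists (nth 0 [:: 3; 2; 1; 2; 1; 2; 1])%N, (inord 2); split.
  + by do 7?[case=> //].
  + by rewrite inordK.
  + by do 7?[case=> [_|]]; rewrite /nodal ?unlock //=; lia.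
  move=> T phi h; rewrite inordK //.
  have /= h1 := h (0, 1)%N isT; have /= h2 := h (1, 2)%N isT; have /= h3 := h (0, 3)%N isT.
  have /= h4 := h (3, 4)%N isT; have /= h5 := h (0, 5)%N isT; have /= h6 := h (5, 6)%N isT.
  by do 7?[case=> [_|]] => //=; congruence.
- exists (nth 0 [:: 4; 2; 3; 2; 1; 3; 2; 1])%N, (inord 4); split.
  + by do 8?[case=> //].
  + by rewrite inordK.
  + by do 8?[case=> [_|]]; rewrite /nodal ?unlock //=; lia.
  move=> T phi h; rewrite inordK //.
  have /= h1 := h (0, 1)%N isT; have /= h2 := h (0, 2)%N isT; have /= h3 := h (2, 3)%N isT.
  have /= h4 := h (3, 4)%N isT; have /= h5 := h (0, 5)%N isT; have /= h6 := h (5, 6)%N isT.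
  have /= h7 := h (6, 7)%N isT.
  by do 8?[case=> [_|]] => //=; congruence.
exists (nth 0 [:: 6; 3; 4; 2; 5; 4; 3; 2; 1])%N, (inord 8); split.
- by do 9?[case=> //].
- by rewrite inordK.
- by do 9?[case=> [_|]]; rewrite /nodal ?unlock //=; lia.
move=> T phi h; rewrite inordK //.
have /= h1 := h (0, 1)%N isT; have /= h2 := h (0, 2)%N isT; have /= h3 := h (2, 3)%N isT.
have /= h4 := h (0, 4)%N isT; have /= h5 := h (4, 5)%N isT; have /= h6 := h (5, 6)%N isT.
have /= h7 := h (6, 7)%N isT; have /= h8 := h (7, 8)%N isT.
by do 9?[case=> [_|]] => //=; congruence.
Qed.

End DynkinRadical.

Section AffineForm.
Variables (Q : quiver) (hQ : affine_quiver Q).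
Local Notation vec := {ffun vertex Q -> int}.

(* [delta] is the minimal positive radical vector; it takes the value 1 at the
   extending vertex [v0]. *)
Lemma affine_delta : exists (delta : vec) (v0 : vertex Q),
  [/\ forall v, 0 < delta v, delta v0 = 1,
      forall v, \sum_a ((src a == v)%:Z * delta (tgt a) + (tgt a == v)%:Z * delta (src a))
        = 2 * delta v
    & forall (T : Type) (phi : vertex Q -> T), (forall a, phi (src a) = phi (tgt a)) ->
        forall v, phi v = phi v0].
Proof.
case: hQ => _ [D [wf [f [g [bf bg fgP]]]]].
have [d [i0 [d_gt0 d0 dn conn]]] := dynkin_radical wf.
case: (bf) => f' ff' f'f; have finj := can_inj ff'.
have lef v : (f v <= dynkin_rank D)%N by rewrite -ltnS ltn_ord.
exists [ffun v => (d (f v))%:Z], (f' i0); split.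
- by move=> v; rewrite ffunE ltz_nat d_gt0.
- by rewrite ffunE f'f d0.
- move=> v; rewrite ffunE -PoszM -dn // /nodal (big_nth (0, 0)%N) big_mkord sumz.
  rewrite (reindex g); last exact: onW_bij.
  apply: eq_bigr => a _; rewrite !ffunE PoszD !PoszM.
  have eqf w : (w == v) = (nat_of_ord (f w) == nat_of_ord (f v)).
    by rewrite (inj_eq val_inj) (inj_eq finj).
  by rewrite !eqf; case: (fgP a) => <- //=; rewrite addrC.
move=> T phi h v; have := conn T (fun i => phi (f' (inord i))) _ (f v) (lef v).
rewrite !inord_val ff' => -> // e eE.
have [j jE] : exists j : 'I_(size (dynkin_edges D)), nth (0, 0)%N (dynkin_edges D) j = e.
  by exists (Ordinal (introT idP (etrans (index_mem e _) eE))); apply: nth_index.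
case: (bg) => g' gg' g'g; have := fgP (g' j); rewrite g'g jE.
by case=> <- /=; rewrite !inord_val !ff' h.
Qed.

End AffineForm.

(** * Semidefiniteness of the Tits form *)

Section PositiveForm.
Variables (Q : quiver).
Local Notation vec := {ffun vertex Q -> int}.
Variables (delta : vec) (v0 : vertex Q).
Hypotheses (delta_gt0 : forall v, 0 < delta v) (delta_v0 : delta v0 = 1)
  (deltaP : forall v,
     \sum_a ((src a == v)%:Z * delta (tgt a) + (tgt a == v)%:Z * delta (src a)) = 2 * delta v)
  (connQ : forall (T : Type) (phi : vertex Q -> T), (forall a, phi (src a) = phi (tgt a)) ->
        forall v, phi v = phi v0).

Let dr v : rat := (delta v)%:~R.
Let dr_gt0 v : 0 < dr v. Proof. by rewrite ltr0z. Qed.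
Let dr_neq0 v : dr v != 0. Proof. by rewrite gt_eqF. Qed.

(** The radical equations at the vertices, weighted by [g] and regrouped by arrows. *)
Lemma handshake (g : vertex Q -> rat) :
  \sum_v g v * (2 * dr v) = \sum_a (g (src a) * dr (tgt a) + g (tgt a) * dr (src a)).
Proof.
transitivity (\sum_v \sum_a ((src a == v)%:R * (g v * dr (tgt a))
                            + (tgt a == v)%:R * (g v * dr (src a)))).
  apply: eq_bigr => v _.
  have -> : 2 * dr v = (2 * delta v)%:~R by rewrite intrM.
  rewrite -deltaP rmorph_sum /= mulr_sumr; apply: eq_bigr => a _.
  rewrite rmorphD !rmorphM /= -!/(dr _) mulrDr !mulrA.
  by rewrite ![g v * _]mulrC; case: (src a == v); case: (tgt a == v).
rewrite exchange_big; apply: eq_bigr => a _; rewrite big_split /=; congr (_ + _).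
  rewrite (bigD1 (src a)) //= eqxx mul1r big1 ?addr0 // => v /negPf.
  by rewrite eq_sym => ->; rewrite mul0r.
rewrite (bigD1 (tgt a)) //= eqxx mul1r big1 ?addr0 // => v /negPf.
by rewrite eq_sym => ->; rewrite mul0r.
Qed.

Lemma euler_radical (x : vec) : euler x delta = - euler delta x.
Proof.
apply/eqP; rewrite -addr_eq0; apply/eqP; apply: (intr_inj (R := rat)).
rewrite rmorphD /euler !rmorphB !rmorph_sum /=.
have := handshake (fun v => (x v)%:~R); rewrite /dr => h.
have e1 : \sum_i (x i * delta i)%:~R + \sum_i (delta i * x i)%:~R
   = \sum_v (x v)%:~R * (2 * (delta v)%:~R) :> rat.
  by rewrite -big_split; apply: eq_bigr => i _; rewrite !rmorphM /=; ring.
rewrite addrACA e1 h -opprD -big_split /=; apply/eqP; rewrite subr_eq0; apply/eqP.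
by apply: eq_bigr => a _; rewrite !rmorphM /=; ring.
Qed.

Let y (x : vec) v : rat := (x v)%:~R / dr v.

(** In the coordinates [y = x / delta] the form is a weighted sum of squares along arrows:
    [handshake] with [g = x^2 / delta] distributes the diagonal terms over the arrows, where they
    complete the squares. *)
Lemma euler_squares (x : vec) :
  2 * (euler x x)%:~R = \sum_a dr (src a) * dr (tgt a) * (y x (src a) - y x (tgt a)) ^+ 2.
Proof.
rewrite /euler rmorphB !rmorph_sum /= mulrBr !mulr_sumr.
have h := handshake (fun v => (x v)%:~R ^+ 2 / dr v).
have -> : \sum_i 2 * (x i * x i)%:~R = \sum_v (x v)%:~R ^+ 2 / dr v * (2 * dr v) :> rat.
  apply: eq_bigr => v _; rewrite rmorphM /=; field; exact: dr_neq0.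
rewrite h -sumrB; apply: eq_bigr => a _; rewrite rmorphM /= /y; field.
by rewrite !dr_neq0.
Qed.

Lemma euler_ge0 (x : vec) : 0 <= euler x x.
Proof.
rewrite -(ler0z rat) -(pmulr_rge0 _ (ltr0n rat 2)) euler_squares.
by apply: sumr_ge0 => a _; rewrite mulr_ge0 ?sqr_ge0 // mulr_ge0 // ltW.
Qed.

Let term_ge0 (x : vec) a : 0 <= dr (src a) * dr (tgt a) * (y x (src a) - y x (tgt a)) ^+ 2.
Proof. by rewrite mulr_ge0 ?sqr_ge0 // mulr_ge0 // ltW. Qed.

Let y_v0 (x : vec) : y x v0 = (x v0)%:~R.
Proof. by rewrite /y /dr delta_v0 divr1. Qed.

Lemma euler_eq0 (x : vec) : euler x x = 0 -> x = delta *~ (x v0).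
Proof.
move=> q0; have := euler_squares x; rewrite q0 mulr0 => /esym/eqP.
rewrite psumr_eq0 => [/allP h|a _]; last exact: term_ge0.
have ye a : y x (src a) = y x (tgt a).
  have /= := h a (mem_index_enum _); rewrite mulf_eq0 mulf_eq0 !(negPf (dr_neq0 _)) /= sqrf_eq0 subr_eq0.
  by move/eqP.
apply/ffunP => v; have := connQ ye v; rewrite y_v0 => /(canRL (divfK _)) e.
rewrite ffunMzE mulrzz mulrC; apply: (intr_inj (R := rat)); by rewrite rmorphM /= e.
Qed.

(** [euler_squares] bounds the variation of [y] along each arrow, and connectedness adds up these
    bounds between [v] and [v0]. *)
Lemma euler_bound (c : int) v : exists b : nat, forall x : vec, euler x x = c ->
  `|x v - (delta *~ x v0) v| <= b%:Z.
Proof.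
pose P v := exists b : nat, forall x : vec, euler x x = c -> `|y x v - y x v0| <= b%:R.
(* All weights are at least 1, so each square is at most [2 c]; [2 c + 1] bounds the root without
   taking one. *)
have adj a (x : vec) : euler x x = c -> `|y x (src a) - y x (tgt a)| <= (2 * absz c + 1)%N%:R.
  move=> qx; have c0 : 0 <= c by rewrite -qx euler_ge0.
  have d1 w : 1 <= dr w by rewrite ler1z; have := delta_gt0 w; lia.
  have := euler_squares x; rewrite qx (bigD1 a) //=.
  set s := (\sum_(_ | _) _); have s0 : 0 <= s by apply: sumr_ge0 => i _; apply: term_ge0.
  set t := y x (src a) - y x (tgt a) => e.
  have -> : ((2 * absz c + 1)%N%:R : rat) = 2 * c%:~R + 1.
    by rewrite natrD natrM -[(absz c)%:R]/((Posz (absz c))%:~R) gez0_abs.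
  have t2 : t ^+ 2 <= 2 * c%:~R.
    rewrite e; apply: (@le_trans _ _ (dr (src a) * dr (tgt a) * t ^+ 2)); last by rewrite lerDl.
    rewrite ler_peMl ?sqr_ge0 //; have := d1 (src a); have := d1 (tgt a); nra.
  have c0' : 0 <= c%:~R :> rat by rewrite ler0z.
  by rewrite ler_norml; apply/andP; split; nra.
have adjP a : P (src a) <-> P (tgt a).
  split=> -[b bP]; exists (b + (2 * absz c + 1))%N => x qx; rewrite natrD.
    apply: le_trans (ler_distD (y x (src a)) _ _) _.
    by rewrite [leLHS]addrC; apply: lerD; [apply: bP|rewrite distrC; apply: adj].
  apply: le_trans (ler_distD (y x (tgt a)) _ _) _.
  by rewrite [leLHS]addrC; apply: lerD; [apply: bP|apply: adj].
have [b bP] : P v.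
  (* Boundedness, as a function from vertices to [Prop], is constant along arrows, so it suffices to
     check it at [v0]. *)
  rewrite (@connQ Prop P) => [|a]; first by exists 0%N => x _; rewrite subrr normr0.
  exact/propext/adjP.
exists (b * absz (delta v))%N => x qx; have := bP x qx.
rewrite -(ler_int rat) intr_norm ffunMzE mulrzz rmorphB rmorphM /= y_v0 => h.
have -> : (x v)%:~R - (delta v)%:~R * (x v0)%:~R = (y x v - (x v0)%:~R) * dr v :> rat.
  by rewrite mulrBl divfK ?gt_eqF // [_ * dr v]mulrC.
rewrite normrM [`|dr v|]gtr0_norm // PoszM intrM (gez0_abs (ltW (delta_gt0 v))).
by rewrite ler_wpM2r // ltW.
Qed.

End PositiveForm.

(** * Defect *)

Section ProjectiveExt.
Variables (F : fieldType) (Q : quiver).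
Local Notation rep := (rep F Q).
Implicit Types (A B C D E M N X Y Z W : rep).

Lemma projectiveP P : projective P <-> forall Y, Ext1_zero P Y.
Proof.
split=> [pP Y E f g /short_exactP [_ /epiP eg _]|h X Y g h0 /epiP eg].
  apply/split_epiP; have /factors_rightP [k kE] := pP E P g (hid P) eg.
  by exists k.
have [K [k sk]] := epi_ker eg; have [c [phi [iphi _ <-]]] := ses_ext sk.
have [psi [_ e2]] := iso_inverse iphi.
have [s sE] : exists s, hcomp (ext_out c) s = h0.
  by apply/ext_out_factor; move/Ext1_zeroP: (h K).
by apply/factors_rightP; exists (hcomp psi s); rewrite -hcompA (hcompA phi) e2 hcomp_idl.
Qed.

Lemma injectiveP I : injective_rep I <-> forall Y, Ext1_zero Y I.
Proof.
split=> [pI Y E f g sfg|h X Y f h0 /monoP mf].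
  have [/monoP mf _ _] := iffLR (short_exactP f g) sfg.
  have /factors_leftP [r rE] := pI I E f (hid I) mf.
  have [c [phi [iphi ef <-]]] := ses_ext (iffLR (short_exactP f g) sfg).
  apply/(split_epi_isor _ iphi)/ext_out_split/ext_in_split; rewrite -ef.
  by apply/(split_mono_isol _ iphi)/split_monoP; exists r.
have [C [q sq]] := mono_coker mf; have [c [phi [iphi ef _]]] := ses_ext sq.
have [s sE] : exists s, hcomp s (ext_in c) = h0.
  by apply/ext_in_factor; move/Ext1_zeroP: (h C).
by apply/factors_leftP; exists (hcomp s phi); rewrite -hcompA ef.
Qed.

Lemma ar_indecl Z X : ar_translate Z X -> indecomposable Z.
Proof. by move=> /ar_translateP [c /ar_coc_indecl]. Qed.
Lemma ar_indecr Z X : ar_translate Z X -> indecomposable X.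
Proof. by move=> /ar_translateP [c /ar_coc_indecr]. Qed.

End ProjectiveExt.

Lemma dependent_sequence (T : Type) (P : T -> Prop) (r : T -> T -> Prop) :
  (forall x, P x -> exists y, P y /\ r x y) -> forall x, P x ->
  exists s : nat -> T, s 0%N = x /\ forall n, P (s n) /\ r (s n) (s n.+1).
Proof.
move=> h x Px.
have /choice [g gP] : forall x : {x | P x}, exists y : {x | P x}, r (sval x) (sval y).
  by move=> [y Py]; have [z [Pz rz]] := h y Py; exists (exist _ z Pz).
exists (fun n => sval (iter n g (exist _ x Px))); split=> // n.
by split; [exact: svalP|exact: gP].
Qed.

Section Defect.
Variables (F : fieldType) (Q : quiver) (hQ : affine_quiver Q).
Local Notation rep := (rep F Q).
Local Notation vec := {ffun vertex Q -> int}.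
Implicit Types (A B C D E M N X Y Z W : rep).

Let acQ : acyclic Q := proj1 hQ.
Definition delta : vec := sval (cid (affine_delta hQ)).
Definition defect M : int := euler delta (dvz M).

Lemma ssrep_vec (w : vec) : (forall v, 0 <= w v) -> dvz (ssrep F (fun v => absz (w v))) = w.
Proof. by move=> h; apply/ffunP => v; rewrite ffunE ssrep_dv gez0_abs. Qed.

Lemma euler0l (w : vec) : euler 0 w = 0.
Proof. by have /eqP := eulerDl 0 0 w; rewrite addr0 -subr_eq subrr => /eqP. Qed.
Lemma euler0r (w : vec) : euler w 0 = 0.
Proof. by have /eqP := eulerDr 0 0 w; rewrite addr0 -subr_eq subrr => /eqP. Qed.
Lemma eulerNl (x w : vec) : euler (- x) w = - euler x w.
Proof. by apply/eqP; rewrite -addr_eq0 -eulerDl addNr euler0l. Qed.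
Lemma eulerNr (x w : vec) : euler w (- x) = - euler w x.
Proof. by apply/eqP; rewrite -addr_eq0 -eulerDr addNr euler0r. Qed.

(** Positive and negative parts of [w] are dimension vectors of semisimple representations, to which
    [serre_euler] applies. *)
Lemma serre_euler_vec Z X (w : vec) : ar_translate Z X ->
  euler (dvz Z) w = - euler w (dvz X).
Proof.
move=> tZX.
pose p : vec := [ffun v => Num.max (w v) 0]; pose n : vec := [ffun v => Num.max (- w v) 0].
have p0 v : 0 <= p v by rewrite ffunE; lia.
have n0 v : 0 <= n v by rewrite ffunE; lia.
have -> : w = p + (- n) by apply/ffunP => v; rewrite !ffunE; lia.
rewrite eulerDr eulerDl eulerNr eulerNl -(ssrep_vec p0) -(ssrep_vec n0).
by rewrite !(serre_euler tZX); lia.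
Qed.

Lemma ses_dvz A B C (f : hom A B) (g : hom B C) : ses f g -> dvz B = dvz A + dvz C.
Proof. by move=> h; apply/ffunP => v; rewrite !ffunE (ses_dv v h). Qed.
Lemma iso_dvz A B : iso A B -> dvz A = dvz B.
Proof. by move=> h; apply/ffunP => v; rewrite !ffunE (iso_dv v h). Qed.

Lemma defect_ses A B C (f : hom A B) (g : hom B C) : ses f g -> defect B = defect A + defect C.
Proof. by move=> h; rewrite /defect (ses_dvz h) eulerDr. Qed.
Lemma defect_iso A B : iso A B -> defect A = defect B.
Proof. by move=> h; rewrite /defect (iso_dvz h). Qed.
Lemma defect_zero A : is_zero A -> defect A = 0.
Proof.
move=> z; rewrite /defect (_ : dvz A = 0) ?euler0r //.
by apply/ffunP => v; rewrite !ffunE /dv z.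
Qed.

Let delta_facts : exists v0, [/\ forall v, 0 < delta v, delta v0 = 1,
      forall v, \sum_a ((src a == v)%:Z * delta (tgt a) + (tgt a == v)%:Z * delta (src a))
        = 2 * delta v
    & forall (T : Type) (phi : vertex Q -> T), (forall a, phi (src a) = phi (tgt a)) ->
        forall v, phi v = phi v0].
Proof. exact: svalP (cid (affine_delta hQ)). Qed.

Lemma euler_delta (x : vec) : euler x delta = - euler delta x.
Proof. by have [v0 [a b c d]] := delta_facts; apply: euler_radical. Qed.

Lemma defect_ar Z X : ar_translate Z X -> defect Z = defect X.
Proof.
move=> h; have := serre_euler_vec delta h; rewrite euler_delta /defect; lia.
Qed.

Let drep : rep := ssrep F (fun v => absz (delta v)).
Let drep_dvz : dvz drep = delta.
Proof. by have [v0 [d0 _ _ _]] := delta_facts; apply: ssrep_vec => v; apply: ltW. Qed.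
Let drep_pos v : (0 < dv drep v)%N.
Proof. by have [v0 [d0 _ _ _]] := delta_facts; rewrite ssrep_dv; have := d0 v; lia. Qed.

Lemma nonzero_vector (V : vectType F) : (0 < \dim {: V})%N -> exists x : V, x <> 0.
Proof.
move=> h; exists (vpick {:V}); apply/eqP; rewrite vpick0 -dimv_eq0; lia.
Qed.

Lemma nonzero_form (V : vectType F) (x : V) : x <> 0 -> exists l : 'Hom(V, F^o), l x = 1.
Proof.
move=> x0; have [|phi [p1 _]] := @separating_functional _ _ 0%VS x; last by exists phi.
by rewrite memv0; apply/eqP.
Qed.

Lemma exists_top_vertex X : ~ is_zero X ->
  exists v (x : X v), x <> 0 /\ forall a (y : X (src a)), tgt a = v -> y = 0.
Proof.
move=> nz; apply: contrapT => no; apply: nz; apply/is_zeroP.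
apply: (src_induction acQ) => v IH x; apply: contrapT => x0; apply: no; exists v, x.
by split=> // a y e; apply: IH.
Qed.

Lemma exists_socle_vertex X : ~ is_zero X ->
  exists v (x : X v), x <> 0 /\ forall a, src a = v -> forall y : X (tgt a), y = 0.
Proof.
move=> nz; apply: contrapT => no; apply: nz; apply/is_zeroP.
apply: (tgt_induction acQ) => v IH x; apply: contrapT => x0; apply: no; exists v, x.
by split=> // a e; apply: IH.
Qed.

Lemma top_simple X : ~ is_zero X ->
  exists v (q : hom X (simple F v)) x, \sum_j (q v x) 0 j = 1.
Proof.
move=> /exists_top_vertex [v [x [x0 h]]]; have [l l1] := nonzero_form x0.
have [|q qE] := @hom_to_simple _ _ X v l.
  move=> a y; have [e|ne] := pselect (tgt a = v).
    by rewrite (h a y e) !lf0.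
  by rewrite place_neq ?zero_lfunE // => e; apply: ne.
exists v, q, x; rewrite (const_mx_sum (qE v x)) ?eqxx // place_eq; exact: l1.
Qed.

Lemma simple_into_drep v : exists (k : hom (simple F v) drep) y,
  y <> 0 /\ forall r, k v r = (\sum_j r 0 j) *: y.
Proof.
have [y y0] := nonzero_vector (drep_pos v).
have [|k kE] := @hom_from_simple _ _ drep v y; first by move=> a; apply: zero_lfunE.
by exists k, y; split=> // r; rewrite kE place_eq.
Qed.

(** Minus the defect is the Euler form of [P] against [delta], that is the dimension of Hom(P,
    drep). It is positive: [P] maps onto some simple, and [drep] contains every simple because
    [delta] has full support. *)
Lemma projective_defect P : ~ is_zero P -> projective P -> defect P < 0.
Proof.
move=> nP /projectiveP eP; have := euler_delta (dvz P); rewrite -/(defect P) -drep_dvz eulerE.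
have /ed_eq0 -> := eP drep.
have [v [q [x q1]]] := top_simple nP; have [k [y [y0 kE]]] := simple_into_drep v.
have : (0 < hd P drep)%N.
  apply: (@hd_gt0 _ _ _ _ (hcomp k q)); apply/hneq0P; exists v, x.
  by rewrite hcompE kE q1 scale1r.
lia.
Qed.

Lemma injective_defect I : ~ is_zero I -> injective_rep I -> 0 < defect I.
Proof.
move=> nI /injectiveP eI; rewrite /defect -drep_dvz eulerE.
have /ed_eq0 -> := eI drep.
have [v [x [x0 h]]] := exists_socle_vertex nI.
have [|k kE] := @hom_from_simple _ _ I v x.
  move=> a; have [e|ne] := pselect (src a = v); first exact: h.
  by rewrite place_neq ?lf0 // => e; apply: ne.
have [y y0] := nonzero_vector (drep_pos v); have [l l1] := nonzero_form y0.
have [|q qE] := @hom_to_simple _ _ drep v l.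
  by move=> a z; rewrite zero_lfunE lf0.
have : (0 < hd drep I)%N.
  apply: (@hd_gt0 _ _ _ _ (hcomp k q)); apply/hneq0P; exists v, y.
  rewrite hcompE kE (const_mx_sum (qE v y)) ?eqxx // !place_eq l1 scale1r //.
lia.
Qed.

(** If no translate is projective, the [tau]-orbit continues forever and [no_negative_defect]
    applies to its dimension vectors. *)
Lemma preprojective_of_defect X : indecomposable X -> defect X < 0 -> preprojective X.
Proof.
move=> iX neg; apply: contrapT => np.
have [|s [s0 sP]] := @dependent_sequence _
    (fun X => indecomposable X /\ ~ preprojective X) (fun Z X => ar_translate Z X) _ X (conj iX np).
  move=> Z [iZ npZ]; have [X' tX'] : exists X', ar_translate Z X'.
    apply: ar_translate_exists => //; apply: contrapT => /forallNP no.
    apply: npZ; apply: preprojective_base => //; apply/projectiveP => Y.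
    by apply: contrapT; apply: no.
  exists X'; split=> //; split; first exact: ar_indecr tX'.
  by move=> pX'; apply: npZ; apply: preprojective_step tX' pX'.
have [v0 [d0 d1 d2 d3]] := delta_facts.
have := @no_negative_defect Q delta v0 (@euler Q) (@eulerDl Q) (@eulerDr Q) (fun=> erefl)
  euler_delta (euler_ge0 d0 d2) (euler_eq0 d0 d1 d2 d3) (euler_bound d0 d1 d2 d3)
  (fun m => dvz (s m)).
rewrite s0 -/(defect X) => /(_ _ _) h; suff : 0 <= defect X by rewrite leNgt neg.
apply: h => [m v|m w]; first by rewrite ffunE.
by apply: serre_euler_vec; have [_] := sP m.
Qed.

(** The same for the orbit under the inverse translate, with the transposed Euler form, for which
    the defect changes sign. *)
Lemma preinjective_of_defect X : indecomposable X -> 0 < defect X -> preinjective X.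
Proof.
move=> iX pos; apply: contrapT => np.
have [|s [s0 sP]] := @dependent_sequence _
    (fun X => indecomposable X /\ ~ preinjective X) (fun X Z => ar_translate Z X) _ X (conj iX np).
  move=> Z [iZ npZ]; have [X' tX'] : exists X', ar_translate X' Z.
    apply: ar_translate_inv_exists => //; apply: contrapT => /forallNP no.
    apply: npZ; apply: preinjective_base => //; apply/injectiveP => Y.
    by apply: contrapT; apply: no.
  exists X'; split=> //; split; first exact: ar_indecl tX'.
  by move=> pX'; apply: npZ; apply: preinjective_step tX' pX'.
have [v0 [d0 d1 d2 d3]] := delta_facts.
have := @no_negative_defect Q delta v0 (fun x y => euler y x) (fun x y w => eulerDr x y w)
  (fun x y w => eulerDl x y w) (fun=> erefl) _ (euler_ge0 d0 d2)
  (euler_eq0 d0 d1 d2 d3) (euler_bound d0 d1 d2 d3) (fun m => dvz (s m)).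
rewrite s0 euler_delta -/(defect X) => h; suff : 0 <= - defect X by rewrite oppr_ge0 leNgt pos.
apply: h => [x|m v|m w]; first by rewrite euler_delta opprK.
  by rewrite ffunE.
by rewrite (serre_euler_vec w (proj2 (sP m))) opprK.
Qed.

(** At a vertex [v] that no arrow enters, the simple has defect [delta v]. *)
Lemma defect_neq0 : exists M, defect M <> 0.
Proof.
have [v0 [d0 _ _ _]] := delta_facts.
have [v nov] : exists v : vertex Q, forall a, tgt a <> v.
  apply: contrapT => no; apply: (src_induction acQ (P := fun=> False)) v0 => v IH.
  by apply: no; exists v => a e; apply: IH e.
exists (simple F v); rewrite /defect /euler (bigD1 v) //= ffunE ssrep_dv eqxx mulr1.
rewrite !big1 => [|a _|w /negPf ne]; last by rewrite ffunE ssrep_dv ne mulr0.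
  by have := d0 v; lia.
by rewrite ffunE ssrep_dv (introF eqP (nov a)) mulr0.
Qed.

Lemma defect0_periodic (s : nat -> rep) : defect (s 0%N) = 0 ->
  (forall m, ar_translate (s m) (s m.+1)) -> exists m1 m2, (m1 < m2)%N /\ dvz (s m1) = dvz (s m2).
Proof.
move=> s0 sP; have [v0 [d0 d1 d2 d3]] := delta_facts; have [M /eqP dM] := defect_neq0.
have h := @zero_defect_periodic Q delta v0 (@euler Q) (@eulerDl Q) (@eulerDr Q) (fun=> erefl)
  euler_delta (euler_eq0 d0 d1 d2 d3) (euler_bound d0 d1 d2 d3)
  (fun m => dvz (s m)).
apply: (h _ _ (dvz M)) => // [m v|m w]; first by rewrite ffunE.
exact: serre_euler_vec.
Qed.

Lemma preprojective_defect X : preprojective X -> defect X < 0.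
Proof.
elim=> [P iP pP|Z X' t _]; last by rewrite (defect_ar t).
by apply: projective_defect => //; case: iP.
Qed.
Lemma preinjective_defect X : preinjective X -> 0 < defect X.
Proof.
elim=> [P iP pP|Z X' t _]; last by rewrite (defect_ar t).
by apply: injective_defect => //; case: iP.
Qed.

(** Both self-extension groups of [Z] and of [tau Z] are dual to Hom(Z, tau Z), so rigidity passes
    along [tau]. *)
Lemma preprojective_rigid X : preprojective X -> rigid X.
Proof.
elim=> [P _ /projectiveP pP|Z X' t _ r]; first exact: pP.
apply/(serre_l _ t) => f; move: f; apply/(serre_r _ t); exact: r.
Qed.
Lemma preinjective_rigid X : preinjective X -> rigid X.
Proof.
elim=> [P _ /injectiveP pP|Z X' t _ r]; first exact: pP.
apply/(serre_r _ t) => f; move: f; apply/(serre_l _ t); exact: r.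
Qed.

End Defect.

(** * Semistable and stable representations *)

Section Semistability.
Variables (F : fieldType) (Q : quiver) (hQ : affine_quiver Q).
Local Notation rep := (rep F Q).
Local Notation df := (defect hQ).
Implicit Types (A B C D E K M N S T U X Y Z W : rep).

Let acQ : acyclic Q := proj1 hQ.

Lemma iso_intro M N (f : hom M N) : is_iso f -> iso M N.
Proof. by move=> h; apply/isoP; exists f. Qed.

Lemma mono_neq0 M N (f : hom M N) : mono f -> ~ is_zero M -> f <> hzero M N.
Proof.
move=> mf /nonzeroP [v [x x0]]; apply/hneq0P; exists v, x => e; apply: x0.
exact: mono_eq0 e.
Qed.
Lemma epi_neq0 M N (f : hom M N) : epi f -> ~ is_zero N -> f <> hzero M N.
Proof.
move=> ef /nonzeroP [v [y y0]]; have [x xy] := ef v y.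
by apply/hneq0P; exists v, x; rewrite xy.
Qed.
Lemma hcomp_neq0 M N X (g : hom N X) (f : hom M N) :
  hcomp g f <> hzero M X -> g <> hzero N X /\ f <> hzero M N.
Proof.
move=> h; split=> e; apply: h; apply: hom_ext => v x; rewrite hcompE e !hzeroE ?lf0 //.
Qed.
Lemma mono_comp_neq0 M N X (g : hom N X) (f : hom M N) :
  mono g -> f <> hzero M N -> hcomp g f <> hzero M X.
Proof.
move=> mg /hneq0P [v [x fx]]; apply/hneq0P; exists v, x; rewrite hcompE => e; apply: fx.
exact: mono_eq0 e.
Qed.
Lemma epi_comp_neq0 M N X (g : hom N X) (f : hom M N) :
  epi f -> g <> hzero N X -> hcomp g f <> hzero M X.
Proof.
move=> ef /hneq0P [v [y gy]]; have [x xy] := ef v y; apply/hneq0P; exists v, x.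
by rewrite hcompE xy.
Qed.

(** Both sides say that Ext^1(Z2, X1) vanishes. This transfer of nonzero morphisms takes the place
    of functoriality of [tau]. *)
Lemma ar_hom_zero Z1 X1 Z2 X2 : ar_translate Z1 X1 -> ar_translate Z2 X2 ->
  (forall f : hom Z1 Z2, f = hzero _ _) <-> (forall f : hom X1 X2, f = hzero _ _).
Proof.
by move=> t1 t2; rewrite -(serre_r _ t1) (serre_l _ t2).
Qed.

Lemma ar_hom_neq0 Z1 X1 Z2 X2 : ar_translate Z1 X1 -> ar_translate Z2 X2 ->
  (exists f : hom Z1 Z2, f <> hzero _ _) <-> (exists f : hom X1 X2, f <> hzero _ _).
Proof.
move=> t1 t2; have h := ar_hom_zero t1 t2.
by split=> -[f f0]; apply: contrapT => /forallNP no; apply: f0; move: f; apply/h => g; apply: contrapT.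
Qed.

Lemma ar_exists D : indecomposable D -> 0 <= df D -> exists D', ar_translate D D'.
Proof.
move=> iD d0; apply: ar_translate_exists => //; apply: contrapT => /forallNP no.
have : df D < 0; last by rewrite ltNge d0.
apply: projective_defect; first by case: iD.
by apply/projectiveP => Y; apply: contrapT; apply: no.
Qed.

Lemma ar_inv_exists D : indecomposable D -> df D <= 0 -> exists D', ar_translate D' D.
Proof.
move=> iD d0; apply: ar_translate_inv_exists => //; apply: contrapT => /forallNP no.
have : 0 < df D; last by rewrite ltNge d0.
apply: injective_defect; first by case: iD.
by apply/injectiveP => Y; apply: contrapT; apply: no.
Qed.

(** A nonzero image in a projective is projective, so the indecomposable [D] splits onto it and is
    isomorphic to it, against the sign of its defect. The inductive step moves both objects by
    [tau]. *)
Lemma hom_to_preprojective X : preprojective X -> forall D (f : hom D X),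
  indecomposable D -> 0 <= df D -> f = hzero D X.
Proof.
elim=> [P iP /projectiveP pP D f iD d0|Z X' t _ IH D f iD d0].
  apply: contrapT => f0; have [I [e [m [ee mm fE]]]] := image f.
  have nI : ~ is_zero I.
    move=> z; apply: f0; apply: hom_ext => v x; rewrite -fE hcompE hzeroE.
    by rewrite (iffLR (is_zeroP _) z v (e v x)) lf0.
  have pI Y : Ext1_zero I Y by apply: Ext1_mono mm (pP Y).
  have /iso_intro/defect_iso dI : is_iso e.
    apply: split_epi_indec => //; have [K [k /short_exactP se]] := epi_ker ee; exact: pI se.
  by have := projective_defect hQ nI (iffRL (projectiveP I) pI); rewrite -dI ltNge d0.
have [D' tD] := ar_exists iD d0; move: f; apply/(ar_hom_zero tD t) => f.
by apply: IH; [apply: ar_indecr tD|rewrite -(defect_ar hQ tD)].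
Qed.

Lemma hom_from_preinjective X : preinjective X -> forall D (f : hom X D),
  indecomposable D -> df D <= 0 -> f = hzero X D.
Proof.
elim=> [P iP /injectiveP pP D f iD d0|Z X' t _ IH D f iD d0].
  apply: contrapT => f0; have [I [e [m [ee mm fE]]]] := image f.
  have nI : ~ is_zero I.
    move=> z; apply: f0; apply: hom_ext => v x; rewrite -fE hcompE hzeroE.
    by rewrite (iffLR (is_zeroP _) z v (e v x)) lf0.
  have pI Y : Ext1_zero Y I by apply: Ext1_epi ee (pP Y).
  have /iso_intro/defect_iso dI : is_iso m.
    apply: split_mono_indec => //; have [C [c sc]] := mono_coker mm.
    have [k [phi [iphi e1 e2]]] := ses_ext sc.
    apply/(split_mono_isol _ iphi); rewrite e1; apply/ext_in_split.
    exact: (iffLR (Ext1_zeroP _ _) (pI C)).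
  by have := injective_defect hQ nI (iffRL (injectiveP I) pI); rewrite dI ltNge d0.
have [D' tD] := ar_inv_exists iD d0; move: f; apply/(ar_hom_zero t tD) => f.
by apply: IH; [apply: ar_indecl tD|rewrite (defect_ar hQ tD)].
Qed.

Lemma hom_zero_of_defect D X (f : hom D X) : indecomposable D -> indecomposable X ->
  (0 <= df D /\ df X < 0) \/ (0 < df D /\ df X <= 0) -> f = hzero D X.
Proof.
move=> iD iX [] [d x].
  exact: hom_to_preprojective (preprojective_of_defect iX x) _ _ iD d.
exact: hom_from_preinjective (preinjective_of_defect iD d) _ _ iX x.
Qed.

Lemma nonrigid_defect M : indecomposable M -> ~ rigid M -> df M = 0.
Proof.
move=> iM nr; case: (ltgtP (df M) 0) => // d; case: nr.
  exact: preprojective_rigid (preprojective_of_defect iM d).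
exact: preinjective_rigid (preinjective_of_defect iM d).
Qed.

(** [P] is a sign condition: when a sum satisfies it, so does a term, hence it survives into some
    indecomposable summand. *)
Lemma indec_summand_defect (P : int -> Prop) : (forall a b, P (a + b) -> P a \/ P b) ->
  forall X, ~ is_zero X -> P (df X) ->
  exists D (i : hom D X) (p : hom X D), [/\ indecomposable D, hcomp p i = hid D & P (df D)].
Proof.
move=> PD X; have [n] := ubnP (tdim X); elim: n X => // n IH X; rewrite ltnS => le nX PX.
have [iX|dX] := pselect (indecomposable X).
  by exists X, (hid X), (hid X); rewrite hcomp_idl.
have [A [B [iA [pA [iB [pB [bp nA nB]]]]]]] := decomposable nX dX.
have tX := ses_tdim (biprod_ses bp); have := tdim_gt0 nA; have := tdim_gt0 nB => tA tB.
have [eA eB _] := bp.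
move: PX; rewrite (defect_ses hQ (biprod_ses bp)) => /PD [] PA.
  have [|//|//|D [i [p [iD e PDD]]]] := IH A; first by lia.
  exists D, (hcomp iA i), (hcomp p pA); split=> //.
  by rewrite -hcompA (hcompA pA) eA hcomp_idl.
have [|//|//|D [i [p [iD e PDD]]]] := IH B; first by lia.
exists D, (hcomp iB i), (hcomp p pB); split=> //.
by rewrite -hcompA (hcompA pB) eB hcomp_idl.
Qed.

(** King semistability for the weight given by the defect. In this form, closure under extensions,
    images and kernels is a matter of adding defects. *)
Definition semistable X := df X = 0 /\ forall U (i : hom U X), mono i -> df U <= 0.

(** A subobject of positive defect has an indecomposable summand of positive defect, which admits no
    nonzero morphism to [X]. *)
Lemma semistable_indec X : indecomposable X -> df X = 0 -> semistable X.
Proof.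
move=> iX d0; split=> // U i mi; rewrite leNgt; apply/negP => pos.
have nU : ~ is_zero U by move=> z; move: pos; rewrite defect_zero.
have [|D [j [p [iD e pD]]]] := @indec_summand_defect (fun a => 0 < a) _ U nU pos.
  by move=> a b; lia.
have mj : mono j by apply: split_mono_mono; apply/split_monoP; exists p.
apply: (mono_neq0 (mono_comp mi mj)); first by case: iD.
by apply: hom_zero_of_defect => //; right; rewrite d0.
Qed.

Lemma semistable_quot X C (q : hom X C) : semistable X -> epi q -> 0 <= df C.
Proof.
move=> [d0 h] /epi_ker [K [k s]]; have [mk _ _] := s.
by have := defect_ses hQ s; have := h K k mk; rewrite d0; lia.
Qed.

Lemma semistable_sub X U (i : hom U X) : semistable X -> mono i -> df U = 0 -> semistable U.
Proof. by move=> [_ h] mi d0; split=> // W j mj; apply: h (mono_comp mi mj). Qed.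

(** [V] is the preimage of [U]; presenting it as an extension of [U] by [K] lifts defects and
    semistability from a quotient. *)
Lemma pullback_mono K X C (k : hom K X) (q : hom X C) U (j : hom U C) : ses k q -> mono j ->
  exists V (i : hom V X) (l : hom K V) (p : hom V U),
    [/\ mono i, ses l p, hcomp i l = k & hcomp q i = hcomp j p].
Proof.
move=> s mj; have [mk eq x] := s; have [G [r sr]] := mono_coker mj; have [_ er xr] := sr.
have [V [i si]] := epi_ker (epi_comp er eq); have [mi _ xi] := si.
have [|l lE] := factor_mono (g := k) mi.
  move=> v y; apply/xi; rewrite hcompE (_ : q v _ = 0) ?lf0 //; by apply/x; exists y.
have [|p pE] := factor_mono (g := hcomp q i) mj.
  move=> v y; apply/xr; rewrite hcompE -(hcompE r); apply/xi; by exists y.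
exists V, i, l, p; split=> //; split.
- by apply: (@mono_compr _ _ _ _ _ i); rewrite lE.
- move=> v u; have [y yE] := eq v (j v u).
  have [z zE] : exists z, i v z = y by apply/xi; rewrite hcompE yE; apply/xr; exists u.
  by exists z; apply: mj; rewrite -hcompE pE hcompE zE.
move=> v y; split=> [p0|[z <-]].
  have [z zE] : exists z, k v z = i v y by apply/x; rewrite -hcompE -pE hcompE p0 lf0.
  by exists z; apply: mi; rewrite -hcompE lE.
apply: (mono_eq0 mj); rewrite -hcompE pE hcompE -(hcompE i) lE.
by apply/x; exists z.
Qed.

Lemma semistable_quotient K X C (k : hom K X) (q : hom X C) :
  ses k q -> semistable X -> df K = 0 -> semistable C.
Proof.
move=> s [d0 h] dK; split; first by have := defect_ses hQ s; rewrite d0 dK; lia.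
move=> U j mj; have [V [i [l [p [mi sl _ _]]]]] := pullback_mono s mj.
by have := defect_ses hQ sl; have := h V i mi; rewrite dK; lia.
Qed.

Lemma semistable_ext K X C (k : hom K X) (q : hom X C) :
  ses k q -> semistable K -> semistable C -> semistable X.
Proof.
move=> s [dK hK] [dC hC]; split; first by rewrite (defect_ses hQ s) dK dC.
move=> U i mi; have [I [e [m [ee mm eE]]]] := image (hcomp q i).
have [L [l sl]] := epi_ker ee; have [ml _ xl] := sl; have [mk _ x] := s.
have [|g gE] := factor_mono (g := hcomp i l) mk.
  move=> v y; apply/x; rewrite hcompE -(hcompE q) -eE hcompE (_ : e v _ = 0) ?lf0 //.
  by apply/xl; exists y.
have mg : mono g by apply: (@mono_compr _ _ _ _ _ k); rewrite gE; apply: mono_comp.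
by have := hK L g mg; have := hC I m mm; rewrite (defect_ses hQ sl); lia.
Qed.

Lemma semistable_iso X Y : iso X Y -> semistable X -> semistable Y.
Proof.
move=> h [d0 hX]; split; first by rewrite -(defect_iso hQ h).
move=> U i mi; have /isoP [g [mg _]] := iso_sym h.
exact: hX (mono_comp mg mi).
Qed.

Lemma semistable_zero X : is_zero X -> semistable X.
Proof.
by move=> z; split=> [|U i mi]; rewrite (@defect_zero _ _ hQ) //; apply: mono_zero mi z.
Qed.

(** The defect of the image is at least 0 as that of a quotient and at most 0 as that of a
    subobject. *)
Lemma semistable_image X Y I (e : hom X I) (m : hom I Y) :
  semistable X -> semistable Y -> epi e -> mono m -> semistable I.
Proof.
move=> hX hY ee mm; apply: (semistable_sub _ mm) => //.
by have := semistable_quot hX ee; have := hY.2 _ m mm; lia.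
Qed.

Lemma semistable_kernel X Y (f : hom X Y) K (k : hom K X) :
  semistable X -> semistable Y -> mono k -> exact k f -> semistable K.
Proof.
move=> hX hY mk x; have [I [e [m [ee mm fE]]]] := image f.
have s : ses k e.
  split=> // v y; rewrite -x -fE hcompE; split=> [->|]; first by rewrite lf0.
  exact: mono_eq0.
apply: (semistable_sub _ mk) => //.
have := defect_ses hQ s; have [-> _] := hX.
by have [-> _] := semistable_image hX hY ee mm; lia.
Qed.

Lemma regularP X : regular X <-> semistable X.
Proof.
split=> [|hX D iD [i /split_monoP [p e]]]; last first.
  have mi : mono i by apply: split_mono_mono; apply/split_monoP; exists p.
  have ep : epi p by apply: split_epi_epi; apply/split_epiP; exists i.
  have := semistable_quot hX ep; have := hX.2 _ i mi => d1 d2.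
  by split=> [/(preprojective_defect hQ)|/(preinjective_defect hQ)]; lia.
have [n] := ubnP (tdim X); elim: n X => // n IH X; rewrite ltnS => le hX.
have [z|nX] := pselect (is_zero X); first exact: semistable_zero.
have [iX|dX] := pselect (indecomposable X).
  have [|np ni] := hX X iX; first by exists (hid X); apply/split_monoP; exists (hid X); rewrite hcomp_idl.
  apply: semistable_indec => //; case: (ltgtP (df X) 0) => // d.
    by case: np; apply: preprojective_of_defect d.
  by case: ni; apply: preinjective_of_defect d.
have [A [B [iA [pA [iB [pB [bp nA nB]]]]]]] := decomposable nX dX.
have tX := ses_tdim (biprod_ses bp); have := tdim_gt0 nA; have := tdim_gt0 nB => tA tB.
have [eA eB _] := bp.
have rA : regular A.
  move=> D iD [i /split_monoP [p e]]; apply: hX iD _; exists (hcomp iA i).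
  by apply/split_monoP; exists (hcomp p pA); rewrite -hcompA (hcompA pA) eA hcomp_idl.
have rB : regular B.
  move=> D iD [i /split_monoP [p e]]; apply: hX iD _; exists (hcomp iB i).
  by apply/split_monoP; exists (hcomp p pB); rewrite -hcompA (hcompA pB) eB hcomp_idl.
by apply: (semistable_ext (biprod_ses bp)); apply: IH => //; lia.
Qed.

Definition stable S := [/\ ~ is_zero S, semistable S
  & forall U (i : hom U S), mono i -> df U = 0 -> is_zero U \/ is_iso i].

Lemma quasi_simpleP S : quasi_simple S <-> stable S.
Proof.
split=> [[/regularP rS nS h]|[nS sS h]]; split=> //; last 2 first.
- exact/regularP.
- move=> N /regularP [dN _]; have [z|[_ eN]] := h _ _ (@sub_incl_mono _ _ _ N) dN; first by left.
  right=> v; apply/vspaceP => x; rewrite memvf; apply/sub_inclP; exact: eN.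
move=> U i mi dU; have iU := img_iso mi.
have [|z|full] := h (img i).
- by apply/regularP; apply: semistable_iso (iso_sym iU) _; apply: semistable_sub mi dU.
- by left; apply: iso_zero z.
by right; split=> // v y; apply/imgP; rewrite full memvf.
Qed.

Lemma stable_mono S X (f : hom S X) : stable S -> semistable X -> f <> hzero S X -> mono f.
Proof.
move=> [nS sS h] sX f0; have [K [k [mk x]]] := kernel f.
have [dK _] := semistable_kernel sS sX mk x.
have [z|[_ ek]] := h K k mk dK.
  apply: mono0 => v y /x [u <-]; by rewrite (iffLR (is_zeroP _) z v u) lf0.
case: f0; apply: hom_ext => v y; rewrite hzeroE; apply/x; exact: ek.
Qed.

Lemma stable_epi S X (f : hom X S) : stable S -> semistable X -> f <> hzero X S -> epi f.
Proof.
move=> [nS sS h] sX f0; have [I [e [m [ee mm fE]]]] := image f.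
have [dI _] := semistable_image sX sS ee mm.
have [z|[_ em]] := h I m mm dI; last by rewrite -fE; apply: epi_comp.
case: f0; apply: hom_ext => v y; rewrite hzeroE -fE hcompE.
by rewrite (iffLR (is_zeroP _) z v (e v y)) lf0.
Qed.

Lemma stable_schur S T (f : hom S T) : stable S -> stable T -> f <> hzero S T -> is_iso f.
Proof.
move=> hS hT f0; have [_ sS _] := hS; have [_ sT _] := hT.
by split; [apply: stable_mono f0|apply: stable_epi f0].
Qed.

Lemma stable_iso S T : iso S T -> stable S -> stable T.
Proof.
move=> h [nS sS hS]; split.
- by move=> z; apply: nS; apply: iso_zero z; apply: iso_sym.
- exact: semistable_iso sS.
move=> U i mi dU; have /isoP [g [mg eg]] := iso_sym h.
have [z|[_ e]] := hS U _ (mono_comp mg mi) dU; first by left.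
right; split=> // v y; have [x xE] := e v (g v y); exists x; apply: mg.
by rewrite -hcompE.
Qed.

Lemma stable_indec S : stable S -> indecomposable S.
Proof.
move=> [nS [d0 sS] hS]; apply: contrapT => nd.
have [A [B [iA [pA [iB [pB [bp nA nB]]]]]]] := decomposable nS nd.
have s := biprod_ses bp; have s' := biprod_ses (biprod_sym bp).
have [mA _ x] := s; have [mB eA _] := s'.
have := defect_ses hQ s; have := sS _ _ mA; have := sS _ _ mB; rewrite d0 => dA dB dAB.
have [//|[_ ei]] := hS A iA mA ltac:(lia).
apply: nB; apply/is_zeroP => v b; apply: (mono_eq0 mB).
have [a aE] := ei v (iB v b); rewrite -aE.
have [eA' eB' _] := bp; have [h1 h2] := biprod_comp0 bp.
have : pA v (iB v b) = 0 := h1 v b.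
by rewrite -aE -hcompE eA' hidE => ->; rewrite lf0.
Qed.

Lemma stable_subobject X : semistable X -> ~ is_zero X ->
  exists S (i : hom S X), stable S /\ mono i.
Proof.
move=> sX nX.
have [|n [[S [i [mi dS nS tS]]] mn]] := @min_nat (fun n => exists S, exists i : hom S X,
  [/\ mono i, df S = 0, ~ is_zero S & tdim S = n]).
  by exists (tdim X), X, (hid X); split=> //; [apply: mono_id|case: sX].
exists S, i; split=> //; split=> //; first exact: semistable_sub mi dS.
move=> U j mj dU; have [z|nU] := pselect (is_zero U); [by left|right].
apply: mono_tdim_iso => //; rewrite tS; apply: mn.
by exists U, (hcomp i j); split=> //; apply: mono_comp.
Qed.

Lemma stable_quotient X : semistable X -> ~ is_zero X ->
  exists S (q : hom X S), stable S /\ epi q.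
Proof.
move=> sX nX.
have [|n [[S [q [eq dS nS tS]]] mn]] := @min_nat (fun n => exists S, exists q : hom X S,
  [/\ epi q, df S = 0, ~ is_zero S & tdim S = n]).
  by exists (tdim X), X, (hid X); split=> //; [apply: epi_id|case: sX].
have sS : semistable S.
  have [K [k s]] := epi_ker eq; apply: (semistable_quotient s sX).
  by have := defect_ses hQ s; case: sX => -> _; rewrite dS; lia.
exists S, q; split=> //; split=> // U j mj dU; have [z|nU] := pselect (is_zero U); [by left|right].
have [C [c s]] := mono_coker mj; have [_ ec x] := s.
have zC : is_zero C.
  apply: contrapT => nC; have : (n <= tdim C)%N.
    apply: mn; exists C, (hcomp c q); split=> //; first exact: epi_comp.
    by have := defect_ses hQ s; rewrite dS dU; lia.
  by have := ses_tdim s; have := tdim_gt0 nU; lia.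
by split=> // v y; apply/x; apply: (iffLR (is_zeroP _) zC).
Qed.

End Semistability.

(** * Tubes *)

(** This isolates the property of the ground field that makes endomorphisms of stable
    representations scalar. *)
Definition has_eigenvectors (F : fieldType) := forall (V : vectType F) (f : 'End(V)) (x : V),
  x <> 0 -> exists a y, y <> 0 /\ f y = a *: y.

Section Tubes.
Variables (F : fieldType) (eigF : has_eigenvectors F) (Q : quiver) (hQ : affine_quiver Q).
Local Notation rep := (rep F Q).
Local Notation df := (defect hQ).
Local Notation stable := (stable hQ).
Local Notation semistable := (semistable hQ).
Implicit Types (A B C D E K M N S T U X Y Z W : rep).

Lemma stable_scalar S (f : hom S S) : stable S -> exists a, forall v x, f v x = a *: x.
Proof.
move=> hS; have [nS sS _] := hS; have /nonzeroP [v [x x0]] := nS.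
have [a [y [y0 fy]]] := eigF (f v) x0; exists a => w z.
suff e : hlin (- a) (hid S) f = hzero S S.
  have := congr1 (fun g : hom S S => g w z) e; rewrite hlinE hidE hzeroE scaleNr addrC.
  by move/eqP; rewrite subr_eq0 => /eqP.
apply: contrapT => /(stable_schur hS hS) [/mono_eq0 mg _]; apply: y0; apply: mg.
by rewrite hlinE hidE fy scaleNr addNr.
Qed.

Lemma fam_of_id_neq0 A : ~ is_zero A -> fam_of (hid A) != 0.
Proof.
move=> nA; apply/eqP => /fam_of_eq0 e; have /nonzeroP [v [x x0]] := nA.
by apply: x0; rewrite -(hidE x) e hzeroE.
Qed.

Lemma stable_hd S : stable S -> hd S S = 1%N.
Proof.
move=> hS; have [nS _ _] := hS.
rewrite /hd (_ : homsp S S = <[fam_of (hid S)]>%VS) ?dim_vline ?fam_of_id_neq0 //.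
apply/vspaceP => u; apply/idP/idP => [/homspP [f ->]|/vlineP [a ->]].
  have [a aE] := stable_scalar f hS; apply/vlineP; exists a; apply/ffunP => v; apply/lfunP => x.
  by rewrite dprodZE scale_lfunE !fam_ofE hidE aE.
apply/homspP; exists (hlin a (hid S) (hzero S S)); apply/ffunP => v; apply/lfunP => x.
by rewrite dprodZE scale_lfunE !fam_ofE hlinE hzeroE addr0.
Qed.

Lemma hd1_iso A (f : hom A A) : ~ is_zero A -> hd A A = 1%N -> f <> hzero A A -> is_iso f.
Proof.
move=> nA d1 f0; have [a aE] : exists a, fam_of f = a *: fam_of (hid A).
  apply/vlineP; have /eqP -> : <[fam_of (hid A)]>%VS == homsp A A.
    rewrite eqEdim dim_vline fam_of_id_neq0 // -/(hd A A) d1 leqnn andbT -memvE.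
    by apply/homspP; exists (hid A).
  by apply/homspP; exists f.
have fE v x : f v x = a *: x by rewrite -fam_ofE aE dprodZE scale_lfunE fam_ofE hidE.
have a0 : a != 0 by apply: contra_notN f0 => /eqP e; apply: hom_ext => v x; rewrite fE e scale0r hzeroE.
split; first by apply: mono0 => v x; rewrite fE => /eqP; rewrite scaler_eq0 (negPf a0) => /eqP.
by move=> v y; exists (a^-1 *: y); rewrite fE scalerA divff // scale1r.
Qed.

Lemma semistable_ar Z X : ar_translate Z X -> semistable Z -> semistable X.
Proof.
move=> t [d _]; apply: semistable_indec; first exact: ar_indecr t.
by rewrite -(defect_ar hQ t).
Qed.
Lemma semistable_ar_inv Z X : ar_translate Z X -> semistable X -> semistable Z.
Proof.
move=> t [d _]; apply: semistable_indec; first exact: ar_indecl t.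
by rewrite (defect_ar hQ t).
Qed.

(* A stable sub [S'] of [tau Z] and a stable quotient [S1] of it satisfy
   [tau^- S' ->> Z >-> tau^- S1]; the composite is nonzero, so [S' = S1], and being a
   nonzero endomorphism of a brick it is invertible, so [S' = tau Z]. *)
Lemma stable_ar Z X : ar_translate Z X -> stable Z -> stable X.
Proof.
move=> t hZ; have [nZ sZ _] := hZ; have sX := semistable_ar t sZ.
have nX : ~ is_zero X by case: (ar_indecr t).
have [S' [i [hS' mi]]] := stable_subobject sX nX.
have [S1 [q [hS1 eq]]] := stable_quotient sX nX.
have [Z'' t''] : exists Z'', ar_translate Z'' S'.
  by apply: (ar_inv_exists (hQ := hQ) (stable_indec hS')); case: hS' => _ [-> _].
have [Z1 t1] : exists Z1, ar_translate Z1 S1.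
  by apply: (ar_inv_exists (hQ := hQ) (stable_indec hS1)); case: hS1 => _ [-> _].
have sZ'' : semistable Z'' by apply: semistable_ar_inv t'' _; case: hS'.
have sZ1 : semistable Z1 by apply: semistable_ar_inv t1 _; case: hS1.
have [p p0] : exists p : hom Z'' Z, p <> hzero _ _.
  by apply/(ar_hom_neq0 t'' t); exists i; apply: mono_neq0 => //; case: hS'.
have [m m0] : exists m : hom Z Z1, m <> hzero _ _.
  by apply/(ar_hom_neq0 t t1); exists q; apply: epi_neq0 => //; case: hS1.
have ep := stable_epi hZ sZ'' p0; have mm := stable_mono hZ sZ1 m0.
have mp0 := epi_comp_neq0 ep m0.
have [g g0] : exists g : hom S' S1, g <> hzero _ _.
  by apply/(ar_hom_neq0 t'' t1); exists (hcomp m p).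
have iS := iso_intro (stable_schur hS' hS1 g0).
have t1' := ar_translate_iso (iso_refl Z1) (iso_sym iS) t1.
have /isoP [phi iphi] := ar_unique_r t1' t''.
have [mphi _] := iphi.
have nZ'' : ~ is_zero Z'' by case: (ar_indecl t'').
(* [Z''] is not yet known to be stable, but Serre duality applied twice gives End(Z'') the dimension
   of End(S'). *)
have h1 : hd Z'' Z'' = 1%N.
  by rewrite (serre_dim_r t'') -(serre_dim_l t'') stable_hd.
have [mc _] := hd1_iso nZ'' h1 (mono_comp_neq0 mphi mp0).
have ip : is_iso p by split=> //; apply: mono_compr (mono_compr mc).
have t2 := ar_translate_iso (iso_intro ip) (iso_refl S') t''.
exact: stable_iso (ar_unique_l t2 t) hS'.
Qed.

(** The translate of a stable subobject [S'] of [Z] is stable and maps nontrivially to [X], so it is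
    [X] by Schur, and uniqueness of the inverse translate identifies [S'] with [Z]. *)
Lemma stable_ar_inv Z X : ar_translate Z X -> stable X -> stable Z.
Proof.
move=> t hX; have [nX sX _] := hX; have sZ := semistable_ar_inv t sX.
have nZ : ~ is_zero Z by case: (ar_indecl t).
have [S' [i [hS' mi]]] := stable_subobject sZ nZ.
have [Y t'] : exists Y, ar_translate S' Y.
  by apply: (ar_exists (hQ := hQ) (stable_indec hS')); case: hS' => _ [-> _].
have [g g0] : exists g : hom Y X, g <> hzero _ _.
  by apply/(ar_hom_neq0 t' t); exists i; apply: mono_neq0 => //; case: hS'.
have iS := iso_intro (stable_schur (stable_ar t' hS') hX g0).
have t2 := ar_translate_iso (iso_refl S') iS t'.
exact: stable_iso (ar_unique_r t2 t) hS'.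
Qed.

Lemma stable_tau S : stable S -> exists T, ar_translate S T /\ stable T.
Proof.
move=> hS; have [T t] : exists T, ar_translate S T.
  by apply: (ar_exists (hQ := hQ) (stable_indec hS)); case: hS => _ [-> _].
by exists T; split=> //; apply: stable_ar t hS.
Qed.

Definition tube p (R : 'I_p -> rep) :=
  [/\ forall i, stable (R i), forall i j, iso (R i) (R j) -> i = j
    & forall i, ar_translate (R i) (R (ord_pred i))].

(** Defect 0 makes the dimension vectors of the [tau]-orbit repeat; a repetition up to isomorphism
    follows, and the rank is the least period. *)
Lemma stable_tube S : stable S -> exists p (R : 'I_p -> rep) i, tube R /\ iso S (R i).
Proof.
move=> hS.
have [|s [s0 sP]] := @dependent_sequence _ stable (fun Z X => ar_translate Z X) _ S hS.
  by move=> Z /stable_tau [T [t hT]]; exists T.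
have sS m : stable (s m) by case: (sP m).
have sA m : ar_translate (s m) (s m.+1) by case: (sP m).
have down a b : iso (s a.+1) (s b.+1) -> iso (s a) (s b).
  move=> h; exact: ar_unique_r (ar_translate_iso (iso_refl _) h (sA a)) (sA b).
have down0 a b : iso (s a) (s (a + b)%N) -> iso (s 0%N) (s b).
  by elim: a => // a IH; rewrite addSn => /down.
have [m1 [m2 [lt e]]] : exists m1 m2, (m1 < m2)%N /\ iso (s m1) (s m2).
  have [||m1 [m2 [lt e]]] := @defect0_periodic F Q hQ s; first by case: (sS 0%N) => _ [].
    exact: sA.
  (* Equal dimension vectors alone do not give an isomorphism. With a self-extension, Serre duality
     makes [s m1] isomorphic to its translate; without one, the Euler form of [s m2] against [s m1]
     is 1 and produces a nonzero morphism. *)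
  have [z|nz] := pselect (Ext1_zero (s m1) (s m1)); last first.
    exists m1, m1.+1; split=> //.
    have [f f0] : exists f : hom (s m1) (s m1.+1), f <> hzero _ _.
      by apply: contrapT => /forallNP no; apply/nz/(serre_l _ (sA m1)) => f; apply: contrapT.
    exact: iso_intro (stable_schur (sS _) (sS _) f0).
  exists m1, m2; split=> //; apply: iso_sym.
  have [f f0] : exists f : hom (s m2) (s m1), f <> hzero _ _.
    apply: hd_gt0P; have := eulerE (s m1) (s m1); rewrite {1}e eulerE stable_hd //.
    by have /ed_eq0 -> := z; lia.
  exact: iso_intro (stable_schur (sS _) (sS _) f0).
have [|p [[p0 pP] pmin]] := @min_nat (fun d => (0 < d)%N /\ iso (s 0%N) (s d)).
  by exists (m2 - m1)%N; rewrite subn_gt0; split=> //; apply: (down0 m1); rewrite subnKC // ltnW.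
case: p p0 pP pmin => // p _ pP pmin.
(* [s] runs along [tau], whereas [tau] lowers the index of [R]; the orbit is listed backwards and
   [S] gets the last index. *)
exists p.+1, (fun i => s (p - i)%N), ord_max; split; last by rewrite /= subnn s0; apply: iso_refl.
split=> // [i j|i].
  have aux (a b : nat) : (a < b)%N -> (b <= p)%N -> ~ iso (s a) (s b).
    move=> lt' le h; have := pmin (b - a)%N; rewrite subn_gt0 => /(_ _) H.
    have : (p < b - a)%N by apply: H; split=> //; apply: (down0 a); rewrite subnKC // ltnW.
    by lia.
  move=> h; apply: val_inj => /=; have := ltn_ord i; have := ltn_ord j.
  case: (ltngtP (i : nat) j) => // lt' hi hj; exfalso.
    by apply: (@aux (p - j)%N (p - i)%N); rewrite ?leq_subr //; try lia; apply: iso_sym.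
  by apply: (@aux (p - i)%N (p - j)%N); rewrite ?leq_subr //; try lia.
case: i => -[|i] /= lt'.
  rewrite subn0 modn_small // subnn.
  apply: ar_translate_iso (iso_refl _) _ (sA p); exact: iso_sym.
rewrite modnDr modn_small 1?ltnW //.
have -> : (p - i = (p - i.+1).+1)%N by lia.
exact: sA.
Qed.

(* The quasi-simples of a tube of rank [p], listed along [tau^-]. *)
Definition ladder p (s : nat -> rep) :=
  [/\ (0 < p)%N, forall b, stable (s b), forall b, ar_translate (s b.+1) (s b)
    & forall a b, iso (s a) (s b) <-> a = b %[mod p]].

(** The start is one step below [i]: [R i] sits at position 1, so that its translate also has a
    natural number as position. *)
Definition tube_seq p (R : 'I_p -> rep) i b : rep := R (iter b (@ordS p) (ord_pred i)).

Lemma tube_ladder p (R : 'I_p -> rep) i : tube R -> ladder p (tube_seq R i).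
Proof.
move=> [sR jR aR]; have p0 : (0 < p)%N by apply: leq_ltn_trans (ltn_ord i).
split=> // [b|b|a b]; first by rewrite /tube_seq.
  by rewrite /tube_seq /= -{2}(ordSK (iter b (@ordS p) (ord_pred i))).
have vE c (x : 'I_p) : val (iter c (@ordS p) x) = ((x + c) %% p)%N.
  elim: c => [|c IH] /=; first by rewrite addn0 modn_small.
  by move: IH => /= ->; rewrite -addn1 modnDml addn1 addnS.
rewrite /tube_seq; split=> [/jR/(congr1 val)|/eqP e].
  by rewrite !vE => /eqP; rewrite eqn_modDl => /eqP.
rewrite (_ : iter a _ _ = iter b (@ordS p) (ord_pred i)); first exact: iso_refl.
by apply: val_inj; rewrite !vE; apply/eqP; rewrite eqn_modDl.
Qed.

Lemma tube_seq1 p (R : 'I_p -> rep) i : tube_seq R i 1 = R i.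
Proof. by rewrite /tube_seq /= ord_predK. Qed.

End Tubes.

(** * Uniserial regular representations *)

Section Uniserial.
Variables (F : fieldType) (eigF : has_eigenvectors F) (Q : quiver) (hQ : affine_quiver Q).
Local Notation rep := (rep F Q).
Local Notation df := (defect hQ).
Local Notation stable := (stable hQ).
Local Notation semistable := (semistable hQ).
Implicit Types (A B C D E K L M N S T U V X Y Z W : rep).

Definition factors M N X (f : hom M X) (g : hom N X) := exists k, hcomp g k = f.

Lemma factorsP M N X (f : hom M X) (g : hom N X) : mono g ->
  factors f g <-> forall v x, exists y, g v y = f v x.
Proof.
move=> mg; split=> [[k <-] v x|]; last exact: factor_mono.
by exists (k v x); rewrite hcompE.
Qed.

(** Only semistable subobjects are compared: this is uniseriality inside the abelian category of
    regular representations. *)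
Definition uniserial X := semistable X /\ forall U W (i : hom U X) (j : hom W X),
  mono i -> mono j -> semistable U -> semistable W -> factors i j \/ factors j i.

Lemma uniserial_sub U X (i : hom U X) : uniserial X -> mono i -> semistable U -> uniserial U.
Proof.
move=> [sX h] mi sU; split=> // A B a b ma mb sA sB.
have := h _ _ _ _ (mono_comp mi ma) (mono_comp mi mb) sA sB.
case=> -[k e]; [left|right]; exists k; apply: hom_ext => v x; apply: mi.
  by rewrite -(hcompE i) hcompA e hcompE.
by rewrite -(hcompE i) hcompA e hcompE.
Qed.

Lemma uniserial_quot X C (q : hom X C) : uniserial X -> epi q -> semistable C -> uniserial C.
Proof.
move=> [sX h] eq sC; split=> // A B a b ma mb sA sB.
have [K [k s]] := epi_ker eq; have [mk _ x] := s.
have sK := semistable_kernel sX sC mk x.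
have [A' [i [l [p [mi sl _ e]]]]] := pullback_mono s ma.
have [B' [j [l' [p' [mj sl' _ e']]]]] := pullback_mono s mb.
have [_ ep _] := sl; have [_ ep' _] := sl'.
have := h _ _ _ _ mi mj (semistable_ext sl sK sA) (semistable_ext sl' sK sB).
case=> -[f fE]; [left; apply/(factorsP _ mb)|right; apply/(factorsP _ ma)] => v y.
  have [z <-] := ep v y; exists (p' v (f v z)).
  by rewrite -(hcompE b) -e' hcompE -(hcompE j) fE -(hcompE q) e hcompE.
have [z <-] := ep' v y; exists (p v (f v z)).
by rewrite -(hcompE a) -e hcompE -(hcompE i) fE -(hcompE q) e' hcompE.
Qed.

Lemma uniserial_iso X Y : iso X Y -> uniserial X -> uniserial Y.
Proof.
move=> h u; have /isoP [f [_ ef]] := h; apply: (uniserial_quot u ef).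
by apply: (semistable_iso h); case: u.
Qed.

Lemma stable_uniserial S : stable S -> uniserial S.
Proof.
move=> [nS sS h]; split=> // A B a b ma mb sA sB.
have [dA _] := sA; have [z|[_ ea]] := h A a ma dA; [left|right].
  by apply/(factorsP _ mb) => v x; exists 0; rewrite (iffLR (is_zeroP _) z v x) !lf0.
by apply/(factorsP _ ma) => v x; apply: ea.
Qed.

(** A semistable subobject lies in [U] or maps onto [T], and in the second case it is everything.
    Indeed some [f : U -> tau T] carries [c] to an almost split class, and [f] cannot vanish on the
    intersection with [U]; as the kernel of [f] is a maximal semistable subobject of the uniserial
    [U], that intersection is [U]. *)
Lemma uniserial_ext_top U T (c : coc T U) : uniserial U -> stable T -> ~ cobound c ->
  uniserial (ext_rep c).
Proof.
move=> uU hT nc; have [sU hU] := uU; have [_ sT _] := hT.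
have s := ext_ses c; have [mu ee x] := s.
have sE := semistable_ext s sU sT; split=> //.
have key W (j : hom W (ext_rep c)) : mono j -> semistable W ->
    factors j (ext_in c) \/ epi j.
  move=> mj sW; have [e0|e0] := pselect (hcomp (ext_out c) j = hzero W T).
    left; apply/(factorsP _ mu) => v w; apply/x.
    by rewrite -hcompE e0 hzeroE.
  right; have ej := stable_epi hT sW e0.
  have [L [l [ml xl]]] := kernel (hcomp (ext_out c) j).
  have sL := semistable_kernel sW sT ml xl.
  have [|g gE] := factor_mono (g := hcomp j l) mu.
    move=> v y; apply/x; rewrite hcompE -(hcompE (ext_out c)); apply/xl; by exists y.
  have mg : mono g by apply: (@mono_compr _ _ _ _ _ (ext_in c)); rewrite gE; apply: mono_comp.
  have [Y [t hY]] := stable_tau eigF hT; have [_ sY _] := hY.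
  have /ar_translateP [d arc] := t; have [nd _ _] := arc.
  have [f fE] := ar_coc_push arc nc.
  have npf : ~ cobound (push f c) by move/(cobound_addl fE).
  (* [U] and [W] together span the extension and meet in [L]. If [f] vanished on [L], setting it to
     0 on [W] would extend it over the extension and split [push f c]. *)
  have fg0 : hcomp f g <> hzero L Y.
    move=> fg; apply: npf; apply/ext_in_factor.
    have [D [iU [pU [iW [pW bp]]]]] := dsum U W; have [eU eW eD] := bp.
    have [h1 h2] := biprod_comp0 bp.
    pose a := hlin 1 (hcomp (ext_in c) pU) (hcomp j pW).
    have aE v z : a v z = ext_in c v (pU v z) + j v (pW v z).
      by rewrite hlinE scale1r !hcompE.
    have [||k kE] := @factor_epi _ _ _ _ _ a (hcomp f pU).
    - move=> v y; have [w wE] := ej v (ext_out c v y).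
      have [u uE] : exists u, ext_in c v u = y - j v w.
        by apply/x; rewrite lfB -(hcompE _ j) wE subrr.
      exists (iU v u + iW v w); rewrite aE !lfD h1 h2 !lf0 -(hcompE pU) -(hcompE pW) eU eW !hidE.
      by rewrite addr0 add0r uE subrK.
    - move=> v z; rewrite aE => /eqP; rewrite addrC addr_eq0 => /eqP e.
      have [y yE] : exists y, l v y = pW v z.
        apply/xl; rewrite hcompE e lfN (_ : ext_out c v _ = 0) ?oppr0 //.
        by apply/x; exists (pU v z).
      have : pU v z = - g v y.
        by apply: mu; rewrite lfN -(hcompE _ g) gE hcompE yE e opprK.
      by rewrite hcompE => ->; rewrite lfN -hcompE fg hzeroE oppr0.
    exists k; apply: hom_ext => v u.
    have -> : hcomp k (ext_in c) v u = hcomp k a v (iU v u).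
      by rewrite !hcompE aE h2 lf0 addr0 -(hcompE pU) eU hidE.
    by rewrite kE hcompE -(hcompE pU) eU hidE.
  have efg := stable_epi hY sL fg0.
  have [U' [k [mk xk]]] := kernel f.
  have sU' := semistable_kernel sU sY mk xk.
  (* [L] is comparable with the kernel of [f] and not contained in it, so it contains it; since it
     also maps onto [tau T], it is [U]. *)
  have eg : epi g.
    case: (hU _ _ _ _ mg mk sL sU') => -[h hE].
      case: fg0; rewrite -hE; apply: hom_ext => v y; rewrite hzeroE !hcompE.
      by apply/xk; exists (h v y).
    move=> v u; have [y yE] := efg v (f v u).
    have [z zE] : exists z, k v z = u - g v y.
      by apply/xk; rewrite lfB -(hcompE f) yE subrr.
    by exists (h v z + y); rewrite lfD -hcompE hE zE subrK.
  move=> v z; have [w wE] := ej v (ext_out c v z).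
  have [u uE] : exists u, ext_in c v u = z - j v w.
    by apply/x; rewrite lfB -(hcompE _ j) wE subrr.
  have [y yE] := eg v u; exists (l v y + w).
  by rewrite lfD -(hcompE j) -gE hcompE yE uE subrK.
move=> A B a b ma mb sA sB.
case: (key _ _ ma sA) => [fa|ea]; last first.
  by right; apply/(factorsP _ ma) => v w; apply: ea.
case: (key _ _ mb sB) => [fb|eb]; last first.
  by left; apply/(factorsP _ mb) => v w; apply: eb.
have [a' aE] := fa; have [b' bE] := fb.
have ma' : mono a' by apply: (@mono_compr _ _ _ _ _ (ext_in c)); rewrite aE.
have mb' : mono b' by apply: (@mono_compr _ _ _ _ _ (ext_in c)); rewrite bE.
case: (hU _ _ _ _ ma' mb' sA sB) => -[k kE]; [left|right]; exists k.
  by rewrite -bE -hcompA kE.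
by rewrite -aE -hcompA kE.
Qed.

(** Every nonzero semistable subobject contains [T]. Otherwise it embeds in [U] and there contains
    the image of the inverse translate of [T] under a map [g] along which [c] stays non-split; this
    would lift [g] to the extension. *)
Lemma uniserial_ext_socle U T (c : coc U T) : uniserial U -> stable T -> ~ cobound c ->
  uniserial (ext_rep c).
Proof.
move=> uU hT nc; have [sU hU] := uU; have [_ sT hT'] := hT.
have s := ext_ses c; have [mt ee x] := s.
have sE := semistable_ext s sT sU; split=> //.
have [Z t] : exists Z, ar_translate Z T.
  by apply: (ar_inv_exists (hQ := hQ) (stable_indec hT)); case: sT => ->.
have hZ := stable_ar_inv eigF t hT; have [nZ sZ hZ'] := hZ.
have /ar_translateP [d arc] := t; have [nd _ _] := arc.
have [g gE] := ar_coc_pull arc nc.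
have npg : ~ cobound (pull c g) by move/(cobound_addl gE).
have g0 : g <> hzero Z U.
  move=> e; apply: npg; rewrite e (_ : pull _ _ = 0); first exact: cobound0.
  by apply: coc_ext => a z; rewrite !cocE hzeroE lf0.
have mg := stable_mono hZ sU g0.
have nolift : ~ exists k, hcomp (ext_out c) k = g by move/ext_out_factor.
have key W (j : hom W (ext_rep c)) : mono j -> semistable W -> ~ is_zero W ->
    factors (ext_in c) j.
  move=> mj sW nW; have [L [l [ml xl]]] := kernel (hcomp (ext_out c) j).
  have sL := semistable_kernel sW sU ml xl.
  have [|h hE] := factor_mono (g := hcomp j l) mt.
    move=> v y; apply/x; rewrite hcompE -(hcompE (ext_out c)); apply/xl; by exists y.
  have mh : mono h by apply: (@mono_compr _ _ _ _ _ (ext_in c)); rewrite hE; apply: mono_comp.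
  have [dL _] := sL; have [zL|[_ eh]] := hT' L h mh dL; last first.
    apply/(factorsP _ mj) => v z; have [y <-] := eh v z; exists (l v y).
    by rewrite -!hcompE hE.
  have mej : mono (hcomp (ext_out c) j).
    by apply: mono0 => v w /xl [y <-]; rewrite (iffLR (is_zeroP _) zL v y) lf0.
  exfalso; apply: nolift; case: (hU _ _ _ _ mg mej sZ sW) => -[k kE].
    by exists (hcomp j k); rewrite hcompA.
  have mk : mono k by apply: (@mono_compr _ _ _ _ _ g); rewrite kE.
  have [dW _] := sW; have [//|ik] := hZ' W k mk dW.
  have [k' [_ kk']] := iso_inverse ik; exists (hcomp j k').
  by rewrite hcompA -kE -hcompA kk' hcomp_idr.
move=> A B a b ma mb sA sB.
have [zA|nA] := pselect (is_zero A).
  by left; apply/(factorsP _ mb) => v w; exists 0; rewrite (iffLR (is_zeroP _) zA v w) !lf0.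
have [zB|nB] := pselect (is_zero B).
  by right; apply/(factorsP _ ma) => v w; exists 0; rewrite (iffLR (is_zeroP _) zB v w) !lf0.
have [I [p [m [ep mm fE]]]] := image (hcomp (ext_out c) a).
have [J [q [n [eq mn fE']]]] := image (hcomp (ext_out c) b).
have sI := semistable_image sA sU ep mm; have sJ := semistable_image sB sU eq mn.
have aux A1 B1 I1 J1 (a1 : hom A1 (ext_rep c)) (b1 : hom B1 (ext_rep c)) (p1 : hom A1 I1)
    (m1 : hom I1 U) (q1 : hom B1 J1) (n1 : hom J1 U) : mono b1 -> factors (ext_in c) b1 ->
    epi q1 -> hcomp m1 p1 = hcomp (ext_out c) a1 -> hcomp n1 q1 = hcomp (ext_out c) b1 ->
    factors m1 n1 -> factors a1 b1.
  move=> mb1 ft eq1 e1 e2 [k kE]; apply/(factorsP _ mb1) => v y.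
  have [w wE] := eq1 v (k v (p1 v y)).
  have [z zE] : exists z, ext_in c v z = a1 v y - b1 v w.
    by apply/x; rewrite lfB -!hcompE -e1 -e2 !hcompE wE -!hcompE kE subrr.
  have /(factorsP _ mb1)/(_ v z) [u uE] := ft.
  by exists (u + w); rewrite lfD uE zE subrK.
case: (hU _ _ _ _ mm mn sI sJ) => h; [left|right].
  exact: (aux _ _ _ _ a b p m q n mb (key _ _ mb sB nB) eq fE fE' h).
exact: (aux _ _ _ _ b a q n p m ma (key _ _ ma sA nA) ep fE' fE h).
Qed.

Lemma ext_push_map A B B' (r : hom B B') (c : coc A B) :
  exists m : hom (ext_rep c) (ext_rep (push r c)), forall v p, m v p = (r v p.1, p.2).
Proof.
pose m v (p : (B v * A v)%type) : (B' v * A v)%type := (r v p.1, p.2).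
have ml v : linear (@m v) by move=> k y z; rewrite /m -[(k *: y + z).1]/(k *: y.1 + z.1) lfD lfZ.
have mP a y : (linfun (@m (tgt a)) : 'Hom(ext_rep c _, ext_rep (push r c) _)) (rmap (ext_rep c) a y)
    = rmap (ext_rep (push r c)) a ((linfun (@m (src a)) : 'Hom(ext_rep c _, _)) y).
  by rewrite !ext_rmapE !(linfun_linearE (@ml _)) /m /= pushE lfD homE.
exists (@mkhom _ _ (ext_rep c) (ext_rep (push r c)) (fun v => linfun (@m v)) mP) => v p.
by rewrite /= (linfun_linearE (@ml _)).
Qed.

Lemma ext_pull_map A A' B (s : hom A' A) (c : coc A B) :
  exists m : hom (ext_rep (pull c s)) (ext_rep c), forall v p, m v p = (p.1, s v p.2).
Proof.
pose m v (p : (B v * A' v)%type) : (B v * A v)%type := (p.1, s v p.2).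
have ml v : linear (@m v) by move=> k y z; rewrite /m -[(k *: y + z).2]/(k *: y.2 + z.2) lfD lfZ.
have mP a y : (linfun (@m (tgt a)) : 'Hom(ext_rep (pull c s) _, ext_rep c _))
      (rmap (ext_rep (pull c s)) a y)
    = rmap (ext_rep c) a ((linfun (@m (src a)) : 'Hom(ext_rep (pull c s) _, _)) y).
  by rewrite !ext_rmapE !(linfun_linearE (@ml _)) /m /= pullE homE.
exists (@mkhom _ _ (ext_rep (pull c s)) (ext_rep c) (fun v => linfun (@m v)) mP) => v p.
by rewrite /= (linfun_linearE (@ml _)).
Qed.

Lemma pushout_epi K X C (k : hom K X) (q : hom X C) T (r : hom K T) : ses k q -> epi r ->
  exists X2 (pi : hom X X2) (t : hom T X2) (q2 : hom X2 C),
    [/\ epi pi, ses t q2, hcomp pi k = hcomp t r & hcomp q2 pi = q].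
Proof.
move=> s er; have [mk eq x] := s; have [L [l sl]] := epi_ker er; have [ml _ xl] := sl.
have [X2 [pi sp]] := mono_coker (mono_comp mk ml); have [_ ep xp] := sp.
have [|t tE] := factor_epi (g := hcomp pi k) er.
  by move=> v y /xl [z <-]; rewrite hcompE; apply/xp; exists z; rewrite hcompE.
have [|q2 q2E] := factor_epi (g := q) ep.
  by move=> v y /xp [z <-]; rewrite hcompE; apply/x; eexists.
exists X2, pi, t, q2; split=> //; split.
- apply: mono0 => v y; have [z <-] := er v y; rewrite -(hcompE t) tE hcompE => /xp [w].
  rewrite hcompE => /mk <-; by apply/xl; exists w.
- by apply: (@epi_compl _ _ _ _ _ _ pi); rewrite q2E.
move=> v y; have [z <-] := ep v y; rewrite -(hcompE q2) q2E; split=> [/x [w <-]|[u uE]].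
  by exists (r v w); rewrite -!hcompE tE.
have [w wu] := er v u; rewrite -q2E hcompE -uE -wu -(hcompE t) tE hcompE -(hcompE q2) q2E.
by apply/x; exists w.
Qed.

Definition subquotient M U := exists A (a : hom A M) (b : hom A U),
  [/\ mono a, epi b & semistable A].

Lemma subquotient_tdim M U : subquotient M U -> (tdim U <= tdim M)%N.
Proof. by move=> [A [a [b [/mono_tdim h1 /epi_tdim h2 _]]]]; apply: leq_trans h2 h1. Qed.

Lemma uniserial_indec X : uniserial X -> ~ is_zero X -> indecomposable X.
Proof.
move=> [[d0 sX] hX] nX; apply: contrapT => nd.
have [A [B [iA [pA [iB [pB [bp nA nB]]]]]]] := decomposable nX nd.
have s := biprod_ses bp; have s' := biprod_ses (biprod_sym bp).
have [mA eB _] := s; have [mB eA _] := s'; have [h1 h2] := biprod_comp0 bp.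
have := defect_ses hQ s; have := sX _ _ mA; have := sX _ _ mB; rewrite d0 => dA dB dAB.
have [eqA eqB _] := bp.
have sA : semistable A by apply: (semistable_sub (X := X) _ mA) => //; lia.
have sB : semistable B by apply: (semistable_sub (X := X) _ mB) => //; lia.
case: (hX _ _ _ _ mA mB sA sB) => -[k kE].
  apply: nA; apply/is_zeroP => v x; rewrite -[x]hidE -eqA hcompE -kE hcompE.
  exact: h1.
apply: nB; apply/is_zeroP => v x; rewrite -[x]hidE -eqB hcompE -kE hcompE.
exact: h2.
Qed.

(* A uniserial subquotient [U] of maximal dimension splits off: extending a retraction
   onto [U], or a section, by one more stable factor is obstructed by a nonsplit
   extension of [U], that is by a larger uniserial subquotient. *)
Lemma indec_uniserial M : indecomposable M -> semistable M -> uniserial M.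
Proof.
move=> iM sM; have nM : ~ is_zero M by case: iM.
have [||n [[U [uU qU tU]] mU]] := @max_nat (fun n => exists U,
  [/\ uniserial U, subquotient M U & tdim U = n]) (tdim M).
- have [S [i [hS mi]]] := stable_subobject sM nM; exists (tdim S), S; split=> //.
    exact: stable_uniserial.
  by exists S, i, (hid S); split=> //; [apply: epi_id|case: hS].
- by move=> n [U [_ h <-]]; apply: subquotient_tdim.
have maxU V : uniserial V -> subquotient M V -> (tdim V <= tdim U)%N.
  by move=> uV qV; rewrite tU; apply: mU; exists V.
have nU : ~ is_zero U.
  have [S [i [hS mi]]] := stable_subobject sM nM; move=> z.
  have : (tdim S <= tdim U)%N.
    apply: maxU; first exact: stable_uniserial.
    by exists S, i, (hid S); split=> //; [apply: epi_id|case: hS].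
  by move/is_zero_tdim: z => ->; case: hS => /tdim_gt0; lia.
have [sU _] := uU.
have [A [a [b [ma eb sA]]]] := qU.
(* [U] is a quotient of the subobject [A], hence a subobject of [M] modulo the kernel [K]; a
   retraction onto it is extended over larger and larger semistable subobjects of that quotient. *)
have [pi epi_pi] : exists pi : hom M U, epi pi.
  have [K [k sk]] := epi_ker eb; have [mk _ xk] := sk.
  have sK := semistable_kernel sA sU mk xk; have [dK _] := sK.
  have [C [q sq]] := mono_coker (mono_comp ma mk); have [_ eq xq] := sq.
  have sC := semistable_quotient sq sM dK.
  have [|iota iotaE] := factor_epi (g := hcomp q a) eb.
    by move=> v y /xk [z <-]; rewrite hcompE; apply/xq; exists z; rewrite hcompE.
  have miota : mono iota.
    apply: mono0 => v y; have [z <-] := eb v y; rewrite -(hcompE iota) iotaE hcompE => /xq [w].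
    by rewrite hcompE => /ma <-; apply/xk; exists w.
  have [||m [[V [j [i [r [mj sV jiE riE tV]]]] mV]]] := @max_nat (fun m => exists V,
    exists j : hom V C, exists i : hom U V, exists r : hom V U,
    [/\ mono j, semistable V, hcomp j i = iota, hcomp r i = hid U & tdim V = m]) (tdim C).
  - by exists (tdim U), U, iota, (hid U), (hid U); rewrite hcomp_idr hcomp_idl.
  - by move=> m [V [j [i [r [mj _ _ _ <-]]]]]; apply: mono_tdim mj.
  have [ij|nij] := pselect (is_iso j).
    have [j' [j'j jj']] := iso_inverse ij.
    exists (hcomp (hcomp r j') q); apply: epi_comp => //; apply: epi_comp.
      by apply: (@epi_compl _ _ _ _ _ _ i); rewrite riE; apply: epi_id.
    by case: (inverse_iso jj' j'j).
  exfalso.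
  have [G [g sg]] := mono_coker mj; have [dV _] := sV.
  have sG := semistable_quotient sg sC dV.
  have nG : ~ is_zero G.
    move=> z; apply: nij; apply: mono_tdim_iso => //.
    by rewrite (ses_tdim sg) (iffLR (is_zero_tdim G) z) addn0.
  have [T [t [hT mt]]] := stable_subobject sG nG; have [nT sT _] := hT.
  have [V2 [j2 [l [p [mj2 slp e1 e2]]]]] := pullback_mono sg mt.
  have sV2 := semistable_ext slp sV sT.
  have [c [phi [iphi f1 f2]]] := ses_ext slp.
  have tV2 := ses_tdim slp; have := tdim_gt0 nT => tT.
  have [/ext_in_factor [r2 r2E]|nc] := pselect (cobound (push r c)).
    have : (tdim V2 <= m)%N.
      apply: mV; exists V2, j2, (hcomp l i), (hcomp r2 phi); split=> //.
        by rewrite hcompA e1.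
      by rewrite hcompA -(hcompA r2) f1 r2E.
    by lia.
  have [e eE] := ext_push_map r c.
  have er : epi r by apply: (@epi_compl _ _ _ _ _ _ i); rewrite riE; apply: epi_id.
  have ee : epi e.
    move=> v [y1 y2]; have [z zE] := er v y1; exists (z, y2); by rewrite eE /= zE.
  have := maxU _ (uniserial_ext_top uU hT nc); rewrite (ses_tdim (ext_ses _)) => h.
  suff /h : subquotient M (ext_rep (push r c)) by lia.
  have [A2 [i2 [l2 [p2 [mi2 sl2 _ _]]]]] := pullback_mono sq mj2.
  exists A2, i2, (hcomp e (hcomp phi p2)); split=> //; last exact: semistable_ext sl2 sK sV2.
  by apply: epi_comp => //; apply: epi_comp; [case: iphi|case: sl2].
(* Dually, a section of [pi] is lifted to larger and larger quotients [V] of [M] lying over [U]. *)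
have [||m [[V [q [p [s [eq sV pqE psE tV]]]] mV]]] := @max_nat (fun m => exists V,
  exists q : hom M V, exists p : hom V U, exists s : hom U V,
  [/\ epi q, semistable V, hcomp p q = pi, hcomp p s = hid U & tdim V = m]) (tdim M).
- by exists (tdim U), U, pi, (hid U), (hid U); rewrite hcomp_idl hcomp_idr.
- by move=> m [V [q [p [s [eq _ _ _ <-]]]]]; apply: epi_tdim eq.
have [iq|niq] := pselect (is_iso q).
  have [q' [_ qq']] := iso_inverse iq.
  have e : hcomp pi (hcomp q' s) = hid U by rewrite -pqE -hcompA (hcompA q) qq' hcomp_idl.
  have ipi := indec_retract iM nU e.
  exact: uniserial_iso (iso_intro ipi) uU.
exfalso.
have [L [l sl]] := epi_ker eq; have [ml _ xl] := sl.
have sL := semistable_kernel sM sV ml xl.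
have nL : ~ is_zero L.
  move=> z; apply: niq; apply: epi_tdim_iso => //.
  by rewrite (ses_tdim sl) (iffLR (is_zero_tdim L) z).
have [T [t [hT et]]] := stable_quotient sL nL; have [nT sT _] := hT.
have [V2 [q2 [l2 [p2 [eq2 sl2 e1 e2]]]]] := pushout_epi sl et.
have sV2 := semistable_ext sl2 sT sV.
have [c [phi [iphi f1 f2]]] := ses_ext sl2; have [psi [phi1 phi2]] := iso_inverse iphi.
have tV2 := ses_tdim sl2; have := tdim_gt0 nT => tT.
have [/ext_out_factor [s2 s2E]|nc] := pselect (cobound (pull c s)).
  have : (tdim V2 <= m)%N.
    apply: mV; exists V2, q2, (hcomp p p2), (hcomp psi s2); split=> //.
      by rewrite -hcompA e2.
    by rewrite -hcompA -f2 -hcompA (hcompA phi) phi2 hcomp_idl s2E.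
  by lia.
have [e eE] := ext_pull_map s c.
have ms : mono s by apply: (@mono_compr _ _ _ _ _ p); rewrite psE; apply: mono_id.
have me : mono e.
  move=> v y z; rewrite !eE => -[e3 /ms e4].
  by rewrite (surjective_pairing y) (surjective_pairing z) e3 e4.
have uE := uniserial_ext_socle uU hT nc.
have := maxU _ uE; rewrite (ses_tdim (ext_ses _)) => h.
suff /h : subquotient M (ext_rep (pull c s)) by lia.
have mpe : mono (hcomp psi e).
  by apply: mono_comp => //; case: (inverse_iso phi2 phi1).
have [K [k sk]] := epi_ker eq2; have [mk _ xk] := sk.
have sK := semistable_kernel sM sV2 mk xk.
have [A2 [i2 [l3 [p3 [mi2 sl3 _ _]]]]] := pullback_mono sk mpe.
exists A2, i2, p3; split=> //; first by case: sl3.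
by apply: semistable_ext sl3 sK _; case: uE.
Qed.

End Uniserial.

(** * Quasi-length *)

Section Lengths.
Variables (F : fieldType) (eigF : has_eigenvectors F) (Q : quiver) (hQ : affine_quiver Q).
Local Notation rep := (rep F Q).
Local Notation df := (defect hQ).
Local Notation stable := (stable hQ).
Local Notation semistable := (semistable hQ).
Local Notation uniserial := (uniserial hQ).
Implicit Types (A B C D E K L M N S T U V X Y Z W : rep).

Lemma stable_defect S : stable S -> df S = 0.
Proof. by case=> _ []. Qed.

Lemma uniserial_zero X : is_zero X -> uniserial X.
Proof.
move=> z; split; first exact: semistable_zero.
move=> U W i j mi mj _ _; left; apply/(factorsP _ mj) => v x; exists 0.
by rewrite (iffLR (is_zeroP _) (mono_zero mi z) v x) !lf0.
Qed.

Lemma uniserial_factor_le X U W (i : hom U X) (j : hom W X) : uniserial X -> mono i -> mono j ->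
  semistable U -> semistable W -> (tdim U <= tdim W)%N -> factors i j.
Proof.
move=> [sX hX] mi mj sU sW le; case: (hX _ _ _ _ mi mj sU sW) => // -[k kE].
have mk : mono k by apply: (@mono_compr _ _ _ _ _ i); rewrite kE.
have [_ ek] := mono_tdim_iso mk le.
by apply/(factorsP _ mj) => v x; have [y <-] := ek v x; exists y; rewrite -kE hcompE.
Qed.

Lemma uniserial_top X S S' (q : hom X S) (q' : hom X S') : uniserial X -> stable S -> stable S' ->
  epi q -> epi q' -> iso S S'.
Proof.
move=> [sX hX].
have aux S1 S2 (q1 : hom X S1) (q2 : hom X S2) K1 (k1 : hom K1 X) K2 (k2 : hom K2 X) :
    stable S1 -> stable S2 -> epi q1 -> epi q2 -> exact k1 q1 -> exact k2 q2 ->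
    factors k1 k2 -> iso S1 S2.
  move=> h1 h2 e1 e2 x1 x2 [f fE].
  have [|g gE] := factor_epi (g := q2) e1.
    by move=> v x /x1 [y <-]; rewrite -fE hcompE; apply/x2; eexists.
  apply: iso_intro (stable_schur h1 h2 (f := g) _).
  apply: epi_neq0; last by case: h2.
  by apply: (@epi_compl _ _ _ _ _ _ q1); rewrite gE.
move=> hS hS' eq eq'.
have [K [k [mk x]]] := kernel q; have [K' [k' [mk' x']]] := kernel q'.
have sK : semistable K by apply: semistable_kernel mk x => //; case: hS.
have sK' : semistable K' by apply: semistable_kernel mk' x' => //; case: hS'.
case: (hX _ _ _ _ mk mk' sK sK') => h; first exact: (aux _ _ q q' _ k _ k').
by apply: iso_sym; apply: (aux _ _ q' q _ k' _ k).
Qed.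

Variables (p : nat) (s : nat -> rep).
Hypothesis ls : ladder hQ p s.

Let sS b : stable (s b). Proof. by case: ls. Qed.
Let sA b : ar_translate (s b.+1) (s b). Proof. by case: ls. Qed.

(* [X] is uniserial with the regular composition factors [s b, ..., s (b + n - 1)], from the
   socle upwards. *)
Definition lenp b n X := [/\ uniserial X, dvz X = \sum_(i < n) dvz (s (b + i))
  & (0 < n)%N -> (exists i : hom (s b) X, mono i) /\ exists q : hom X (s (b + n.-1)), epi q].

(** The total dimension forced by the composition factors; it grows strictly with [n], so lengths
    can be compared through dimensions. *)
Definition lend b n := (\sum_(i < n) tdim (s (b + i)))%N.

Lemma lend_lt b m n : (m < n)%N -> (lend b m < lend b n)%N.
Proof.
elim: n => // n IH; rewrite ltnS leq_eqVlt /lend big_ord_recr /= => /orP [/eqP ->|/IH h].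
  by rewrite -[X in (X < _)%N]addn0 ltn_add2l; apply: tdim_gt0; case: (sS (b + n)).
exact: leq_trans h (leq_addr _ _).
Qed.

Lemma lend_le b m n : (lend b m <= lend b n)%N = (m <= n)%N.
Proof.
case: (leqP m n) => [|lt]; last by apply/negP; rewrite leqNgt lend_lt.
by rewrite leq_eqVlt => /orP [/eqP ->|/lend_lt h]; rewrite ?leqnn // ltnW.
Qed.

Lemma dvz_tdim X : (tdim X)%:Z = \sum_v dvz X v.
Proof. by rewrite /tdim sumz; apply: eq_bigr => v _; rewrite ffunE. Qed.

Lemma dvz_sum_tdim X b n : dvz X = \sum_(i < n) dvz (s (b + i)) -> tdim X = lend b n.
Proof.
move=> e; suff : (tdim X)%:Z = (lend b n)%:Z by case.
rewrite dvz_tdim /lend sumz.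
transitivity (\sum_(i < n) \sum_v dvz (s (b + i)) v); last first.
  by apply: eq_bigr => i _; rewrite dvz_tdim.
by rewrite exchange_big; apply: eq_bigr => v _; rewrite e sum_ffunE.
Qed.

Lemma lenp_tdim b n X : lenp b n X -> tdim X = lend b n.
Proof. by move=> [_ /dvz_sum_tdim]. Qed.

Lemma lend0 b : lend b 0 = 0%N. Proof. by rewrite /lend big_ord0. Qed.

Lemma lend_inj b m n : lend b m = lend b n -> m = n.
Proof. by move=> e; apply/eqP; rewrite eqn_leq -(lend_le b m n) -(lend_le b n m) e leqnn. Qed.

Lemma lenp_zero b X : is_zero X -> lenp b 0 X.
Proof.
move=> z; split=> //; first exact: uniserial_zero.
by rewrite big_ord0; apply/ffunP => v; rewrite !ffunE /dv z.
Qed.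

Lemma lenp_nonzero b n X : lenp b n X -> ~ is_zero X <-> (0 < n)%N.
Proof.
move/lenp_tdim => e; rewrite is_zero_tdim e; split=> [h|lt h].
  by rewrite lt0n; apply/eqP => n0; apply: h; rewrite n0 lend0.
by have := lend_lt b lt; rewrite h lend0.
Qed.

(** The preimage of a stable [T] in [C] is a non-split extension of [T] by [s b], by uniseriality;
    Serre duality turns it into a nonzero morphism [s b.+1 -> T], an isomorphism by Schur. *)
Lemma next_socle b X C (i : hom (s b) X) (c : hom X C) : uniserial X -> ses i c ->
  ~ is_zero C -> exists j : hom (s b.+1) C, mono j.
Proof.
move=> uX sic nC; have [mi ec x] := sic; have [sX hX] := uX.
have sC : semistable C by apply: semistable_quotient sic sX (stable_defect (sS b)).
have [T [t [hT mt]]] := stable_subobject sC nC; have [nT sT _] := hT.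
have [_ ssb _] := sS b.
have [W [j [l [r [mj slr jl cj]]]]] := pullback_mono sic mt.
have sW := semistable_ext slr ssb sT.
have nE : ~ Ext1_zero T (s b).
  move=> z; have /split_epiP [sg sgE] := z _ _ _ (iffRL (short_exactP _ _) slr).
  have msg : mono (hcomp j sg).
    by apply: mono_comp => //; apply: (@mono_compr _ _ _ _ _ r); rewrite sgE; apply: mono_id.
  have tE : hcomp c (hcomp j sg) = t by rewrite hcompA cj -hcompA sgE hcomp_idr.
  have ci v y : c v (i v y) = 0 by apply: ses_comp0 sic.
  case: (hX _ _ _ _ msg mi sT ssb) => -[k kE].
    apply: (mono_neq0 mt nT); rewrite -tE -kE; apply: hom_ext => v y.
    by rewrite !hcompE hzeroE ci.
  have k0 : k = hzero (s b) T.
    apply: hom_ext => v y; rewrite hzeroE; apply: (mono_eq0 mt).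
    by rewrite -(hcompE t) -tE -(hcompA c) kE hcompE ci.
  apply: (mono_neq0 mi); first by case: (sS b).
  by rewrite -kE k0; apply: hom_ext => v y; rewrite hcompE !hzeroE lf0.
have [f f0] : exists f : hom (s b.+1) T, f <> hzero _ _.
  by apply: contrapT => /forallNP no; apply/nE/(serre_r _ (sA b)) => f; apply: contrapT.
by exists (hcomp t f); apply: mono_comp => //; case: (stable_schur (sS _) hT f0).
Qed.

Lemma lenp_exists b X (i : hom (s b) X) : uniserial X -> mono i ->
  exists n, (0 < n)%N /\ lenp b n X.
Proof.
have [m] := ubnP (tdim X); elim: m b X i => // m IH b X i; rewrite ltnS => le uX mi.
have [C [c sic]] := mono_coker mi; have [_ ec x] := sic; have [sX hX] := uX.
have [zC|nC] := pselect (is_zero C).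
  have ii : is_iso i.
    by apply: mono_tdim_iso => //; rewrite (ses_tdim sic) (iffLR (is_zero_tdim C) zC) addn0.
  have [q [q1 q2]] := iso_inverse ii; exists 1%N; split=> //; split=> //.
    by rewrite big_ord1 addn0; apply: iso_dvz; apply: iso_sym; apply: iso_intro ii.
  move=> _; split; first by exists i.
  by rewrite /= addn0; exists q; case: (inverse_iso q2 q1).
have [j mj] := next_socle uX sic nC.
have sC : semistable C by apply: semistable_quotient sic sX (stable_defect (sS b)).
have uC := uniserial_quot uX ec sC.
have [|n [n0 [_ dC /(_ n0) [_ [q eq]]]]] := IH _ _ j _ uC mj.
  have [ns _ _] := sS b; have := ses_tdim sic; have := tdim_gt0 ns; lia.
exists n.+1; split=> //; split=> // [|_]; last first.
  split; first by exists i.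
  have e : (b + n.+1.-1 = b.+1 + n.-1)%N by rewrite /=; lia.
  by rewrite e; exists (hcomp q c); apply: epi_comp.
rewrite (ses_dvz sic) dC big_ord_recl addn0; congr (_ + _).
by apply: eq_bigr => k _; rewrite addSnnS.
Qed.

Lemma lenp_sub b n X U (i : hom U X) : lenp b n X -> mono i -> semistable U ->
  exists m, (m <= n)%N /\ lenp b m U.
Proof.
move=> lX mi sU; have [z|nU] := pselect (is_zero U).
  by exists 0%N; split=> //; apply: lenp_zero.
have [uX dX tX] := lX; have n0 : (0 < n)%N.
  by apply/(lenp_nonzero lX) => z; apply: nU; apply: mono_zero mi z.
have [[j mj] _] := tX n0; have [_ ssb _] := sS b; have [_ hX] := uX.
have [k mk] : exists k : hom (s b) U, mono k.
  case: (hX _ _ _ _ mi mj sU ssb) => -[k kE]; last first.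
    by exists k; apply: (@mono_compr _ _ _ _ _ i); rewrite kE.
  have mk : mono k by apply: (@mono_compr _ _ _ _ _ j); rewrite kE.
  have [_ _ hs] := sS b; have [dU _] := sU; have [//|ik] := hs _ _ mk dU.
  have [k' [k1 k2]] := iso_inverse ik; exists k'.
  by case: (inverse_iso k2 k1).
have [m [m0 lU]] := lenp_exists (uniserial_sub uX mi sU) mk.
exists m; split=> //; rewrite -(lend_le b) -(lenp_tdim lU) -(lenp_tdim lX).
exact: mono_tdim mi.
Qed.

Lemma lenp_coker_socle b n X C (i : hom (s b) X) (c : hom X C) : lenp b n.+1 X -> ses i c ->
  lenp b.+1 n C.
Proof.
move=> lX sic; have [uX dX _] := lX; have [mi ec x] := sic; have [sX _] := uX.
have sC : semistable C by apply: semistable_quotient sic sX (stable_defect (sS b)).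
have dC : dvz C = \sum_(k < n) dvz (s (b.+1 + k)).
  have := ses_dvz sic; rewrite dX big_ord_recl addn0 => /addrI <-.
  by apply: eq_bigr => k _; rewrite addSnnS.
have tC := dvz_sum_tdim dC.
have [z|nC] := pselect (is_zero C).
  have n0 : n = 0%N.
    by apply: (@lend_inj b.+1); rewrite -tC lend0; apply/is_zero_tdim.
  by rewrite n0; apply: lenp_zero.
have [j mj] := next_socle uX sic nC.
have [m [m0 lC]] := lenp_exists (uniserial_quot uX ec sC) mj.
by have -> // : n = m by apply: (@lend_inj b.+1); rewrite -tC (lenp_tdim lC).
Qed.

Lemma lenp_iso b n X Y : iso X Y -> lenp b n X -> lenp b n Y.
Proof.
move=> h [uX dX tX]; split; first exact: uniserial_iso h uX.
  by rewrite -(iso_dvz h).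
move=> n0; have [[i mi] [q eq]] := tX n0; have /isoP [f [mf _]] := h.
have /isoP [g [_ eg]] := iso_sym h.
by split; [exists (hcomp f i); apply: mono_comp|exists (hcomp q g); apply: epi_comp].
Qed.

(** Induction on [m], dividing [K] and [X] by their common socle, which raises [b] by one. *)
Lemma lenp_quot b n m X K C (k : hom K X) (q : hom X C) : lenp b n X -> lenp b m K ->
  ses k q -> lenp (b + m) (n - m) C.
Proof.
elim: m b n X K k q => [|m IH] b n X K k q lX lK skq; have [mk eq x] := skq.
  have zK : is_zero K by apply/is_zero_tdim; rewrite (lenp_tdim lK) lend0.
  rewrite addn0 subn0; apply: lenp_iso lX; apply: (iso_intro (f := q)).
  apply: epi_tdim_iso => //; rewrite (ses_tdim skq) (iffLR (is_zero_tdim K) zK); lia.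
have le : (m.+1 <= n)%N by rewrite -(lend_le b) -(lenp_tdim lX) -(lenp_tdim lK); apply: mono_tdim mk.
case: n lX le => // n lX _.
have [_ _ /(_ isT) [[i mi] _]] := lK.
have [K' [cK sK]] := mono_coker mi.
have [X' [cX sX]] := mono_coker (mono_comp mk mi).
have lK' := lenp_coker_socle lK sK; have lX' := lenp_coker_socle lX sX.
have [_ ecK xK] := sK; have [_ ecX xX] := sX.
have [|k' k'E] := factor_epi (g := hcomp cX k) ecK.
  by move=> v y /xK [z <-]; rewrite hcompE; apply/xX; exists z; rewrite hcompE.
have [|q' q'E] := factor_epi (g := q) ecX.
  by move=> v y /xX [z <-]; apply/x; exists (i v z); rewrite hcompE.
rewrite subSS -addSnnS; apply: (IH _ _ _ _ k' q' lX' lK').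
split.
- apply: mono0 => v y; have [z <-] := ecK v y; rewrite -(hcompE k') k'E hcompE => /xX [w].
  by rewrite hcompE => /mk <-; apply/xK; exists w.
- by apply: (@epi_compl _ _ _ _ _ _ cX); rewrite q'E.
move=> v y; have [z <-] := ecX v y; rewrite -(hcompE q') q'E; split=> [/x [w <-]|[w wE]].
  by exists (cK v w); rewrite -(hcompE k') k'E hcompE.
have [u uE] := ecK v w; rewrite -q'E hcompE -wE -uE -(hcompE k') k'E hcompE -(hcompE q') q'E.
by apply/x; exists u.
Qed.

Lemma lenp_exists_sub b n m X : lenp b n X -> (m <= n)%N ->
  exists U (i : hom U X), mono i /\ lenp b m U.
Proof.
elim: n X => [|n IH] X lX.
  by rewrite leqn0 => /eqP ->; exists X, (hid X); split=> //; apply: mono_id.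
rewrite leq_eqVlt => /orP [/eqP ->|]; first by exists X, (hid X); split=> //; apply: mono_id.
rewrite ltnS => le; have [uX dX /(_ isT) [_ [q eq]]] := lX; have [sX _] := uX.
have [K [k skq]] := epi_ker eq; have [mk _ x] := skq; have [_ ssq _] := sS (b + n.+1.-1).
have [m' [_ lK]] := lenp_sub lX mk (semistable_kernel sX ssq mk x).
have e : m' = n.
  apply: (@lend_inj b); rewrite -(lenp_tdim lK).
  by have := ses_tdim skq; rewrite (lenp_tdim lX) /lend big_ord_recr /= => /addIn.
rewrite e in lK; have [U [i [mi lU]]] := IH _ lK le.
by exists U, (hcomp k i); split=> //; apply: mono_comp.
Qed.

(** A uniserial representation has one stable quotient up to isomorphism, so every step of
    [quasi_length] removes the top factor of [lenp]. *)
Lemma quasi_length_lenp n X : quasi_length n X -> forall b m, lenp b m X -> n = m.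
Proof.
elim=> [{}X z|{}n {}X N rX _ IH /(quasi_simpleP hQ) hS] b m lX.
  by apply: (@lend_inj b); rewrite lend0 -(lenp_tdim lX); symmetry; apply/is_zero_tdim.
have sN := quot_ses N; have [mN eN xN] := sN; have [nS sQ _] := hS.
have [uX dX tX] := lX; have [sX _] := uX.
have [m' [_ lN]] := lenp_sub lX mN (semistable_kernel sX sQ mN xN).
have m0 : (0 < m)%N by apply/(lenp_nonzero lX) => z; apply: nS; apply: epi_zero eN z.
have [_ [q eq]] := tX m0.
have /iso_tdim tS := uniserial_top uX hS (sS _) eN eq.
rewrite (IH b m' lN); case: m lX m0 dX tX q eq tS => // m lX _ _ _ q eq tS; congr _.+1.
apply: (@lend_inj b); rewrite -(lenp_tdim lN).
by have := ses_tdim sN; rewrite (lenp_tdim lX) tS /lend big_ord_recr /= => /addIn ->.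
Qed.

Lemma lenp_quasi_length b n X : lenp b n X -> quasi_length n X.
Proof.
elim: n X => [|n IH] X lX.
  by apply: quasi_length0; apply/is_zero_tdim; rewrite (lenp_tdim lX) lend0.
have [uX dX /(_ isT) [_ [q eq]]] := lX; have [sX _] := uX; have [_ ssq _] := sS (b + n.+1.-1).
have sN := quot_ses (ker q); have [mN eN xN] := sN.
have xq : exact (sub_incl (ker q)) q by move=> v y; rewrite -sub_inclP -kerP.
have [|f fE] := factor_epi (g := q) eN.
  by move=> v y /xN/xq.
have i : iso (rep_quot (ker q)) (s (b + n.+1.-1)).
  apply: (iso_intro (f := f)); split.
    apply: mono0 => v y; have [z <-] := eN v y; rewrite -(hcompE f) fE => /xq h; exact/xN.
  by apply: (@epi_compl _ _ _ _ _ _ (quot_proj (ker q))); rewrite fE.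
have [m' [_ lN]] := lenp_sub lX mN (semistable_kernel sX ssq mN xq).
apply: (quasi_lengthS (N := ker q)); first exact/(regularP hQ).
  apply: IH; suff e : m' = n by rewrite e in lN.
  apply: (@lend_inj b); rewrite -(lenp_tdim lN).
  by have := ses_tdim sN; rewrite (lenp_tdim lX) (iso_tdim i) /lend big_ord_recr /= => /addIn.
by apply/(quasi_simpleP hQ); apply: stable_iso (iso_sym i) _.
Qed.

Lemma ray_rep_lenp b n X : ray_rep (s b) n X -> lenp b n X.
Proof.
rewrite /ray_rep; case: eqP => [->|_]; first exact: lenp_zero.
move=> [iX /(regularP hQ) sX qX [S [_ /iso_sym/isoP [f [mf _]]]]].
have [m [m0 lX]] := lenp_exists (indec_uniserial eigF iX sX) (mono_comp (@sub_incl_mono _ _ _ S) mf).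
by rewrite (quasi_length_lenp qX lX).
Qed.

Lemma lenp_ray_rep b n X : lenp b n X -> ray_rep (s b) n X.
Proof.
move=> lX; rewrite /ray_rep; case: eqP => [n0|/eqP n0].
  by apply/is_zero_tdim; rewrite (lenp_tdim lX) n0 lend0.
rewrite -lt0n in n0; have [uX dX /(_ n0) [[i mi] _]] := lX; have [sX hX] := uX.
have nX := iffRL (lenp_nonzero lX) n0.
split; [exact: uniserial_indec uX nX|exact/(regularP hQ)|exact: lenp_quasi_length lX|].
exists (img i); split; last exact: img_iso.
split=> [U /(quasi_simpleP hQ) hU|W hW]; last first.
  apply: hW; apply/(quasi_simpleP hQ); exact: stable_iso (iso_sym (img_iso mi)) (sS b).
have [nU sU hU'] := hU; have [_ ssb _] := sS b; have mU := @sub_incl_mono _ _ _ U.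
have [f [[_ ef] fE]] := mono_img mi.
have h : factors (sub_incl U) i.
  case: (hX _ _ _ _ mU mi sU ssb) => // -[k kE].
  have mk : mono k by apply: (@mono_compr _ _ _ _ _ (sub_incl U)); rewrite kE.
  have [z|[_ ek]] := hU' _ _ mk (stable_defect (sS b)); first by case: (sS b).
  by apply/(factorsP _ mi) => v x; have [y <-] := ek v x; exists y; rewrite -kE hcompE.
by apply/sub_leP; have [k kE] := h; exists (hcomp f k); rewrite hcompA fE.
Qed.

End Lengths.

(** * Auslander-Reiten components *)

Section Component.
Variables (F : fieldType) (eigF : has_eigenvectors F) (Q : quiver) (hQ : affine_quiver Q).
Local Notation rep := (rep F Q).
Local Notation df := (defect hQ).
Local Notation stable := (stable hQ).
Local Notation semistable := (semistable hQ).
Local Notation uniserial := (uniserial hQ).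
Implicit Types (A B C D E K L M N S T U V X Y Z W : rep).

Lemma stable_sub_unique X S S' (i : hom S X) (i' : hom S' X) : uniserial X ->
  stable S -> stable S' -> mono i -> mono i' -> iso S S'.
Proof.
move=> [_ hX] hS hS' mi mi'; have [nS sS _] := hS; have [nS' sS' _] := hS'.
case: (hX _ _ _ _ mi mi' sS sS') => -[k kE].
  have mk : mono k by apply: (@mono_compr _ _ _ _ _ i'); rewrite kE.
  exact: iso_intro (stable_schur hS hS' (mono_neq0 mk nS)).
have mk : mono k by apply: (@mono_compr _ _ _ _ _ i); rewrite kE.
by apply: iso_sym; apply: iso_intro (stable_schur hS' hS (mono_neq0 mk nS')).
Qed.

(** The kernel is semistable, so if nonzero it would contain the socle, on which [f] does not
    vanish. *)
Lemma mono_of_socle X Y S (f : hom X Y) (i : hom S X) : uniserial X -> semistable Y ->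
  stable S -> mono i -> hcomp f i <> hzero S Y -> mono f.
Proof.
move=> [sX hX] sY hS mi fi0; have [nS sS hS'] := hS.
have [K [k [mk x]]] := kernel f; have sK := semistable_kernel sX sY mk x.
suff z : is_zero K by apply: mono0 => v y /x [u <-]; rewrite (iffLR (is_zeroP _) z v u) lf0.
apply: contrapT => nK; apply: fi0; apply: hom_ext => v y; rewrite hcompE hzeroE; apply/x.
case: (hX _ _ _ _ mi mk sS sK) => -[h hE]; first by exists (h v y); rewrite -hE hcompE.
have mh : mono h by apply: (@mono_compr _ _ _ _ _ i); rewrite hE.
have [dK _] := sK; have [//|[_ eh]] := hS' K h mh dK.
by have [w <-] := eh v y; exists w; rewrite -hE hcompE.
Qed.

Lemma irreducible_neq0 X Y (f : hom X Y) : indecomposable X -> indecomposable Y ->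
  irreducible_hom f -> f <> hzero X Y.
Proof.
move=> [nX _] [nY _] [_ _ h] f0.
have z := @ssrep0_zero F Q.
have [|/split_mono_mono m|/split_epi_epi e] := h _ (hzero X (ssrep F (fun=> 0%N))) (hzero _ Y).
- by apply/homeqP; rewrite f0; apply: hom_ext => v x; rewrite hcompE !hzeroE.
- exact/nX/(mono_zero m).
exact/nY/(epi_zero e).
Qed.

(** If [Y] had positive defect, [f] would factor through the middle term of the almost split
    sequence ending at [Y] by a split mono. Its retraction vanishes on [tau Y] by the sign of the
    defect, so it descends to [Y] and splits [f]. *)
Lemma irreducible_defect_target X Y (f : hom X Y) : indecomposable X -> indecomposable Y ->
  irreducible_hom f -> df X = 0 -> df Y = 0.
Proof.
move=> iX iY irf dX; have f0 := irreducible_neq0 iX iY irf; have [nm ne hf] := irf.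
case: (ltgtP (df Y) 0) => // dY; exfalso.
  by apply: f0; apply: (hom_zero_of_defect (hQ := hQ)) => //; left; rewrite dX.
have [Y' t] := ar_exists iY (ltW dY); have /ar_translateP [c arc] := t; have [nc _ rc] := arc.
have [k kE] : exists k, hcomp (ext_out c) k = f by apply/ext_out_factor; exact: rc.
have [|/split_monoP [r rE]|/ext_out_split //] := hf _ k (ext_out c); first exact/homeqP.
have r0 : hcomp r (ext_in c) <> hzero _ _.
  move=> r0; have [_ eo x] := ext_ses c; have [|r' r'E] := factor_epi (g := r) eo.
    by move=> v y /x [z <-]; rewrite -hcompE r0 hzeroE.
  by apply: nm; apply/split_monoP; exists r'; rewrite -kE hcompA r'E.
apply: r0; apply: (hom_zero_of_defect (hQ := hQ) _ (ar_indecr t) iX).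
by right; rewrite dX -(defect_ar hQ t).
Qed.

Lemma irreducible_defect_source X Y (f : hom X Y) : indecomposable X -> indecomposable Y ->
  irreducible_hom f -> df Y = 0 -> df X = 0.
Proof.
move=> iX iY irf dY; have f0 := irreducible_neq0 iX iY irf; have [nm ne hf] := irf.
case: (ltgtP (df X) 0) => // dX; exfalso; last first.
  by apply: f0; apply: (hom_zero_of_defect (hQ := hQ)) => //; right; rewrite dY.
have [X' t] := ar_inv_exists iX (ltW dX); have /ar_translateP [c arc] := t; have [nc lc _] := arc.
have [k kE] : exists k, hcomp k (ext_in c) = f by apply/ext_in_factor; exact: lc.
have [|/ext_in_split //|/split_epiP [r rE]] := hf _ (ext_in c) k; first exact/homeqP.
have r0 : hcomp (ext_out c) r <> hzero _ _.
  move=> r0; have [mi eo x] := ext_ses c; have [|r' r'E] := factor_mono (g := r) mi.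
    by move=> v y; apply/x; rewrite -hcompE r0 hzeroE.
  by apply: ne; apply/split_epiP; exists r'; rewrite -kE -hcompA r'E.
apply: r0; apply: (hom_zero_of_defect (hQ := hQ) _ iY (ar_indecl t)).
by left; rewrite dY (defect_ar hQ t).
Qed.

(** In a factorisation whose second map is not split epi, that map lifts through [ext_out c]; this
    gives an endomorphism of the middle term absorbed by [ext_out c]. It cannot be nilpotent, so
    Fitting makes it invertible and the first map splits. *)
Lemma ar_out_irreducible Z X (c : coc Z X) : ar_coc c -> indecomposable (ext_rep c) ->
  irreducible_hom (ext_out c).
Proof.
move=> arc iE; have [nc lc rc] := arc; have [mi eo x] := ext_ses c; split.
- move/split_mono_mono/mono_eq0 => m; have [nX _] := ar_coc_indecr arc; apply: nX.
  apply/is_zeroP => v y; apply: (mono_eq0 mi); apply: m; exact: ses_comp0 (ext_ses c).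
- by move/ext_out_split.
move=> W u h /homeqP e; have [|nh] := pselect (split_epi h); [by right|left].
have [k kE] : exists k, hcomp (ext_out c) k = h by apply/ext_out_factor; exact: rc.
have gE : hcomp (ext_out c) (hcomp k u) = ext_out c by rewrite hcompA kE -e.
have [/iso_inverse [t [t1 _]]|[n nz]] := fitting (hcomp k u) iE.
  by apply/split_monoP; exists (hcomp t k); rewrite -hcompA.
have : hcomp (ext_out c) (hpow (hcomp k u) n) = ext_out c.
  elim: n {nz} => [|n IH]; first by rewrite /= hcomp_idr.
  by rewrite /= hcompA gE IH.
rewrite nz => e0; have [nZ _] := ar_coc_indecl arc; case: nZ; apply/is_zeroP => v y.
have [w <-] := eo v y; by rewrite -e0 hcompE hzeroE lf0.
Qed.

Section Ladder.
Variables (p : nat) (s : nat -> rep).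
Hypothesis ls : ladder hQ p s.

Let sS b : stable (s b). Proof. by case: ls. Qed.
Let sA b : ar_translate (s b.+1) (s b). Proof. by case: ls. Qed.
Local Notation lenp := (lenp hQ s).

(** A factorisation can be restricted to an indecomposable summand of the middle object on which the
    socle survives; it has defect 0 by the sign rules, so it is uniserial. Its image in [M] either
    lies in the maximal subobject [M'], which splits [g], or is [M], which splits [h]. *)
Lemma ray_irreducible b n M M' (j : hom M' M) : lenp b n.+2 M -> lenp b n.+1 M' -> mono j ->
  irreducible_hom j.
Proof.
move=> lM lM' mj; have [uM _ _] := lM; have [uM' _ /(_ isT) [[i mi] _]] := lM'.
have [sM hM] := uM; have [sM' _] := uM'; have [dM _] := sM; have [dM' _] := sM'.
have iM := uniserial_indec uM (iffRL (lenp_nonzero ls lM) isT).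
have nM' := iffRL (lenp_nonzero ls lM') isT.
have iM' := uniserial_indec uM' nM'.
have lt : (tdim M' < tdim M)%N.
  by rewrite (lenp_tdim lM) (lenp_tdim lM'); apply: (lend_lt ls).
have nj : ~ is_iso j by move=> /iso_intro/iso_tdim e; move: lt; rewrite e ltnn.
split.
- by move/(split_mono_indec iM nM').
- by move/split_epi_epi => ej; apply: nj.
move=> W g h /homeqP e; have [nsb ssb _] := sS b.
have : hcomp h (hcomp g i) <> hzero _ _.
  by rewrite hcompA -e; apply: mono_neq0 => //; apply: mono_comp.
move/indec_summand_factor => [W' [io [pr [iW' prio nz]]]].
pose g' := hcomp pr g; pose h' := hcomp h io.
have nz1 : hcomp (hcomp h' g') i <> hzero _ _.
  by move=> e0; apply: nz; rewrite -e0 /h' /g' !hcompA.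
have [hg0 _] := hcomp_neq0 nz1; have [h0 g0] := hcomp_neq0 hg0.
have dW : df W' = 0.
  case: (ltgtP (df W') 0) => // d; exfalso.
    by apply: g0; apply: (hom_zero_of_defect (hQ := hQ)) => //; left; rewrite dM'.
  by apply: h0; apply: (hom_zero_of_defect (hQ := hQ)) => //; right; rewrite dM.
have sW := semistable_indec iW' dW; have uW := indec_uniserial eigF iW' sW.
have mhg : mono (hcomp h' g') by apply: (mono_of_socle uM' sM (sS b) mi nz1).
have mg' : mono g' by apply: mono_compr mhg.
have [k kE] := uniserial_factor_le uM mhg mj sM' sM' (leqnn _).
have mk : mono k by apply: (@mono_compr _ _ _ _ _ j); rewrite kE.
have ik := mono_tdim_iso mk (leqnn _).
have [k' [k'k _]] := iso_inverse ik.
have case1 (h2 : hom W' M') : hcomp j h2 = h' -> split_mono g.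
  move=> h2E; apply/split_monoP; exists (hcomp k' (hcomp h2 pr)).
  rewrite -!hcompA -/g' -k'k; congr hcomp; apply: hom_ext => v x; apply: mj.
  by rewrite -!(hcompE j) hcompA h2E kE.
have [I [q [m [eq mm fE]]]] := image h'; have sI := semistable_image sW sM eq mm.
have [a [_ lI]] := lenp_sub ls lM mm sI.
have tI := mono_tdim mm.
have [le|gt] := leqP (tdim I) (tdim M').
  left; have [f fE'] := uniserial_factor_le uM mm mj sI sM' le.
  by apply: (case1 (hcomp f q)); rewrite hcompA fE'.
right; have im : is_iso m.
  apply: mono_tdim_iso => //; move: gt; rewrite (lenp_tdim lM) (lenp_tdim lI) (lenp_tdim lM').
  by rewrite (lend_le ls) !ltnNge (lend_le ls) -ltnNge.
have eh' : epi h' by rewrite -fE; apply: epi_comp => //; case: im.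
have nz2 : hcomp h' (hcomp g' i) <> hzero _ _ by rewrite hcompA.
have mh' : mono h' := mono_of_socle uW sM (sS b) (mono_comp mg' mi) nz2.
have [t [_ tE]] := iso_inverse (conj mh' eh').
by apply/split_epiP; exists (hcomp io t); rewrite hcompA.
Qed.

Lemma component_socle b n M : lenp b n.+1 M -> same_ar_component M (s b).
Proof.
elim: n M => [|n IH] M lM.
  have [_ _ /(_ isT) [[i mi] _]] := lM.
  have : is_iso i.
    apply: mono_tdim_iso => //; rewrite (lenp_tdim lM) /lend big_ord1 addn0 //.
  move=> /iso_intro h; have [uM _ _] := lM; apply: rst_sym; apply: rst_step; split.
  - exact: stable_indec (sS b).
  - exact: uniserial_indec uM (iffRL (lenp_nonzero ls lM) isT).
  by left.
have [M' [j [mj lM']]] := lenp_exists_sub ls lM (leqnSn n.+1).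
apply: rst_trans (IH _ lM'); apply: rst_sym; apply: rst_step.
have [uM _ _] := lM; have [uM' _ _] := lM'; split.
- exact: uniserial_indec uM' (iffRL (lenp_nonzero ls lM') isT).
- exact: uniserial_indec uM (iffRL (lenp_nonzero ls lM) isT).
by right; exists j; exact: ray_irreducible lM lM' mj.
Qed.

(** The almost split sequence ending at [s b.+1] has a uniserial, hence indecomposable, middle term;
    it lies on the ray of [s b] and maps irreducibly to [s b.+1]. *)
Lemma component_step b : same_ar_component (s b) (s b.+1).
Proof.
have /ar_translateP [c arc] := sA b; have [nc _ _] := arc.
have uE := uniserial_ext_top eigF (stable_uniserial (sS b)) (sS b.+1) nc.
have [mi eo _] := ext_ses c.
have [n [n0 lE]] := lenp_exists ls uE mi.
have nE := iffRL (lenp_nonzero ls lE) n0; have iE := uniserial_indec uE nE.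
case: n n0 lE => // n _ lE.
apply: rst_trans (rst_sym _ _ _ _ (component_socle lE)) _; apply: rst_step; split=> //.
  exact: stable_indec.
by right; exists (ext_out c); apply: ar_out_irreducible.
Qed.

Lemma component_ladder a b : same_ar_component (s a) (s b).
Proof.
have h0 c : same_ar_component (s 0%N) (s c).
  elim: c => [|c IH]; first exact: rst_refl.
  exact: rst_trans IH (component_step c).
exact: rst_trans (rst_sym _ _ _ _ (h0 a)) (h0 b).
Qed.

(** An invariant of components: it shows that a component contains no quasi-simple outside the
    ladder. *)
Definition in_tube Y := [/\ indecomposable Y, semistable Y & exists b (i : hom (s b) Y), mono i].

Lemma ladder_down p' s' a b t : ladder hQ p' s' -> iso (s' (a + t)%N) (s (b + t)%N) ->
  iso (s' a) (s b).
Proof.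
move=> [_ _ sA' _]; elim: t => [|t IH]; first by rewrite !addn0.
rewrite !addnS => h; apply: IH.
exact: ar_unique_l (ar_translate_iso h (iso_refl _) (sA' _)) (sA _).
Qed.

(** The socle of [I] is obtained from that of [X] by finitely many inverse translates. For the
    converse, the socle of [X] is placed in its own tube and compared with the given ladder by going
    down as many steps. *)
Lemma in_tube_epi X I (q : hom X I) : uniserial X -> semistable I -> ~ is_zero I -> epi q ->
  (exists b (i : hom (s b) X), mono i) <-> (exists b (i : hom (s b) I), mono i).
Proof.
move=> uX sI nI eq; have [sX _] := uX.
have [K [k skq]] := epi_ker eq; have [mk _ x] := skq.
have sK := semistable_kernel sX sI mk x.
have aux p' s' c (i : hom (s' c) X) : ladder hQ p' s' -> mono i ->
    exists m (i' : hom (s' (c + m)%N) I), mono i'.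
  move=> ls' mi; have [n [n0 lX]] := lenp_exists ls' uX mi.
  have [m [le lK]] := lenp_sub ls' lX mk sK.
  have lI := lenp_quot ls' lX lK skq.
  have lt := iffLR (lenp_nonzero ls' lI) nI.
  by have [_ _ /(_ lt) [[i' mi'] _]] := lI; exists m, i'.
split=> [[b [i mi]]|[b [i mi]]].
  by have [m [i' mi']] := aux p s b i ls mi; exists (b + m)%N, i'.
have nX : ~ is_zero X by move=> z; apply: nI; apply: epi_zero eq z.
have [S [t [hS mt]]] := stable_subobject sX nX.
have [p' [R' [i0 [tR iS]]]] := stable_tube eigF hS.
have ls' := tube_ladder i0 tR; have /isoP [g [mg _]] := iso_sym iS.
have [i' mi'] : exists i' : hom (tube_seq R' i0 1) X, mono i'.
  by rewrite tube_seq1; exists (hcomp t g); apply: mono_comp.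
have [m [i1 mi1]] := aux p' _ 1%N i' ls' mi'.
have [_ sS' _ _] := ls'; have uI := uniserial_quot uX eq sI.
have h1 := stable_sub_unique uI (sS' _) (sS b) mi1 mi.
have [p0 _ _ per] := ls.
(* Raising the index by a multiple of the period leaves room to go down [m] steps in the natural
   numbers. *)
have h2 : iso (s b) (s (b + p * m - m + m)%N).
  by apply/per; rewrite subnK ?modnMDl; [rewrite addnC mulnC modnMDl|nia].
have h3 := ladder_down ls' (iso_trans h1 h2).
have /isoP [f [mf _]] := iso_sym h3.
by exists (b + p * m - m)%N, (hcomp i' f); apply: mono_comp.
Qed.

Lemma in_tube_mono X I (m : hom I X) : uniserial X -> semistable I -> ~ is_zero I -> mono m ->
  (exists b (i : hom (s b) X), mono i) <-> (exists b (i : hom (s b) I), mono i).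
Proof.
move=> uX sI nI mm; split=> -[b [i mi]]; last by exists b, (hcomp m i); apply: mono_comp.
have [n [n0 lX]] := lenp_exists ls uX mi.
have [a [_ lI]] := lenp_sub ls lX mm sI.
have lt := iffLR (lenp_nonzero ls lI) nI.
by have [_ _ /(_ lt) [[i' mi'] _]] := lI; exists b, i'.
Qed.

Lemma in_tube_hom X Y (f : hom X Y) : indecomposable X -> indecomposable Y ->
  semistable X -> semistable Y -> f <> hzero X Y -> in_tube X <-> in_tube Y.
Proof.
move=> iX iY sX sY f0; have uX := indec_uniserial eigF iX sX.
have uY := indec_uniserial eigF iY sY.
have [I [q [m [eq mm fE]]]] := image f; have sI := semistable_image sX sY eq mm.
have nI : ~ is_zero I.
  move=> z; apply: f0; apply: hom_ext => v x; rewrite -fE hcompE hzeroE.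
  by rewrite (iffLR (is_zeroP _) z v (q v x)) lf0.
have e1 := in_tube_epi uX sI nI eq; have e2 := in_tube_mono uY sI nI mm.
by split=> -[_ _ h]; split=> //; [apply/e2/e1|apply/e1/e2].
Qed.

Lemma in_tube_adjacent X Y : ar_adjacent X Y -> in_tube X <-> in_tube Y.
Proof.
move=> [iX iY [/isoP [f [mf ef]]|[f irf]]].
  have h := iso_intro (conj mf ef); have [nX _] := iX.
  split=> -[_ sX hX]; (split=> //; [|have [b [i mi]] := hX; exists b]).
  - exact: semistable_iso h sX.
  - by exists (hcomp f i); apply: mono_comp.
  - exact: semistable_iso (iso_sym h) sX.
  by have /isoP [g [mg _]] := iso_sym h; exists (hcomp g i); apply: mono_comp.
have f0 := irreducible_neq0 iX iY irf.
split=> -[_ sX hX]; have [d _] := sX.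
  have sY := semistable_indec iY (irreducible_defect_target iX iY irf d).
  exact/(in_tube_hom iX iY sX sY f0).
have sY := semistable_indec iX (irreducible_defect_source iX iY irf d).
exact/(in_tube_hom iX iY sY sX f0).
Qed.

Lemma in_tube_component X Y : same_ar_component X Y -> in_tube X <-> in_tube Y.
Proof.
elim=> [{}X {}Y /in_tube_adjacent //|//|{}X {}Y _ ->//|{}X {}Y Z _ -> _ -> //].
Qed.

End Ladder.

Lemma tube_seq_surj p (R : 'I_p -> rep) i j : exists b, tube_seq R i b = R j.
Proof.
exists (p - ord_pred i + j)%N; rewrite /tube_seq; congr R; apply: val_inj.
have vE c (x : 'I_p) : val (iter c (@ordS p) x) = ((x + c) %% p)%N.
  elim: c => [|c IH] /=; first by rewrite addn0 modn_small.
  by move: IH => /= ->; rewrite -addn1 modnDml addn1 addnS.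
rewrite vE addnA subnKC; last by apply: ltnW.
by rewrite modnDl modn_small.
Qed.

Lemma tube_mouth_of_tube p (R : 'I_p -> rep) i M n : tube hQ R ->
  lenp hQ (tube_seq R i) 1 n.+1 M -> tube_mouth M R.
Proof.
move=> tR lM; have ls := tube_ladder i tR; have [sR jR aR] := tR.
have cM := component_socle ls lM; have [uM _ /(_ isT) [[f mf] _]] := lM.
split=> // [j|S /(quasi_simpleP hQ) hS cS].
  split; first by apply/(quasi_simpleP hQ).
  have [b <-] := tube_seq_surj R i j; exact: rst_trans cM (component_ladder ls _ _).
have [sM _] := uM.
have : in_tube (tube_seq R i) M.
  by split=> //; [exact: uniserial_indec uM (iffRL (lenp_nonzero ls lM) isT)|exists 1%N, f].
move/(in_tube_component ls cS) => [_ sS [b [g mg]]].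
have [_ _ h] := hS; have sb : stable (tube_seq R i b) by case: ls.
have [nb _ _] := sb; have [//|ig] := h _ g mg (stable_defect sb).
by exists (iter b (@ordS p) (ord_pred i)); apply: iso_sym; apply: iso_intro ig.
Qed.

End Component.

(** * Extensions between subquotients *)

Section ExtSubquotient.
Variables (F : fieldType) (eigF : has_eigenvectors F) (Q : quiver) (hQ : affine_quiver Q).
Local Notation rep := (rep F Q).
Local Notation df := (defect hQ).
Local Notation stable := (stable hQ).
Local Notation semistable := (semistable hQ).
Local Notation uniserial := (uniserial hQ).
Implicit Types (A B C D E I J K L M N S T U V X Y Z W : rep).

Let acQ : acyclic Q := proj1 hQ.

Lemma Ext1_zero_source A B : is_zero A -> Ext1_zero A B.
Proof.
move=> /is_zeroP z; apply/Ext1_zeroP => c; rewrite (_ : c = 0); first exact: cobound0.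
by apply: coc_ext => a x; rewrite (z _ x) !lf0.
Qed.

(** For indecomposable [A] a nonzero class gives a nonzero morphism [B -> tau A]; its image has an
    indecomposable summand of nonnegative defect, which cannot map nontrivially to [tau A], of
    negative defect. *)
Lemma Ext1_negative_nonnegative A B :
  (forall W (i : hom W A), mono i -> ~ is_zero W -> df W < 0) ->
  (forall D (q : hom B D), epi q -> 0 <= df D) -> Ext1_zero A B.
Proof.
move=> hA hB; have [n] := ubnP (tdim A); elim: n A hA => // n IH A hA; rewrite ltnS => le.
have [z|nA] := pselect (is_zero A); first exact: Ext1_zero_source.
have [iA|dA] := pselect (indecomposable A).
  apply: contrapT => nE; have [A' t] : exists A', ar_translate A A'.
    by apply: ar_translate_exists => //; exists B.
  apply/nE/(serre_l _ t) => f; apply: contrapT => f0.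
  have [I [e [m [ee mm fE]]]] := image f.
  have nI : ~ is_zero I.
    move=> z; apply: f0; apply: hom_ext => v x; rewrite -fE hcompE hzeroE.
    by rewrite (iffLR (is_zeroP _) z v (e v x)) lf0.
  have [|D [i [r [iD rE dD]]]] := @indec_summand_defect _ _ hQ (fun a => 0 <= a) _ I nI (hB _ _ ee).
    by move=> a b; lia.
  have mi : mono i by apply: split_mono_mono; apply/split_monoP; exists r.
  have [nD _] := iD; apply: (mono_neq0 (mono_comp mm mi) nD).
  apply: (hom_zero_of_defect (hQ := hQ) _ iD (ar_indecr t)); left; split=> //.
  by rewrite -(defect_ar hQ t); apply: (hA _ (hid A)) => //; apply: mono_id.
have [A1 [A2 [i1 [p1 [i2 [p2 [bp n1 n2]]]]]]] := decomposable nA dA.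
have s1 := biprod_ses bp; have [m1 _ _] := s1; have [m2 _ _] := biprod_ses (biprod_sym bp).
have tA := ses_tdim s1; have := tdim_gt0 n1; have := tdim_gt0 n2 => t2 t1.
apply: (Ext1_extl s1); apply: IH; try lia.
  by move=> W i mi; apply: hA (mono_comp m1 mi).
by move=> W i mi; apply: hA (mono_comp m2 mi).
Qed.

(** A nonzero image of [B] in the semistable [tau J] would have defect both positive and at most
    0. *)
Lemma Ext1_semistable_positive J B : indecomposable J -> semistable J ->
  (forall D (q : hom B D), epi q -> ~ is_zero D -> 0 < df D) -> Ext1_zero J B.
Proof.
move=> iJ sJ hB; have [dJ _] := sJ.
have [J' t] : exists J', ar_translate J J' by apply: (ar_exists (hQ := hQ)) => //; rewrite dJ.
have sJ' := semistable_ar t sJ; apply/(serre_l _ t) => f; apply: contrapT => f0.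
have [I [e [m [ee mm fE]]]] := image f.
have nI : ~ is_zero I.
  move=> z; apply: f0; apply: hom_ext => v x; rewrite -fE hcompE hzeroE.
  by rewrite (iffLR (is_zeroP _) z v (e v x)) lf0.
by have := hB _ _ ee nI; have := sJ'.2 _ _ mm; lia.
Qed.

(* The maximal semistable subobject [J] of [N] and the minimal semistable [V] between
   [N] and [M] carry the whole of [Ext^1(N, M/N)]. *)
Lemma Ext1_semistable_core M N C (i : hom N M) (c : hom M C) : uniserial M -> ses i c ->
  ~ Ext1_zero N C ->
  exists J (j : hom J N) V (v : hom V M) MV (w : hom M MV),
    [/\ mono j /\ semistable J, ses v w /\ semistable V, factors i v & ~ Ext1_zero J MV].
Proof.
move=> uM sic nE; have [mi ec x] := sic; have [sM hM] := uM.
have [||t [[J [j [mj sJ tJ]]] mJ]] := @max_nat (fun t => exists J, exists j : hom J N,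
  [/\ mono j, semistable J & tdim J = t]) (tdim N).
- have z := @ssrep0_zero F Q; exists 0%N, (ssrep F (fun=> 0%N)), (hzero _ _); split.
  + by apply: mono0 => u y _; apply: (iffLR (is_zeroP _) z).
  + exact: semistable_zero.
  by apply/is_zero_tdim.
- by move=> t [J [j [mj _ <-]]]; apply: mono_tdim mj.
have [|r [[V [v [mv sV fV tV]]] mV]] := @min_nat (fun t => exists V, exists v : hom V M,
  [/\ mono v, semistable V, factors i v & tdim V = t]).
  by exists (tdim M), M, (hid M); split=> //; [apply: mono_id|exists i; rewrite hcomp_idl].
have [MV [w svw]] := mono_coker mv; have [_ ew xw] := svw.
exists J, j, V, v, MV, w; split=> //.
have [A [a sja]] := mono_coker mj; have [_ ea xa] := sja.
have EA : Ext1_zero A C.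
  apply: Ext1_negative_nonnegative => [W k mk nW|D q eq]; last first.
    by apply: (semistable_quot sM (epi_comp eq ec)).
  rewrite ltNge; apply/negP => dW.
  have [W' [k' [l [s [mk' sls _ _]]]]] := pullback_mono sja mk.
  have dW' := defect_ses hQ sls; have [dJ _] := sJ.
  have sW' : semistable W'.
    apply: (semistable_sub sM (mono_comp mi mk')).
    by have := sM.2 _ _ (mono_comp mi mk'); rewrite dW' dJ; lia.
  have : (tdim W' <= t)%N by apply: mJ; exists W', k'.
  by have := ses_tdim sls; have := tdim_gt0 nW; lia.
have [n nE'] : exists n : hom N V, hcomp v n = i by [].
have mn : mono n by apply: (@mono_compr _ _ _ _ _ v); rewrite nE'.
have [B [b snb]] := mono_coker mn; have [_ eb xb] := snb.
have [|b' b'E] := factor_epi (g := hcomp c v) eb.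
  by move=> u y /xb [z <-]; rewrite hcompE -(hcompE v) nE'; apply/x; exists z.
have [|w' w'E] := factor_epi (g := w) ec.
  by move=> u y /x [z <-]; rewrite -nE' hcompE; apply/xw; eexists.
have sB : ses b' w'.
  split.
  - apply: mono0 => u y; have [z <-] := eb u y; rewrite -(hcompE b') b'E hcompE => /x [z'].
    by rewrite -nE' hcompE => /mv <-; apply/xb; exists z'.
  - by apply: (@epi_compl _ _ _ _ _ _ c); rewrite w'E.
  move=> u y; have [z <-] := ec u y; rewrite -(hcompE w') w'E; split=> [/xw [z' <-]|[z' z'E]].
    by exists (b u z'); rewrite -(hcompE b') b'E hcompE.
  have [z2 z2E] := eb u z'; rewrite -w'E hcompE -z'E -z2E -(hcompE b') b'E hcompE.
  by rewrite -(hcompE w') w'E; apply/xw; exists z2.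
have EB : ~ is_zero J -> Ext1_zero J B.
  move=> nJ; have iJ : indecomposable J.
    by apply: uniserial_indec nJ; apply: uniserial_sub uM (mono_comp mi mj) sJ.
  apply: Ext1_semistable_positive => // D q eq nD.
  (* If a nonzero quotient [D] of [V / N] had defect 0, the kernel of [V -> D] would be a smaller
     semistable subobject still containing [N]. *)
  have [V' [k sk]] := epi_ker (epi_comp eq eb); have [mk _ xk] := sk.
  have [dV _] := sV; have dV' := defect_ses hQ sk; have le := sM.2 _ _ (mono_comp mv mk).
  rewrite lt_neqAle; apply/andP; split; last by lia.
  apply/eqP => d0; have : (r <= tdim V')%N.
    apply: mV; exists V', (hcomp v k); split=> //; first exact: mono_comp.
      by apply: (semistable_sub sM (mono_comp mv mk)); lia.
    have [|n' n'E] := factor_mono (g := n) mk.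
      move=> u y; apply/xk; rewrite hcompE (_ : b u _ = 0) ?lf0 //; by apply/xb; exists y.
    by exists n'; rewrite -hcompA n'E.
  by have := ses_tdim sk; have := tdim_gt0 nD; lia.
move=> E0; apply: nE; apply: (Ext1_extl sja) => //.
have [zJ|nJ] := pselect (is_zero J); first exact: Ext1_zero_source.
exact: Ext1_extr sB (EB nJ) E0.
Qed.

Section Ladder.
Variables (p : nat) (s : nat -> rep).
Hypothesis ls : ladder hQ p s.

Let p_gt0 : (0 < p)%N. Proof. by case: ls. Qed.
Let sS b : stable (s b). Proof. by case: ls. Qed.
Let sA b : ar_translate (s b.+1) (s b). Proof. by case: ls. Qed.
Let sP a b : iso (s a) (s b) <-> a = b %[mod p]. Proof. by case: ls. Qed.
Local Notation lenp := (lenp hQ s).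

(** The two forms of Serre duality each produce a nonzero morphism; matching socles in one and tops
    in the other gives a congruence modulo [p], which is the corresponding bound. *)
Lemma Ext1_length_bounds n M J (j : hom J M) V (v : hom V M) MV (w : hom M MV) :
  lenp 1 n M -> mono j -> semistable J -> ses v w -> semistable V -> ~ Ext1_zero J MV ->
  exists a m, [/\ lenp 1 a J, lenp 1 m V, (n %% p < a)%N, (0 < n %/ p)%N
    & (m <= n %/ p * p - 1)%N].
Proof.
move=> lM mj sJ svw sV nE; have [uM _ tM] := lM; have [sM hM] := uM; have [mv ew xw] := svw.
have [a [_ lJ]] := lenp_sub ls lM mj sJ; have [m [mn lV]] := lenp_sub ls lM mv sV.
have lMV := lenp_quot ls lM lV svw.
have [uJ _ tJ] := lJ; have [uMV _ _] := lMV; have [sMV _] := uMV.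
have nJ : ~ is_zero J by move=> z; apply: nE; exact: Ext1_zero_source.
have a0 := iffLR (lenp_nonzero ls lJ) nJ.
have nMV : ~ is_zero MV.
  move=> /is_zeroP z; apply: nE; apply/Ext1_zeroP => c; rewrite (_ : c = 0); first exact: cobound0.
  by apply: coc_ext => b x; rewrite [LHS]z [RHS]z.
have nM : ~ is_zero M by move=> z; apply: nMV; apply: epi_zero ew z.
have n0 := iffLR (lenp_nonzero ls lM) nM.
have iJ := uniserial_indec uJ nJ; have iMV := uniserial_indec uMV nMV.
have [dJ _] := sJ; have [dMV _] := sMV.
exists a, m.
(* [k] is the length of the kernel of [M] onto the image of a nonzero [M/V -> tau J]. The socle
   [s k.+1] of that image is the translate of the socle [s 1] of [J]. *)
have [k [mk kn kp]] : exists k, [/\ (m <= k)%N, (k < n)%N & k.+1 = 0 %[mod p]].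
  have [J' t] : exists J', ar_translate J J' by apply: (ar_exists (hQ := hQ)) => //; rewrite dJ.
  have sJ' := semistable_ar t sJ.
  have [f f0] : exists f : hom MV J', f <> hzero _ _.
    by apply: contrapT => /forallNP no; apply/nE/(serre_l _ t) => f; apply: contrapT.
  have [I [e [i [ee mi fE]]]] := image f; have sI := semistable_image sMV sJ' ee mi.
  have nI : ~ is_zero I.
    move=> z; apply: f0; apply: hom_ext => u x; rewrite -fE hcompE hzeroE.
    by rewrite (iffLR (is_zeroP _) z u (e u x)) lf0.
  have [K [k skc]] := epi_ker (epi_comp ee ew); have [mk _ xk] := skc.
  have sK := semistable_kernel sM sI mk xk.
  have [b [_ lK]] := lenp_sub ls lM mk sK; have lI := lenp_quot ls lM lK skc.
  have nb := iffLR (lenp_nonzero ls lI) nI; exists b; split.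
  - rewrite -(lend_le ls 1) -(lenp_tdim lV) -(lenp_tdim lK).
    have [|vk vkE] := factor_mono (g := v) mk.
      move=> u y; apply/xk; rewrite hcompE (_ : w u _ = 0) ?lf0 //; by apply/xw; exists y.
    by apply: (@mono_tdim _ _ _ _ vk); apply: (@mono_compr _ _ _ _ _ k); rewrite vkE.
  - by rewrite -subn_gt0.
  have [_ _ /(_ nb) [[g mg] _]] := lI.
  have [h h0] : exists h : hom (s (1 + b).+1) J, h <> hzero _ _.
    apply/(ar_hom_neq0 (sA (1 + b)) t); exists (hcomp i g).
    by apply: mono_neq0; [apply: mono_comp|case: (sS (1 + b))].
  have mh := stable_mono (sS _) sJ h0.
  have [[i1 mi1] _] := tJ a0.
  have /sP := stable_sub_unique uJ (sS _) (sS _) mh mi1.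
  by rewrite !add1n -[b.+2]addn1 -[1%N in RHS]add0n => /eqP; rewrite eqn_modDr => /eqP.
(* A nonzero morphism from the inverse translate of [M/V] to [J] has an image with top [s b.+1],
   where [b < a]. Translating, [s b] is the top [s n] of [M], so [b] and [n] agree modulo [p]. *)
have ka : (n %% p < a)%N.
  have [W t] : exists W, ar_translate W MV.
    by apply: (ar_inv_exists (hQ := hQ)) => //; rewrite dMV.
  have sW := semistable_ar_inv t sMV.
  have [f f0] : exists f : hom W J, f <> hzero _ _.
    by apply: contrapT => /forallNP no; apply/nE/(serre_r _ t) => f; apply: contrapT.
  have [I [e [i [ee mi fE]]]] := image f; have sI := semistable_image sW sJ ee mi.
  have nI : ~ is_zero I.
    move=> z; apply: f0; apply: hom_ext => u x; rewrite -fE hcompE hzeroE.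
    by rewrite (iffLR (is_zeroP _) z u (e u x)) lf0.
  have [b [ba lI]] := lenp_sub ls lJ mi sI.
  have b0 := iffLR (lenp_nonzero ls lI) nI; have [_ _ /(_ b0) [_ [q eq]]] := lI.
  case: b b0 ba lI q eq => // b _ ba lI q eq.
  have [h h0] : exists h : hom MV (s b), h <> hzero _ _.
    apply/(ar_hom_neq0 t (sA b)); exists (hcomp q e).
    by apply: epi_neq0; [apply: epi_comp|case: (sS (1 + b.+1.-1))].
  have eh := stable_epi (sS b) sMV h0.
  have [_ [q' eq']] := tM n0.
  have /sP := uniserial_top uM (sS _) (sS _) (epi_comp eh ew) eq'.
  rewrite add1n (prednK n0) => e1; apply: leq_ltn_trans ba; rewrite -e1; exact: leq_mod.
have le : (k.+1 <= n %/ p * p)%N.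
  have /dvdnP [c cE] : (p %| k.+1)%N by rewrite /dvdn kp mod0n.
  by rewrite cE leq_mul2r leq_divRL // -cE kn orbT.
split=> //; last by lia.
by case: (n %/ p)%N le => //; rewrite mul0n.
Qed.

Lemma hd_ladder a b : hd (s a) (s b) = (a == b %[mod p]) :> nat.
Proof.
case: eqP => [/sP h|ne].
  have t : ar_translate (s b.+1) (s a).
    exact: ar_translate_iso (iso_refl _) (iso_sym h) (sA b).
  by rewrite (serre_dim_l (sA b)) -(serre_dim_l t) (stable_hd eigF (sS a)).
apply/hd_eq0 => f; apply: contrapT => f0; apply/ne/sP.
exact: iso_intro (stable_schur (sS a) (sS b) f0).
Qed.

Lemma euler_ladder a b :
  euler (dvz (s a.+1)) (dvz (s b)) = (a.+1 == b %[mod p])%:Z - (a == b %[mod p])%:Z.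
Proof. by rewrite eulerE -(serre_dim_l (sA a)) !hd_ladder (eq_sym (b %% p)%N). Qed.

(** The Euler form telescopes to [S k.+1 - S 0], where [S c] counts the residues up to [k] congruent
    to [c] and [S 0 = 1]. For [k.+1 < p] the value is -1, which forces an extension. *)
Lemma Ext1_ladder_nonzero k l U C : (k < p)%N -> lenp 1 k.+1 U -> lenp (l * p) k.+1 C ->
  ~ Ext1_zero U C.
Proof.
move=> kp lU lC /ed_eq0 e0; have [_ dU /(_ isT) [_ [q eq]]] := lU.
have [_ dC /(_ isT) [[i mi] _]] := lC.
pose S c := \sum_(b < k.+1) (c == b %[mod p])%:Z.
have S0 : S 0%N = 1.
  rewrite /S big_ord_recl eqxx big1 ?addr0 // => b _.
  by rewrite mod0n modn_small // lift0; apply: leq_trans kp; case: b.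
have : euler (dvz U) (dvz C) = S k.+1 - S 0%N.
  rewrite dU (big_morph (fun x => euler x _) (fun x y => eulerDl x y _) (euler0l _)).
  transitivity (\sum_(a < k.+1) (S a.+1 - S a)).
    apply: eq_bigr => a _; rewrite dC (big_morph (euler _) (fun x y => eulerDr x y _) (euler0r _)).
    rewrite /S -sumrB; apply: eq_bigr => b _.
    by rewrite add1n euler_ladder modnMDl.
  by rewrite -(big_mkord xpredT (fun a => S a.+1 - S a)) telescope_sumr.
rewrite eulerE e0 S0; case: (ltnP k.+1 p) => [lt|ge].
  rewrite [S _]big1 ?sub0r; first by lia.
  by move=> b _; rewrite !modn_small ?(ltn_trans (ltn_ord b) lt) // eqn_leq leqNgt ltn_ord.
(* When [U] goes once around the tube the Euler form vanishes, but the top [s p] of [U] is the socle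
   [s (l * p)] of [C]; so Hom is nonzero, and Ext^1 has the same dimension. *)
have kE : k.+1 = p by lia.
have k0 : k.+1 = 0 %[mod p] by rewrite kE modnn mod0n.
have -> : S k.+1 = S 0%N by rewrite /S k0.
have /isoP [f [mf _]] : iso (s (1 + k.+1.-1)) (s (l * p)).
  by apply/sP; rewrite add1n kE modnn modnMl.
have h : (0 < hd U C)%N.
  have [nS _ _] := sS (1 + k.+1.-1); have /nonzeroP [v [y y0]] := nS.
  apply: (hd_gt0 (f := hcomp (hcomp i f) q)); apply/hneq0P; have [x xy] := eq v y.
  exists v, x => e; apply: y0; rewrite hcompE xy in e.
  by refine (mono_eq0 (mono_comp mi mf) e).
by lia.
Qed.

(** Vanishing would pass from [N] to its subobject [U] and from [M/N] to its quotient [M/V], whose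
    factors start at position [1 + (l * p - 1) = l * p] and number [k.+1]. *)
Lemma Ext1_removed l k M (N U V : subrep M) : (0 < l)%N -> (k < p)%N ->
  lenp 1 (l * p + k) M -> lenp 1 k.+1 (rep_of_sub U) -> lenp 1 (l * p - 1) (rep_of_sub V) ->
  sub_le U N -> sub_le N V -> ~ Ext1_zero (rep_of_sub N) (rep_quot N).
Proof.
move=> l0 kp lM lU lV /sub_leP [f fE] NV E0.
have lp : (0 < l * p)%N by rewrite muln_gt0 l0.
have := lenp_quot ls lM lV (quot_ses V).
rewrite addnC subnK // (_ : l * p + k - (l * p - 1) = k.+1)%N; last by lia.
move=> lC; apply: (Ext1_ladder_nonzero kp lU lC).
have mf : mono f.
  by apply: (@mono_compr _ _ _ _ _ (sub_incl N)); rewrite fE; apply: sub_incl_mono.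
have [mN eN xN] := quot_ses N; have [mV eV xV] := quot_ses V.
have [|g gE] := factor_epi (g := quot_proj V) eN.
  by move=> v x /xN/sub_inclP xN'; apply/xV/sub_inclP; apply: subvP (NV v) _ xN'.
apply: (Ext1_mono mf); apply: (Ext1_epi (p := g)) E0.
by apply: (@epi_compl _ _ _ _ _ _ (quot_proj N)); rewrite gE.
Qed.

(** The core pair found for [N] need not have the prescribed lengths: by the bounds, [J] contains
    the subobject of length [n %% p + 1], and [V] lies in the one of length [n %/ p * p - 1]. *)
Lemma Ext1_nonzero_removed n M (N : subrep M) : lenp 1 n M ->
  ~ Ext1_zero (rep_of_sub N) (rep_quot N) ->
  exists U V : subrep M, [/\ (0 < n %/ p)%N, lenp 1 (n %% p).+1 (rep_of_sub U),
    lenp 1 (n %/ p * p - 1) (rep_of_sub V), sub_le U N & sub_le N V].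
Proof.
move=> lM nE; have [uM _ _] := lM.
have [J [j [V [v [MV [w [[mj sJ] [svw sV] [n' n'E] nJ]]]]]]] := Ext1_semistable_core uM (quot_ses N) nE.
have mij : mono (hcomp (sub_incl N) j) by apply: mono_comp mj; apply: sub_incl_mono.
have [a [m [lJ lV ka l0 mle]]] := Ext1_length_bounds lM mij sJ svw sV nJ.
have [U [u [mu lU]]] := lenp_exists_sub ls lJ ka.
have [|V2 [v2 [mv2 lV2]]] := lenp_exists_sub ls lM (m := n %/ p * p - 1).
  by have := leq_trunc_div n p; lia.
have mU := mono_comp mij mu; exists (img (hcomp (hcomp (sub_incl N) j) u)), (img v2); split=> //.
- exact: lenp_iso (iso_sym (img_iso mU)) lU.
- exact: lenp_iso (iso_sym (img_iso mv2)) lV2.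
- move=> b; apply/subvP => x /imgP [y <-]; apply/sub_inclP; exists (j b (u b y)).
  by rewrite !hcompE.
have [mv _ _] := svw; have [[sV2 _] _ _] := lV2.
have [f fE] : factors v v2.
  apply: (uniserial_factor_le uM) => //.
  by rewrite (lenp_tdim lV) (lenp_tdim lV2) (lend_le ls).
move=> b; apply/subvP => x /sub_inclP [y <-]; apply/imgP; exists (f b (n' b y)).
by rewrite -n'E -fE !hcompE.
Qed.

End Ladder.
End ExtSubquotient.

(** * The transverse quiver Grassmannian *)

Lemma closed_has_eigenvectors (F : closedFieldType) : has_eigenvectors F.
Proof.
move=> V f x x0; have be := vbasisP {:V}.
have [|a] := closed_rootP (char_poly (passmx.mxof (vbasis {:V}) (vbasis {:V}) f)) _.
  rewrite size_char_poly eqSS dimv_eq0; apply/eqP => V0.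
  by apply/x0/eqP; rewrite -memv0 -V0 memvf.
rewrite -eigenvalue_root_char => /eigenvalueP [u uE u0]; exists a, (passmx.vecof (vbasis {:V}) u).
split; first by apply/eqP; rewrite passmx.vecof_eq0.
rewrite (passmx.hom_vecof _ be) uE /passmx.vecof scaler_sumr.
by apply: eq_bigr => i _; rewrite mxE scalerA.
Qed.

Section Transverse.
Variables (F : fieldType) (eigF : has_eigenvectors F) (Q : quiver) (hQ : affine_quiver Q).
Implicit Types (M : rep F Q).

Lemma rigid_Ext1_subquotient M (N : subrep M) : rigid M ->
  Ext1_zero (rep_of_sub N) (rep_quot N).
Proof.
have [mN eN _] := quot_ses N => rM.
exact: Ext1_epi eN (Ext1_mono mN rM).
Qed.

(** [Tr_removed] quantifies over all presentations of the tube of [M]. One inclusion treats an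
    arbitrary presentation; the other builds one from a stable subobject of [M], with [l] and [k]
    the quotient and remainder of the length by the rank. *)
Lemma nonrigid_Ext1_subquotient M (N : subrep M) : indecomposable M -> ~ rigid M ->
  Ext1_zero (rep_of_sub N) (rep_quot N) <-> ~ Tr_removed M N.
Proof.
move=> iM nrM; have [nM _] := iM.
have sM := semistable_indec iM (nonrigid_defect hQ iM nrM).
have uM := indec_uniserial eigF iM sM.
split=> [E0 [p [R [i [l [k [U [V [[mM l0 kp rM] [rU rV UN NV]]]]]]]]]|nT].
  have [sR _ iR aR] := mM.
  have tR : tube hQ R by split=> // j; have [/(quasi_simpleP hQ)] := sR j.
  have ls := tube_ladder i tR; rewrite -(tube_seq1 R i) in rM rU rV.
  have lM := ray_rep_lenp eigF ls rM; have lU := ray_rep_lenp eigF ls rU.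
  have lV := ray_rep_lenp eigF ls rV.
  exact: (Ext1_removed eigF ls l0 kp lM lU lV UN NV).
apply: contrapT => nE; apply: nT.
have [S [t [hS mt]]] := stable_subobject sM nM.
have [p [R [i [tR /iso_sym/isoP [g [mg _]]]]]] := stable_tube eigF hS.
have ls := tube_ladder i tR; have [p0 _ _ _] := ls; rewrite -(tube_seq1 R i) in g mg.
have [n [n0 lM]] := lenp_exists ls uM (mono_comp mt mg); case: n n0 lM => // n _ lM.
have [U [V [l0 lU lV UN NV]]] := Ext1_nonzero_removed ls lM nE.
have rr m X : lenp hQ (tube_seq R i) 1 m X -> ray_rep (R i) m X.
  by rewrite -(tube_seq1 R i); apply: (lenp_ray_rep ls).
exists p, R, i, (n.+1 %/ p)%N, (n.+1 %% p)%N, U, V; split; split=> //.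
- exact (tube_mouth_of_tube eigF tR lM).
- by rewrite ltn_mod.
- by rewrite -divn_eq; apply: rr.
- exact: rr.
- exact: rr.
Qed.

End Transverse.

Theorem theorem1p1 (R : realType) (Q : quiver) (hQ : affine_quiver Q)
  (M : rep R[i] Q) (hM : indecomposable M) :
  Tr M = [set N | Gr M N /\ Ext1_zero (rep_of_sub N) (rep_quot N)].
Proof.
apply/seteqP; rewrite /Tr; case: asboolP => r; split=> N.
- by move=> /= g; split=> //; apply: rigid_Ext1_subquotient.
- by case.
- move=> [g nT]; split=> //.
  exact/(nonrigid_Ext1_subquotient (@closed_has_eigenvectors _) hQ).
move=> [g E0]; split=> //.
exact/(nonrigid_Ext1_subquotient (@closed_has_eigenvectors _) hQ).
Qed.
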